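(* Let $s_j=\sigma_j+it_j$ ($j=1,2,3$) satisfy $\sigma_1\ge0$, $\sigma_2\ge0$, $\sigma_3>0$, $t_1\ge0$, $t_2\ge0$, $2\le t_3\le T$, $\sigma_1+\sigma_3\le1$, $\sigma_2+\sigma_3\le1$, $\sigma_1+\sigma_2+\sigma_3>\tfrac32$, with $s_1,s_2,\sigma_3$ fixed. Assume that as $t_3$ runs from $2$ to $T$ the point $(s_1,s_2,s_3)$ never lies on any of the hyperplanes $s_1+s_3=1$, $s_2+s_3=1$, $s_1+s_2+s_3=2$. Then as $T\to\infty$, $$\int_2^T|\zeta_{MT,2}(s_1,s_2,s_3)|^2dt_3=\zeta_{MT,2}^{[2]}(s_1,s_2,2\sigma_3)T+\begin{cases}O(T^{5/2-\sigma_1-\sigma_2-\sigma_3})&(\tfrac32<\sigma_1+\sigma_2+\sigma_3<2),\\ O((T\log T)^{1/2})&(\sigma_1+\sigma_2+\sigma_3=2),\end{cases}$$ where the implied constants depend on $s_1,s_2$ and $\sigma_3$.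
   Context: Write $s_j=\sigma_j+it_j$ with $\sigma_j,t_j\in\mathbb{R}$; complex powers $n^{s}=e^{s\log n}$ use the real logarithm. The Mordell–Tornheim double zeta-function is $\zeta_{MT,2}(s_1,s_2,s_3)=\sum_{m=1}^\infty\sum_{n=1}^\infty m^{-s_1}n^{-s_2}(m+n)^{-s_3}$, absolutely convergent for $\sigma_1+\sigma_3>1$, $\sigma_2+\sigma_3>1$, $\sigma_1+\sigma_2+\sigma_3>2$, and meromorphically continued to $\mathbb{C}^3$; $\zeta_{MT,2}$ denotes this continuation. Also $$\zeta_{MT,2}^{[2]}(s_1,s_2,s_3)=\sum_{k=2}^\infty\left|\sum_{m=1}^{k-1}\frac{1}{m^{s_1}(k-m)^{s_2}}\right|^2\frac{1}{k^{s_3}},$$ absolutely convergent when $2\sigma_1+\sigma_3>1$, $2\sigma_2+\sigma_3>1$, $2\sigma_1+2\sigma_2+\sigma_3>2$. *)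

(* Defs.v *)
From Stdlib Require Import Reals Lra List.
From Coquelicot Require Import Coquelicot.
Open Scope R_scope.

Definition cexp (z : C) : C :=
  (exp (Re z) * cos (Im z), exp (Re z) * sin (Im z)).

Definition npow_neg (n : nat) (s : C) : C :=
  cexp (Copp s * RtoC (ln (INR n)))%C.

Definition MT_term (s1 s2 s3 : C) (m n : nat) : C :=
  (npow_neg m s1 * npow_neg n s2 * npow_neg (m + n) s3)%C.

Definition MT_series_value (s1 s2 s3 : C) (v : C) : Prop :=
  exists inner : nat -> C,
    (forall m : nat,
       is_series (K := C_AbsRing) (V := C_NormedModule)
         (fun n => MT_term s1 s2 s3 (S m) (S n)) (inner m)) /\
    is_series (K := C_AbsRing) (V := C_NormedModule) inner v.

Definition MT_abs_region (s1 s2 s3 : C) : Prop :=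
  Re s1 + Re s3 > 1 /\ Re s2 + Re s3 > 1 /\ Re s1 + Re s2 + Re s3 > 2.

Definition MT_singular (s1 s2 s3 : C) : Prop :=
  (exists l : nat, (s1 + s3)%C = RtoC (1 - INR l)) \/
  (exists l : nat, (s2 + s3)%C = RtoC (1 - INR l)) \/
  (s1 + s2 + s3)%C = RtoC 2.

(* Z : C -> C is the meromorphic continuation of s3 |-> zeta_MT,2(s1,s2,s3):
   complex-differentiable off the singular locus and equal to the double
   series on the region of absolute convergence.  By the identity theorem
   (the complement of the discrete singular locus is connected) this
   determines Z uniquely off the singular locus. *)
Definition is_zetaMT2_in_s3 (s1 s2 : C) (Z : C -> C) : Prop :=
  (forall s3 : C, ~ MT_singular s1 s2 s3 ->
     ex_derive (K := C_AbsRing) (V := C_NormedModule) Z s3) /\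
  (forall s3 : C, MT_abs_region s1 s2 s3 -> MT_series_value s1 s2 s3 (Z s3)).

Definition inner_conv (s1 s2 : C) (k : nat) : C :=
  fold_right Cplus (RtoC 0)
    (map (fun m => (npow_neg m s1 * npow_neg (k - m) s2)%C) (seq 1 (k - 1))).

Definition rpow_neg (k : nat) (x : R) : R := exp (- x * ln (INR k)).

Definition zetaMT2_sq (s1 s2 : C) (x : R) : R :=
  Series (fun j => (Cmod (inner_conv s1 s2 (j + 2))) ^ 2 * rpow_neg (j + 2) x).

(* Main.v *)
Require Import Defs.
From Stdlib Require Import Reals Lra Lia Psatz Classical ClassicalEpsilon List Arith.
From Coquelicot Require Import Coquelicot.
Open Scope R_scope.

(** The hypotheses force [sigma1, sigma2 > 1/2] and [alpha := sigma1 + sigma2 + sigma3 < 2], so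
    the boundary case is vacuous. Collecting the terms with [m + n = k], the double series is
    the Dirichlet series of [a_k = sum_(m < k) m^(-s1) (k - m)^(-s2)], and comparing the sum with
    a Riemann sum of a function of bounded variation gives
    [a_k = B k^(1-s1-s2) + zeta(s1) k^(-s2) + zeta(s2) k^(-s1) + O(k^(-sigma1-sigma2))].
    Hence [B zeta(s1+s2+s3-1) + zeta(s1) zeta(s2+s3) + zeta(s2) zeta(s1+s3)] plus an absolutely
    convergent Dirichlet series continues the double zeta function to [Re s3 > 0]; by the identity
    theorem it is equal to [Z] on the quadrant [Re s3 > 0, Im s3 > 0], where there is no
    singularity. A Kusmin-Landau telescoping argument bounds the difference between [Z] and the
    partial sum over [k < N] by [O(N^(2-alpha) / t)] when [N] exceeds a multiple of [t], and with
    [N] of order [T] the mean square of the partial sum has diagonal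
    [T * sum |a_k|^2 k^(-2 sigma3)] and off-diagonal part [O(T^(5/2-alpha))]. *)

(** * Complex derivatives and the mean value inequality *)

(** Both sigma1 and sigma2 lie in (1/2, 1). Being below 1, they make the endpoint singularities of
    x^(-s1) (1-x)^(-s2) integrable, which is what the comparison with a Riemann sum rests on; the
    terms with zeta(s1) and zeta(s2) are the traces of these singularities. Having sum above 1, they
    make the remainder k^(-sigma1-sigma2) summable with room to spare, so its Dirichlet series is
    holomorphic on all of Re s3 > 0.

    [Z] is known only through its differentiability and through the double series far to the right.
    Its values on the line of integration therefore have to be recovered by complex analysis, for
    which integrals over rectangles suffice.

    The exponent 5/2 - alpha is that of a cross term: the Dirichlet polynomial has mean square O(T),
    the error N^(2-alpha) / t with N of order T has mean square O(T^(4-2 alpha)), and the geometric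
    mean of the two is T^(5/2-alpha). This exponent also leaves room to estimate the off-diagonal
    terms by absolute values, using log(l/i) >= (l-i)/l. *)

Definition derw (P : C -> Prop) (f : C -> C) (z l : C) : Prop :=
  forall eps, 0 < eps -> exists d, 0 < d /\
    forall h, P h -> Cmod h < d ->
      Cmod (f (z + h) - f z - l * h)%C <= eps * Cmod h.

Definition cder := derw (fun _ => True).

(** A curve is a function on [C] precomposed with [Re], and only real displacements count. Both
    [cder] and [rder] are thus instances of [derw], and one set of rules serves them, including the
    composition of a holomorphic function with a curve. *)
Definition rder (g : R -> C) (x : R) (l : C) : Prop :=
  derw (fun h => Im h = 0) (fun z => g (Re z)) (RtoC x) l.

Lemma Cmod_minus_sym (a b : C) : Cmod (a - b) = Cmod (b - a).
Proof. rewrite <- Cmod_opp. f_equal. ring. Qed.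

Lemma Cmod_triangle_le (a b : C) (x y : R) :
  Cmod a <= x -> Cmod b <= y -> Cmod (a + b) <= x + y.
Proof. intros; eapply Rle_trans; [apply Cmod_triangle | lra]. Qed.

Lemma Cmod_minus_le (a b : C) (x y : R) :
  Cmod a <= x -> Cmod b <= y -> Cmod (a - b) <= x + y.
Proof. intros; apply Cmod_triangle_le; [|rewrite Cmod_opp]; assumption. Qed.

Lemma Cmod_mult_le (a b : C) (x y : R) :
  Cmod a <= x -> Cmod b <= y -> Cmod (a * b) <= x * y.
Proof.
intros; rewrite Cmod_mult.
apply Rmult_le_compat; auto using Cmod_ge_0.
Qed.

Lemma Cmod_ge_minus (a b : C) : Cmod a - Cmod b <= Cmod (a + b).
Proof.
assert (Cmod a <= Cmod (a + b) + Cmod b); [|lra].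
replace a with ((a + b) + - b)%C at 1 by ring.
eapply Rle_trans; [apply Cmod_triangle|]; rewrite Cmod_opp; lra.
Qed.

Lemma im_le_Cmod (c : C) : Rabs (Im c) <= Cmod c.
Proof. eapply Rle_trans; [|apply (Rmax_Cmod c)]. apply Rmax_r. Qed.

Lemma Cmod_le_Re_Im (c : C) : Cmod c <= Rabs (Re c) + Rabs (Im c).
Proof.
replace c with (RtoC (Re c) + RtoC (Im c) * Ci)%C at 1
  by (apply injective_projections; simpl; unfold Re, Im; ring).
apply Cmod_triangle_le; [|rewrite Cmod_mult, Cmod_Ci, Rmult_1_r];
  rewrite Cmod_R; lra.
Qed.

Lemma Re_le_Cmod (c : C) : Re c <= Cmod c.
Proof. eapply Rle_trans; [apply Rle_abs|apply re_le_Cmod]. Qed.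

Section DerivativeRules.
Variable P : C -> Prop.

Lemma derw_const (c z : C) : derw P (fun _ => c) z 0.
Proof.
intros eps He; exists 1; split; [lra|]; intros h _ _.
replace (c - c - 0 * h)%C with (RtoC 0) by ring.
rewrite Cmod_0; apply Rmult_le_pos; [lra|apply Cmod_ge_0].
Qed.

Lemma derw_id (z : C) : derw P (fun z => z) z 1.
Proof.
intros eps He; exists 1; split; [lra|]; intros h _ _.
replace (z + h - z - 1 * h)%C with (RtoC 0) by ring.
rewrite Cmod_0; apply Rmult_le_pos; [lra|apply Cmod_ge_0].
Qed.

Lemma derw_ext_loc (f g : C -> C) (z l : C) (r : R) :
  0 < r -> (forall w, Cmod (w - z) < r -> f w = g w) ->
  derw P f z l -> derw P g z l.
Proof.
intros Hr Hfg Hf eps He; destruct (Hf eps He) as [d [Hd H]].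
exists (Rmin d r); split; [apply Rmin_pos; lra|].
intros h Ph Hh.
rewrite <- !Hfg.
- apply H; auto; eapply Rlt_le_trans; [exact Hh|apply Rmin_l].
- replace (z - z)%C with (RtoC 0) by ring; rewrite Cmod_0; lra.
- replace (z + h - z)%C with h by ring.
  eapply Rlt_le_trans; [exact Hh|apply Rmin_r].
Qed.

Lemma derw_ext (f g : C -> C) (z l : C) :
  (forall w, f w = g w) -> derw P f z l -> derw P g z l.
Proof. intros H; apply (derw_ext_loc _ _ _ _ 1); auto; lra. Qed.

Lemma derw_eq (f : C -> C) (z l l' : C) :
  l = l' -> derw P f z l -> derw P f z l'.
Proof. intros ->; auto. Qed.

Lemma derw_plus (f g : C -> C) (z a b : C) :
  derw P f z a -> derw P g z b -> derw P (fun w => f w + g w)%C z (a + b)%C.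
Proof.
intros Hf Hg eps He.
destruct (Hf (eps/2) ltac:(lra)) as [d1 [Hd1 H1]].
destruct (Hg (eps/2) ltac:(lra)) as [d2 [Hd2 H2]].
exists (Rmin d1 d2); split; [apply Rmin_pos; lra|]; intros h Ph Hh.
replace (f (z+h) + g (z+h) - (f z + g z) - (a+b)*h)%C
  with ((f (z+h) - f z - a*h) + (g (z+h) - g z - b*h))%C by ring.
eapply Rle_trans.
- apply Cmod_triangle_le; [apply H1|apply H2]; auto;
  (eapply Rlt_le_trans; [exact Hh|]); [apply Rmin_l|apply Rmin_r].
- lra.
Qed.

Lemma derw_lip (f : C -> C) (z a : C) :
  derw P f z a -> exists d, 0 < d /\ forall h, P h -> Cmod h < d ->
    Cmod (f (z + h) - f z)%C <= (Cmod a + 1) * Cmod h.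
Proof.
intros Hf; destruct (Hf 1 ltac:(lra)) as [d [Hd H]].
exists d; split; auto; intros h Ph Hh.
replace (f (z+h) - f z)%C with ((f (z+h) - f z - a * h) + a * h)%C by ring.
eapply Rle_trans; [apply Cmod_triangle|]; rewrite Cmod_mult.
specialize (H h Ph Hh); lra.
Qed.

Lemma derw_mult (f g : C -> C) (z a b : C) :
  derw P f z a -> derw P g z b ->
  derw P (fun w => f w * g w)%C z (a * g z + f z * b)%C.
Proof.
intros Hf Hg eps He.
destruct (derw_lip _ _ _ Hf) as [d0 [Hd0 H0]].
pose proof (Cmod_ge_0 a) as Ha; pose proof (Cmod_ge_0 b) as Hb.
pose proof (Cmod_ge_0 (f z)) as Hfz; pose proof (Cmod_ge_0 (g z)) as Hgz.
destruct (derw_lip _ _ _ Hg) as [d3 [Hd3 H3]].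
destruct (Hf (eps/(3*(1+Cmod (g z)))) ltac:(apply Rdiv_lt_0_compat; nra))
  as [d1 [Hd1 H1]].
destruct (Hg (eps/(3*(1+Cmod (f z)))) ltac:(apply Rdiv_lt_0_compat; nra))
  as [d2 [Hd2 H2]].
(* Controls the product of the two increments, which is quadratic in [h]. *)
set (d4 := eps / (3 * ((Cmod a + 1)*(Cmod b + 1)))).
assert (Hd4 : 0 < d4) by (apply Rdiv_lt_0_compat; nra).
exists (Rmin (Rmin d0 d3) (Rmin d4 (Rmin d1 d2))); split.
{ repeat apply Rmin_pos; lra. }
intros h Ph Hh.
apply Rmin_Rgt in Hh as [Hh1 Hh]; apply Rmin_Rgt in Hh1 as [Hh0 Hh3].
apply Rmin_Rgt in Hh as [Hh4 Hh]; apply Rmin_Rgt in Hh as [Hh1 Hh2].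
specialize (H0 h Ph ltac:(lra)); specialize (H1 h Ph ltac:(lra)).
specialize (H2 h Ph ltac:(lra)); specialize (H3 h Ph ltac:(lra)).
replace (f (z+h) * g (z+h) - f z * g z - (a * g z + f z * b) * h)%C
 with ((f (z+h) - f z - a*h) * g z + f z * (g (z+h) - g z - b * h)
       + (f (z+h) - f z) * (g (z+h) - g z))%C by ring.
pose proof (Cmod_ge_0 h) as Hh'.
assert (E1 : Cmod ((f (z+h) - f z - a*h) * g z)%C <= eps/3 * Cmod h).
{ rewrite Cmod_mult. eapply Rle_trans; [apply Rmult_le_compat_r, H1; lra|].
  replace (eps / (3 * (1 + Cmod (g z))) * Cmod h * Cmod (g z)) with
    (eps / 3 * Cmod h * (Cmod (g z) / (1 + Cmod (g z)))) by (field; lra).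
  assert (Cmod (g z) / (1 + Cmod (g z)) <= 1)
    by (apply Rle_div_l; lra).
  assert (0 <= eps / 3 * Cmod h) by nra. nra. }
assert (E2 : Cmod (f z * (g (z+h) - g z - b*h))%C <= eps/3 * Cmod h).
{ rewrite Cmod_mult. eapply Rle_trans; [apply Rmult_le_compat_l, H2; lra|].
  replace (Cmod (f z) * (eps / (3 * (1 + Cmod (f z))) * Cmod h)) with
    (eps / 3 * Cmod h * (Cmod (f z) / (1 + Cmod (f z)))) by (field; lra).
  assert (Cmod (f z) / (1 + Cmod (f z)) <= 1)
    by (apply Rle_div_l; lra).
  assert (0 <= eps / 3 * Cmod h) by nra. nra. }
assert (E3 : Cmod ((f (z+h) - f z) * (g (z+h) - g z))%C <= eps/3 * Cmod h).
{ eapply Rle_trans; [apply (Cmod_mult_le _ _ _ _ H0 H3)|].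
  replace ((Cmod a + 1) * Cmod h * ((Cmod b + 1) * Cmod h)) with
   ((Cmod a + 1)* (Cmod b + 1) * Cmod h * Cmod h) by ring.
  apply Rmult_le_compat_r; [lra|].
  apply Rle_trans with ((Cmod a + 1)* (Cmod b + 1) * d4).
  - apply Rmult_le_compat_l; nra.
  - unfold d4; right; field; nra. }
eapply Rle_trans; [apply Cmod_triangle_le; [apply Cmod_triangle_le; [exact E1|exact E2]|exact E3]|].
lra.
Qed.

Lemma derw_comp (F f : C -> C) (z l m : C) :
  derw P f z l -> cder F (f z) m -> derw P (fun w => F (f w)) z (m * l)%C.
Proof.
intros Hf HF eps He.
pose proof (Cmod_ge_0 l) as Hl; pose proof (Cmod_ge_0 m) as Hm.
destruct (derw_lip _ _ _ Hf) as [d0 [Hd0 H0]].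
destruct (HF (eps / (2 * (Cmod l + 1))) ltac:(apply Rdiv_lt_0_compat; lra))
  as [d1 [Hd1 H1]].
destruct (Hf (eps / (2 * (Cmod m + 1))) ltac:(apply Rdiv_lt_0_compat; lra))
  as [d2 [Hd2 H2]].
set (d3 := d1 / (Cmod l + 1)).
assert (Hd3 : 0 < d3) by (apply Rdiv_lt_0_compat; lra).
exists (Rmin d0 (Rmin d2 d3)); split; [repeat apply Rmin_pos; lra|].
intros h Ph Hh.
apply Rmin_Rgt in Hh as [Hh0 Hh]; apply Rmin_Rgt in Hh as [Hh2 Hh3].
specialize (H0 h Ph ltac:(lra)); specialize (H2 h Ph ltac:(lra)).
set (k := (f (z+h) - f z)%C) in *.
assert (Hk : Cmod k < d1).
{ eapply Rle_lt_trans; [exact H0|].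
  apply Rlt_le_trans with ((Cmod l + 1) * d3);
   [apply Rmult_lt_compat_l; lra|unfold d3; right; field; lra]. }
specialize (H1 k I Hk).
replace (f (z+h)%C) with (f z + k)%C by (unfold k; ring).
replace (F (f z + k) - F (f z) - m * l * h)%C with
  ((F (f z + k) - F (f z) - m * k) + m * (k - l * h))%C by ring.
eapply Rle_trans; [apply Cmod_triangle_le; [exact H1|
  apply (Cmod_mult_le _ _ _ _ (Rle_refl _) H2)]|].
assert (eps / (2 * (Cmod l + 1)) * Cmod k <= eps / 2 * Cmod h).
{ eapply Rle_trans; [apply Rmult_le_compat_l, H0;
    left; apply Rdiv_lt_0_compat; lra|]. right; field; lra. }
assert (Cmod m * (eps / (2 * (Cmod m + 1)) * Cmod h) <= eps / 2 * Cmod h).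
{ replace (Cmod m * (eps / (2 * (Cmod m + 1)) * Cmod h)) with
    (eps / 2 * Cmod h * (Cmod m / (Cmod m + 1))) by (field; lra).
  assert (Cmod m / (Cmod m + 1) <= 1) by (apply Rle_div_l; lra).
  assert (0 <= eps / 2 * Cmod h) by (pose proof (Cmod_ge_0 h); nra). nra. }
lra.
Qed.

Lemma derw_cont (f : C -> C) (z l : C) :
  derw P f z l -> forall eps, 0 < eps -> exists d, 0 < d /\
    forall h, P h -> Cmod h < d -> Cmod (f (z + h) - f z)%C < eps.
Proof.
intros H eps He; destruct (derw_lip _ _ _ H) as [d [Hd H1]].
pose proof (Cmod_ge_0 l) as Hl.
assert (Hq : 0 < eps / (Cmod l + 1)) by (apply Rdiv_lt_0_compat; lra).
exists (Rmin d (eps / (Cmod l + 1))); split; [apply Rmin_pos; lra|].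
intros h Ph Hh; apply Rmin_Rgt in Hh as [Hh0 Hh].
eapply Rle_lt_trans; [apply H1; auto; lra|].
apply Rlt_le_trans with ((Cmod l + 1) * (eps / (Cmod l + 1)));
  [apply Rmult_lt_compat_l; lra|right; field; lra].
Qed.

End DerivativeRules.

Lemma derw_scal (P : C -> Prop) (f : C -> C) (c z l : C) :
  derw P f z l -> derw P (fun w => c * f w)%C z (c * l)%C.
Proof.
intros H; eapply derw_eq; [|apply derw_mult; [apply derw_const|exact H]].
cbv beta; ring.
Qed.

Lemma derw_opp (P : C -> Prop) (f : C -> C) (z l : C) :
  derw P f z l -> derw P (fun w => - f w)%C z (- l)%C.
Proof.
intros H; apply (derw_eq _ _ _ (- (1) * l)%C); [ring|].
apply (derw_ext _ (fun w => - (1) * f w)%C); [intros w; ring|].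
apply derw_scal, H.
Qed.

Lemma derw_minus (P : C -> Prop) (f g : C -> C) (z a b : C) :
  derw P f z a -> derw P g z b -> derw P (fun w => f w - g w)%C z (a - b)%C.
Proof. intros; apply derw_plus; auto using derw_opp. Qed.

Lemma cder_inv (z : C) : z <> 0 -> cder Cinv z (- / (z * z))%C.
Proof.
intros Hz eps He.
assert (Hm : 0 < Cmod z) by (apply Cmod_gt_0; auto).
set (m := Cmod z) in *.
(* The remainder is h^2 / (z^2 (z + h)), and |z + h| >= |z| / 2. *)
set (d1 := eps * (m * m * m) / 2).
assert (Hd1 : 0 < d1) by (unfold d1; apply Rdiv_lt_0_compat; [|lra];
  repeat apply Rmult_lt_0_compat; lra).
exists (Rmin (m/2) d1); split; [apply Rmin_pos; lra|].
intros h _ Hh; apply Rmin_Rgt in Hh as [Hh1 Hh2].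
assert (Hzh : m / 2 <= Cmod (z + h)).
{ pose proof (Cmod_ge_minus z h); unfold m in *; lra. }
assert (Nzh : (z + h)%C <> 0) by (intros E; rewrite E, Cmod_0 in Hzh; lra).
replace (/ (z + h) - / z - - / (z * z) * h)%C
  with (h * h * / (z * z * (z + h)))%C by (field; auto).
rewrite !Cmod_mult, Cmod_inv, !Cmod_mult
  by (repeat apply Cmult_neq_0; auto).
fold m. pose proof (Cmod_ge_0 h).
assert (/ (m * m * Cmod (z+h)) <= 2 / (m * m * m)).
{ replace (2 / (m*m*m)) with (/ (m * m * (m/2))) by (field; lra).
  apply Rinv_le_contravar; [|apply Rmult_le_compat_l; nra].
  apply Rmult_lt_0_compat; [nra|lra]. }
replace (Cmod h * Cmod h * / (m * m * Cmod (z + h))) with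
  ((Cmod h * / (m * m * Cmod (z + h))) * Cmod h) by ring.
apply Rmult_le_compat_r; auto.
apply Rle_trans with (d1 * (2 / (m*m*m))).
- apply Rmult_le_compat; try lra.
  left; apply Rinv_0_lt_compat; apply Rmult_lt_0_compat; [nra|lra].
- unfold d1; right; field; lra.
Qed.

Lemma rder_RtoC (f : R -> R) (x l : R) :
  is_derive f x l -> rder (fun t => RtoC (f t)) x (RtoC l).
Proof.
intros [_ H] eps He.
destruct (H x (fun P HP => HP) (mkposreal _ He)) as [d Hd].
exists d; split; [apply cond_pos|].
intros h Ph Hh.
destruct h as [a b]; simpl in Ph; subst b; simpl.
change (a, 0) with (RtoC a) in *. rewrite Cmod_R in *.
rewrite <- RtoC_mult, <- !RtoC_minus, Cmod_R.
specialize (Hd (x + a)).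
unfold minus, plus, opp, scal, norm, ball in Hd; simpl in Hd.
unfold AbsRing_ball, abs, minus, plus, opp, mult, mult in Hd; simpl in Hd.
replace (x + a + - x) with a in Hd by ring.
specialize (Hd Hh).
replace (f (x + a) - f x - l * a) with (f (x + a) + - f x + - (a * l)) by ring.
exact Hd.
Qed.

Lemma rder_is_derive (g : R -> C) (x : R) (l c : C) :
  rder g x l -> is_derive (fun t => Re (c * g t)%C) x (Re (c * l)%C).
Proof.
intros H; split; [apply is_linear_scal_l|].
intros y Hy.
replace y with x by (apply is_filter_lim_locally_unique; exact Hy).
intros eps.
assert (Hc := Cmod_ge_0 c). pose proof (cond_pos eps) as He.
destruct (H (eps / (Cmod c + 1)) ltac:(apply Rdiv_lt_0_compat; lra))
  as [d [Hd Hd']].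
exists (mkposreal d Hd); intros t Ht; change R in t; change (Rabs (t - x) < d) in Ht.
specialize (Hd' (RtoC (t - x)) eq_refl).
rewrite Cmod_R in Hd'. specialize (Hd' Ht).
rewrite <- RtoC_plus in Hd'; simpl in Hd'.
replace (x + (t - x)) with t in Hd' by ring.
set (E := (g t - g x - l * RtoC (t-x))%C) in *.
unfold norm, minus, plus, opp, scal; simpl. unfold abs, mult; simpl.
assert (HE : Rabs (Re (c * E)%C) <= Cmod c * Cmod E)
  by (rewrite <- Cmod_mult; apply re_le_Cmod).
match goal with |- Rabs ?A <= _ => replace A with (Re (c * E)%C) end.
2: { unfold E, Re, Im; simpl; ring. }
eapply Rle_trans; [exact HE|].
eapply Rle_trans; [apply Rmult_le_compat_l, Hd'; lra|].
change (t + - x) with (t - x).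
replace (Cmod c * (eps / (Cmod c + 1) * Rabs (t - x))) with
  ((Cmod c / (Cmod c + 1)) * (eps * Rabs (t - x))) by (field; lra).
assert (Cmod c / (Cmod c + 1) <= 1) by (apply Rle_div_l; lra).
assert (0 <= eps * Rabs (t-x)) by (pose proof (Rabs_pos (t-x)); nra). nra.
Qed.

Lemma exists_phase (z : C) : exists u, Cmod u = 1 /\ Re (u * z)%C = Cmod z.
Proof.
destruct (Req_dec (Cmod z) 0) as [H|H].
- exists 1; split; [apply Cmod_1|].
  rewrite H; apply Cmod_eq_0 in H; rewrite H; simpl; ring.
- pose proof (Cmod_ge_0 z).
  exists (RtoC (/ Cmod z) * Cconj z)%C; split.
  + rewrite Cmod_mult, Cmod_conj, Cmod_R, Rabs_inv, Rabs_pos_eq by lra; field; auto.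
  + transitivity (/ Cmod z * Cmod z ^ 2); [|field; auto].
    rewrite Cmod2_alt; unfold Re, Im; simpl; ring.
Qed.

(* Apply the real mean value theorem to [Re (u * g) - v], where [u] is the phase making
   [u * (g b - g a)] real and nonnegative. *)
Lemma mean_value_ineq (g g' : R -> C) (v v' : R -> R) (a b : R) :
  a <= b ->
  (forall x, a <= x <= b -> rder g x (g' x)) ->
  (forall x, a <= x <= b -> is_derive v x (v' x)) ->
  (forall x, a <= x <= b -> Cmod (g' x) <= v' x) ->
  Cmod (g b - g a) <= v b - v a.
Proof.
intros Hab Hg Hv Hgv.
destruct (exists_phase (g b - g a)) as [u [Hu ED]].
set (w := fun t => Re (u * g t)%C - v t).
assert (Hw : forall x, a <= x <= b -> is_derive w x (Re (u * g' x)%C - v' x)).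
{ intros x Hx; apply (is_derive_minus (fun t => Re (u * g t)%C) v); auto.
  apply rder_is_derive, Hg; auto. }
destruct (MVT_gen w a b (fun x => Re (u * g' x)%C - v' x)) as [c [Hc Ec]].
- intros x Hx; apply Hw; rewrite Rmin_left, Rmax_right in Hx; lra.
- intros x Hx; rewrite Rmin_left, Rmax_right in Hx by lra.
  apply continuity_pt_filterlim, (ex_derive_continuous w x).
  eexists; apply Hw; lra.
- rewrite Rmin_left, Rmax_right in Hc by lra.
  assert (Hw' : Re (u * g' c)%C <= v' c).
  { eapply Rle_trans; [apply Re_le_Cmod|]. rewrite Cmod_mult, Hu, Rmult_1_l; auto. }
  assert (Hle : w b - w a <= 0) by (rewrite Ec; nra).
  assert (Re (u * (g b - g a))%C = Re (u * g b)%C - Re (u * g a)%C)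
    by (unfold Re; simpl; ring).
  unfold w in Hle; lra.
Qed.

Lemma cder_rder_line (f : C -> C) (p q : C) (t : R) (l : C) :
  cder f (p + RtoC t * q)%C l ->
  rder (fun t => f (p + RtoC t * q)%C) t (l * q)%C.
Proof.
intros H; unfold rder.
apply (derw_comp _ f (fun z => p + RtoC (Re z) * q)%C); [|exact H].
eapply derw_eq; [|apply derw_plus; [apply derw_const|
  eapply (derw_mult _ (fun z => RtoC (Re z)) (fun _ => q));
  [|apply derw_const]]].
2: { apply rder_RtoC, (is_derive_id (K:=R_AbsRing)). }
simpl. change one with 1. ring.
Qed.

Lemma mean_value_ineq_line (f f' : C -> C) (p q : C) (M : R) :
  (forall t, 0 <= t <= 1 -> cder f (p + RtoC t * (q - p)) (f' (p + RtoC t * (q - p)))%C) ->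
  (forall t, 0 <= t <= 1 -> Cmod (f' (p + RtoC t * (q - p))%C) <= M) ->
  Cmod (f q - f p) <= M * Cmod (q - p).
Proof.
intros Hd Hb.
pose proof (mean_value_ineq (fun t => f (p + RtoC t * (q - p))%C)
  (fun t => f' (p + RtoC t * (q - p))%C * (q - p))%C
  (fun t => M * Cmod (q - p) * t) (fun _ => M * Cmod (q - p)) 0 1 ltac:(lra)) as H.
cbv beta in H.
replace (p + 1 * (q - p))%C with q in H by ring.
replace (p + 0 * (q - p))%C with p in H by ring.
rewrite Rmult_1_r, Rmult_0_r, Rminus_0_r in H.
apply H.
- intros x Hx; apply (cder_rder_line f), Hd, Hx.
- intros x Hx. auto_derive; auto; ring.
- intros x Hx. apply Cmod_mult_le; auto; lra.
Qed.

(** * The exponential function *)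

Lemma cexp_plus (a b : C) : cexp (a + b) = (cexp a * cexp b)%C.
Proof.
unfold cexp; apply injective_projections; simpl;
  unfold Re, Im; simpl; rewrite exp_plus, ?cos_plus, ?sin_plus; ring.
Qed.

Lemma cexp_0 : cexp 0 = RtoC 1.
Proof.
unfold cexp; apply injective_projections; simpl;
 rewrite exp_0, ?cos_0, ?sin_0; ring.
Qed.

Lemma Cmod_cexp (z : C) : Cmod (cexp z) = exp (Re z).
Proof.
replace (cexp z) with (RtoC (exp (Re z)) * (cos (Im z), sin (Im z)))%C
  by (unfold cexp; apply injective_projections; simpl; ring).
rewrite Cmod_mult, Cmod_R, Rabs_pos_eq by (left; apply exp_pos).
unfold Cmod; simpl.
replace (cos (Im z) * (cos (Im z) * 1) + sin (Im z) * (sin (Im z) * 1)) with 1.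
- rewrite sqrt_1; ring.
- generalize (sin2_cos2 (Im z)); unfold Rsqr; lra.
Qed.

Lemma cexp_RtoC (x : R) : cexp (RtoC x) = RtoC (exp x).
Proof.
unfold cexp; apply injective_projections; simpl; rewrite ?cos_0, ?sin_0; ring.
Qed.

Lemma rder_pair (f g : R -> R) (x a b : R) :
  is_derive f x a -> is_derive g x b -> rder (fun t => (f t, g t)) x (a, b).
Proof.
intros Hf Hg; unfold rder.
eapply derw_eq; [|eapply derw_ext; [|
  apply derw_plus; [apply (rder_RtoC _ _ _ Hf)|
    apply derw_mult; [apply (derw_const _ Ci)|apply (rder_RtoC _ _ _ Hg)]]]].
- apply injective_projections; simpl; ring.
- intros w; simpl; apply injective_projections; simpl; ring.
Qed.

Lemma rder_cexp_line (z : C) (t : R) :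
  rder (fun t => cexp (RtoC t * z)) t (z * cexp (RtoC t * z))%C.
Proof.
eapply derw_eq; [|eapply (derw_ext _ (fun w : C =>
  (exp (Re w * Re z) * cos (Re w * Im z), exp (Re w * Re z) * sin (Re w * Im z)))); [|
 apply (rder_pair (fun t => exp (t * Re z) * cos (t * Im z))
   (fun t => exp (t * Re z) * sin (t * Im z)) t); auto_derive; auto; reflexivity]].
- unfold cexp; apply injective_projections; simpl; unfold Re, Im; simpl;
  replace (t * fst z - 0 * snd z) with (t * fst z) by ring;
  replace (t * snd z + 0 * fst z) with (t * snd z) by ring; ring.
- intros w; unfold cexp; simpl; unfold Re, Im; simpl;
  replace (fst w * fst z - 0 * snd z) with (fst w * fst z) by ring;
  replace (fst w * snd z + 0 * fst z) with (fst w * snd z) by ring; reflexivity.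
Qed.

Lemma exp_le (x y : R) : x <= y -> exp x <= exp y.
Proof. intros [H|H]; [left; apply exp_increasing|right; f_equal]; auto. Qed.

(** The Taylor bounds carry a parameter [u] because each one integrates the previous one along the
    segment from 0 to [z], and so needs it at every point of the segment. *)
Lemma cexp_taylor1_unit (z : C) (u : R) : 0 <= u <= 1 ->
  Cmod (cexp (RtoC u * z) - 1)%C <= Cmod z * exp (Cmod z) * u.
Proof.
intros Hu.
pose proof (mean_value_ineq (fun t => cexp (RtoC t * z)) (fun t => z * cexp (RtoC t * z))%C
  (fun t => Cmod z * exp (Cmod z) * t) (fun _ => Cmod z * exp (Cmod z)) 0 u ltac:(lra)) as H.
cbv beta in H.
replace (0 * z)%C with (RtoC 0) in H by ring. rewrite cexp_0 in H.
rewrite Rmult_0_r, Rminus_0_r in H. apply H.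
- intros; apply rder_cexp_line.
- intros; auto_derive; auto; ring.
- intros x Hx; apply Cmod_mult_le; [lra|]. rewrite Cmod_cexp.
  apply exp_le. eapply Rle_trans; [apply Re_le_Cmod|].
  rewrite Cmod_mult, Cmod_R, Rabs_pos_eq by lra.
  pose proof (Cmod_ge_0 z); nra.
Qed.

Lemma cexp_taylor2_unit (z : C) (u : R) : 0 <= u <= 1 ->
  Cmod (cexp (RtoC u * z) - 1 - RtoC u * z)%C <= Cmod z ^ 2 * exp (Cmod z) / 2 * u ^ 2.
Proof.
intros Hu.
pose proof (mean_value_ineq (fun t => cexp (RtoC t * z) - 1 - RtoC t * z)%C
  (fun t => z * (cexp (RtoC t * z) - 1))%C
  (fun t => Cmod z ^ 2 * exp (Cmod z) / 2 * t ^ 2)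
  (fun t => Cmod z ^ 2 * exp (Cmod z) * t) 0 u ltac:(lra)) as H.
cbv beta in H.
replace (0 * z)%C with (RtoC 0) in H by ring. rewrite cexp_0 in H.
replace (Cmod z ^ 2 * exp (Cmod z) / 2 * u ^ 2 - Cmod z ^ 2 * exp (Cmod z) / 2 * 0 ^ 2)
  with (Cmod z ^ 2 * exp (Cmod z) / 2 * u ^ 2) in H by ring.
replace (cexp (RtoC u * z) - 1 - RtoC u * z - (1 - 1 - 0))%C with
 (cexp (RtoC u * z) - 1 - RtoC u * z)%C in H by ring.
apply H.
- intros x Hx. unfold rder.
  eapply derw_eq; [|apply derw_minus; [apply derw_minus; [apply rder_cexp_line|apply derw_const]|
    apply derw_mult; [apply rder_RtoC, (is_derive_id (K:=R_AbsRing))|apply derw_const]]].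
  simpl; change one with 1; ring.
- intros; auto_derive; auto; field.
- intros x Hx; replace (Cmod z ^ 2 * exp (Cmod z) * x) with
   (Cmod z * (Cmod z * exp (Cmod z) * x)) by ring.
  apply Cmod_mult_le; [lra|]. apply cexp_taylor1_unit; lra.
Qed.

Lemma cexp_taylor3_unit (z : C) (u : R) : 0 <= u <= 1 ->
  Cmod (cexp (RtoC u * z) - 1 - RtoC u * z - RtoC u * RtoC u * z * z / 2)%C
  <= Cmod z ^ 3 * exp (Cmod z) / 6 * u ^ 3.
Proof.
intros Hu.
pose proof (mean_value_ineq (fun t => cexp (RtoC t * z) - 1 - RtoC t * z - RtoC t * RtoC t * z * z / 2)%C
  (fun t => z * (cexp (RtoC t * z) - 1 - RtoC t * z))%C
  (fun t => Cmod z ^ 3 * exp (Cmod z) / 6 * t ^ 3)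
  (fun t => Cmod z ^ 3 * exp (Cmod z) / 2 * t ^ 2) 0 u ltac:(lra)) as H.
cbv beta in H.
replace (0 * z)%C with (RtoC 0) in H by ring. rewrite cexp_0 in H.
replace (Cmod z ^ 3 * exp (Cmod z) / 6 * u ^ 3 - Cmod z ^ 3 * exp (Cmod z) / 6 * 0 ^ 3)
  with (Cmod z ^ 3 * exp (Cmod z) / 6 * u ^ 3) in H by field.
match type of H with _ -> _ -> _ -> Cmod ?A <= _ => replace A with
 (cexp (RtoC u * z) - 1 - RtoC u * z - RtoC u * RtoC u * z * z / 2)%C in H by field end.
apply H.
- intros x Hx. unfold rder.
  eapply derw_eq; [|apply derw_minus; [apply derw_minus; [
    apply derw_minus; [apply rder_cexp_line|apply derw_const]|
    apply derw_mult; [apply rder_RtoC, (is_derive_id (K:=R_AbsRing))|apply derw_const]]|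
    apply derw_mult; [apply derw_mult; [apply derw_mult; [apply derw_mult|]|]|];
    [apply rder_RtoC, (is_derive_id (K:=R_AbsRing))|
     apply rder_RtoC, (is_derive_id (K:=R_AbsRing))|apply derw_const..]]].
  simpl; change one with 1; field.
- intros; auto_derive; auto; field.
- intros x Hx; replace (Cmod z ^ 3 * exp (Cmod z) / 2 * x ^ 2) with
   (Cmod z * (Cmod z ^ 2 * exp (Cmod z) / 2 * x ^ 2)) by field.
  apply Cmod_mult_le; [lra|]. apply cexp_taylor2_unit; lra.
Qed.

Lemma cexp_taylor2 (z : C) :
  Cmod (cexp z - 1 - z)%C <= Cmod z ^ 2 * exp (Cmod z) / 2.
Proof.
generalize (cexp_taylor2_unit z 1 ltac:(lra)).
replace (1 * z)%C with z by ring. rewrite pow1, Rmult_1_r; auto.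
Qed.

Lemma cexp_taylor3 (z : C) :
  Cmod (cexp z - 1 - z - z * z / 2)%C <= Cmod z ^ 3 * exp (Cmod z) / 6.
Proof.
generalize (cexp_taylor3_unit z 1 ltac:(lra)).
replace (1 * 1 * z * z)%C with (z * z)%C by ring.
replace (1 * z)%C with z by ring. rewrite pow1, Rmult_1_r; auto.
Qed.

Lemma cder_cexp (z : C) : cder cexp z (cexp z).
Proof.
intros eps He.
pose proof (exp_pos (Re z)) as Hez. pose proof (exp_pos 1) as He1.
set (m := exp (Re z) * exp 1).
assert (Hm : 0 < m) by (apply Rmult_lt_0_compat; auto).
exists (Rmin 1 (eps / m)); split; [apply Rmin_pos; [lra|apply Rdiv_lt_0_compat; lra]|].
intros h _ Hh; apply Rmin_Rgt in Hh as [Hh1 Hh2].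
rewrite cexp_plus.
replace (cexp z * cexp h - cexp z - cexp z * h)%C with (cexp z * (cexp h - 1 - h))%C by ring.
rewrite Cmod_mult, Cmod_cexp.
pose proof (cexp_taylor2 h) as H2. pose proof (Cmod_ge_0 h) as H0.
assert (exp (Cmod h) <= exp 1) by (apply exp_le; lra).
assert (Cmod (cexp h - 1 - h)%C <= Cmod h * Cmod h * exp 1).
{ eapply Rle_trans; [exact H2|].
  assert (0 <= Cmod h ^2) by nra. pose proof (exp_pos (Cmod h)). nra. }
eapply Rle_trans; [apply Rmult_le_compat_l; [lra|eassumption]|].
replace (exp (Re z) * (Cmod h * Cmod h * exp 1)) with (m * Cmod h * Cmod h) by (unfold m; ring).
apply Rmult_le_compat_r; auto.
apply Rle_trans with (m * (eps / m)); [apply Rmult_le_compat_l; lra|].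
right; field; lra.
Qed.

(** * Complex powers of positive reals *)

Definition xpow (x : R) (s : C) : C := cexp (s * RtoC (ln x)).

Lemma npow_neg_xpow (n : nat) (s : C) : npow_neg n s = xpow (INR n) (- s).
Proof. reflexivity. Qed.

Lemma xpow_plus (x : R) (s w : C) : xpow x (s + w) = (xpow x s * xpow x w)%C.
Proof. unfold xpow; rewrite <- cexp_plus; f_equal; ring. Qed.

Lemma xpow_1 (x : R) : 0 < x -> xpow x 1 = RtoC x.
Proof.
intros; unfold xpow. rewrite Cmult_1_l, cexp_RtoC, exp_ln; auto.
Qed.

Lemma xpow_0 (x : R) : xpow x 0 = RtoC 1.
Proof. unfold xpow; rewrite Cmult_0_l; apply cexp_0. Qed.

Lemma xpow_base_1 (s : C) : xpow 1 s = RtoC 1.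
Proof. unfold xpow; rewrite ln_1, Cmult_0_r; apply cexp_0. Qed.

Lemma xpow_succ (x : R) (s : C) : 0 < x -> xpow x (s + 1) = (RtoC x * xpow x s)%C.
Proof. intros; rewrite xpow_plus, xpow_1 by auto; ring. Qed.

Lemma Cmod_xpow (x : R) (s : C) : Cmod (xpow x s) = Rpower x (Re s).
Proof.
unfold xpow; rewrite Cmod_cexp; unfold Rpower; f_equal.
unfold Re; simpl; ring.
Qed.

Lemma rder_xpow (x : R) (s : C) : 0 < x ->
  rder (fun x => xpow x s) x (s * xpow x (s - 1))%C.
Proof.
intros Hx; unfold rder, xpow.
eapply derw_eq; [|apply (derw_comp _ cexp (fun z => s * RtoC (ln (Re z)))%C);
 [apply derw_scal; apply (rder_RtoC ln x (/ x)); auto_derive; [auto|field; lra]|apply cder_cexp]].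
simpl.
replace ((s - 1) * RtoC (ln x))%C with (s * RtoC (ln x) + - RtoC (ln x))%C by ring.
rewrite cexp_plus, <- RtoC_opp, cexp_RtoC, exp_Ropp, exp_ln by auto. ring.
Qed.

Lemma cder_xpow (x : R) (s : C) :
  cder (xpow x) s (RtoC (ln x) * xpow x s)%C.
Proof.
unfold cder, xpow.
eapply derw_eq; [|apply (derw_comp _ cexp (fun w => w * RtoC (ln x))%C);
 [apply derw_mult; [apply derw_id|apply derw_const]|apply cder_cexp]].
cbv beta; ring.
Qed.

Lemma Rpower_pos (x y : R) : 0 < Rpower x y.
Proof. apply exp_pos. Qed.

Lemma Rpower_le_base (x y e : R) : 0 <= e -> 0 < x <= y -> Rpower x e <= Rpower y e.
Proof.
intros He Hxy; unfold Rpower; apply exp_le, Rmult_le_compat_l; auto.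
destruct (proj2 Hxy) as [H|H]; [left; apply ln_increasing; lra|right; f_equal; auto].
Qed.

Lemma Rpower_le_base_neg (x y e : R) : e <= 0 -> 0 < x <= y -> Rpower y e <= Rpower x e.
Proof.
intros He Hxy; unfold Rpower; apply exp_le.
assert (ln x <= ln y); [|nra].
destruct (proj2 Hxy) as [H|H]; [left; apply ln_increasing; lra|right; f_equal; auto].
Qed.

Lemma ln_nonneg (x : R) : 1 <= x -> 0 <= ln x.
Proof.
intros [H|H]; [|subst; rewrite ln_1; lra].
rewrite <- ln_1; left; apply ln_increasing; lra.
Qed.

Lemma Rpower_le_exp (x a b : R) : 1 <= x -> a <= b -> Rpower x a <= Rpower x b.
Proof.
intros Hx Hab; unfold Rpower; apply exp_le.
pose proof (ln_nonneg x Hx); nra.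
Qed.

Lemma Rpower_ge_1 (x e : R) : 1 <= x -> 0 <= e -> 1 <= Rpower x e.
Proof.
intros Hx He; rewrite <- (Rpower_O x) by lra; apply Rpower_le_exp; auto.
Qed.

Lemma Rpower_le_1 (x e : R) : 1 <= x -> e <= 0 -> Rpower x e <= 1.
Proof.
intros Hx He; rewrite <- (Rpower_O x) by lra; apply Rpower_le_exp; auto.
Qed.

Lemma Rpower_succ (x e : R) : 0 < x -> Rpower x (e + 1) = x * Rpower x e.
Proof. intros; rewrite Rpower_plus, Rpower_1 by auto; ring. Qed.

Lemma is_derive_Rpower (x e : R) : 0 < x ->
  is_derive (fun x => Rpower x e) x (e * Rpower x (e - 1)).
Proof.
intros Hx; unfold Rpower; auto_derive; auto.
replace ((e - 1) * ln x) with (e * ln x + - ln x) by ring.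
rewrite exp_plus, exp_Ropp, exp_ln by auto. rewrite Rmult_1_l; field; lra.
Qed.

(* [ring] and [field] do not see through Coquelicot's structure carriers for [R]. *)
Ltac eq_as_R := match goal with |- @eq _ ?u ?v => change (@eq R u v) end.

(** * Cauchy's theorem for rectangles and the identity theorem *)

Definition cdiff (f : C -> C) (z : C) : Prop := exists l, cder f z l.

Definition ccont (f : C -> C) (z : C) : Prop :=
  forall eps, 0 < eps -> exists d, 0 < d /\
    forall h, Cmod h < d -> Cmod (f (z + h) - f z)%C < eps.

Lemma cdiff_ccont (f : C -> C) (z : C) : cdiff f z -> ccont f z.
Proof.
intros [l H] eps He; destruct (derw_cont _ _ _ _ H eps He) as [d [Hd H']].
exists d; split; auto.
Qed.

Definition Cint (g : R -> C) (a b : R) : C :=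
  (RInt (fun t => Re (g t)) a b, RInt (fun t => Im (g t)) a b).

Definition ex_Cint (g : R -> C) (a b : R) : Prop :=
  ex_RInt (fun t => Re (g t)) a b /\ ex_RInt (fun t => Im (g t)) a b.

Definition rcont (g : R -> C) (t : R) : Prop :=
  forall eps, 0 < eps -> exists d, 0 < d /\
    forall h, Rabs h < d -> Cmod (g (t + h)%R - g t)%C < eps.

(** Serves [Re], [Im] and [Cmod] alike, all of which are 1-Lipschitz. *)
Lemma continuous_of_rcont (k : C -> R) (g : R -> C) (t : R) :
  (forall z w, Rabs (k z - k w) <= Cmod (z - w)) ->
  rcont g t -> continuous (fun t => k (g t)) t.
Proof.
intros Hk H; apply continuity_pt_filterlim, continuity_pt_locally.
intros eps; destruct (H eps (cond_pos eps)) as [d [Hd H']].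
exists (mkposreal d Hd); intros y Hy; change R in y; change (Rabs (y - t) < d) in Hy.
eapply Rle_lt_trans; [apply Hk|].
specialize (H' (y - t) Hy). replace (t + (y - t)) with y in H' by ring. exact H'.
Qed.

Lemma rcont_Re (g : R -> C) (t : R) : rcont g t -> continuous (fun t => Re (g t)) t.
Proof.
apply (continuous_of_rcont Re); intros z w; rewrite <- (re_le_Cmod (z - w)).
right; unfold Re; simpl; reflexivity.
Qed.

Lemma rcont_Im (g : R -> C) (t : R) : rcont g t -> continuous (fun t => Im (g t)) t.
Proof.
apply (continuous_of_rcont Im); intros z w; rewrite <- (im_le_Cmod (z - w)).
right; unfold Im; simpl; reflexivity.
Qed.

Lemma rcont_Cmod (g : R -> C) (t : R) : rcont g t -> continuous (fun t => Cmod (g t)) t.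
Proof.
apply (continuous_of_rcont Cmod); intros z w; apply Rabs_le; split.
- pose proof (Cmod_ge_minus w (z - w)) as H.
  replace (w + (z - w))%C with z in H by ring. lra.
- pose proof (Cmod_triangle w (z - w)) as H.
  replace (w + (z - w))%C with z in H by ring. lra.
Qed.

Lemma ex_Cint_cont (g : R -> C) (a b : R) : a <= b ->
  (forall t, a <= t <= b -> rcont g t) -> ex_Cint g a b.
Proof.
intros Hab H; split; apply (ex_RInt_continuous (V := R_CompleteNormedModule));
 intros z Hz; rewrite Rmin_left, Rmax_right in Hz by lra;
 [apply rcont_Re|apply rcont_Im]; apply H; auto.
Qed.

Lemma rcont_bounded (g : R -> C) (a b : R) : a <= b ->
  (forall t, a <= t <= b -> rcont g t) ->
  exists M, forall t, a <= t <= b -> Cmod (g t) <= M.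
Proof.
intros Hab H.
destruct (continuity_ab_maj (fun t => Cmod (g t)) a b Hab) as [m [Hm _]].
- intros t Ht; apply continuity_pt_filterlim, rcont_Cmod, H, Ht.
- exists (Cmod (g m)); auto.
Qed.

Lemma rcont_hor (f : C -> C) (x y : R) :
  ccont f (x, y) -> rcont (fun t => f (t, y)) x.
Proof.
intros H eps He; destruct (H eps He) as [d [Hd H']].
exists d; split; auto; intros h Hh.
specialize (H' (RtoC h)); rewrite Cmod_R in H'.
replace ((x, y) + RtoC h)%C with (x + h, y) in H'; auto.
apply injective_projections; simpl; ring.
Qed.

Lemma rcont_ver (f : C -> C) (x y : R) :
  ccont f (x, y) -> rcont (fun t => f (x, t)) y.
Proof.
intros H eps He; destruct (H eps He) as [d [Hd H']].
exists d; split; auto; intros h Hh.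
specialize (H' (0, h)).
replace (Cmod (0, h)) with (Rabs h) in H'.
2: { unfold Cmod; simpl; rewrite <- sqrt_Rsqr_abs; f_equal; unfold Rsqr; ring. }
replace ((x, y) + (0, h))%C with (x, y + h) in H'; auto.
apply injective_projections; simpl; ring.
Qed.

Lemma Cint_Chasles (g : R -> C) (a m b : R) :
  ex_Cint g a m -> ex_Cint g m b -> Cint g a b = (Cint g a m + Cint g m b)%C.
Proof.
intros [H1 H2] [H3 H4]; apply injective_projections; simpl; symmetry;
 apply (RInt_Chasles (V := R_CompleteNormedModule)); auto.
Qed.

(** The factor 2 is the price of estimating real and imaginary parts separately; no later constant
    has to be sharp. *)
Lemma Cint_bound (g : R -> C) (a b M : R) : a <= b -> ex_Cint g a b ->
  (forall t, a <= t <= b -> Cmod (g t) <= M) ->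
  Cmod (Cint g a b) <= 2 * M * (b - a).
Proof.
intros Hab [H1 H2] H.
eapply Rle_trans; [apply Cmod_le_Re_Im|]; simpl.
assert (Rabs (RInt (fun t => Re (g t)) a b) <= (b - a) * M).
{ apply abs_RInt_le_const; auto; intros t Ht.
  eapply Rle_trans; [apply re_le_Cmod|auto]. }
assert (Rabs (RInt (fun t => Im (g t)) a b) <= (b - a) * M).
{ apply abs_RInt_le_const; auto; intros t Ht.
  eapply Rle_trans; [apply im_le_Cmod|auto]. }
unfold Re, Im in *; simpl in *; lra.
Qed.

Lemma is_RInt_affine (p q a b : R) :
  is_RInt (fun t => p + q * t) a b (p * (b - a) + q * (b * b - a * a) / 2).
Proof.
set (F := fun t => p * t + q * (t * t) / 2).
replace (p * (b - a) + q * (b * b - a * a) / 2) with (minus (F b) (F a))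
 by (change (F b - F a = p * (b - a) + q * (b * b - a * a) / 2); unfold F; field).
apply (is_RInt_derive (V := R_CompleteNormedModule)).
- intros x _; unfold F; auto_derive; auto; eq_as_R; field.
- intros x _; apply (ex_derive_continuous (fun t => p + q * t)); auto_derive; auto.
Qed.

(** For removing the first-order Taylor polynomial of a function from each side of a rectangle; its
    contribution is kept in closed form so that the four sides can be seen to cancel. *)
Lemma Cint_minus_affine (g : R -> C) (al be : C) (a b : R) :
  ex_Cint g a b ->
  ex_Cint (fun t => g t - (al + be * RtoC t))%C a b /\
  Cint g a b = (Cint (fun t => g t - (al + be * RtoC t)) a b
     + (al * RtoC (b - a) + be * RtoC ((b * b - a * a) / 2)))%C.
Proof.
intros [[i1 H1] [i2 H2]]; change R in i1, i2.
pose proof (is_RInt_affine (Re al) (Re be) a b) as A1.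
pose proof (is_RInt_affine (Im al) (Im be) a b) as A2.
assert (C1 : is_RInt (fun t => Re (g t - (al + be * RtoC t))%C) a b
  (i1 - (Re al * (b - a) + Re be * (b * b - a * a) / 2))).
{ eapply is_RInt_ext; [|exact (is_RInt_minus _ _ _ _ _ _ H1 A1)].
  intros x _; unfold minus, plus, opp, Re, Im; simpl; ring. }
assert (C2 : is_RInt (fun t => Im (g t - (al + be * RtoC t))%C) a b
  (i2 - (Im al * (b - a) + Im be * (b * b - a * a) / 2))).
{ eapply is_RInt_ext; [|exact (is_RInt_minus _ _ _ _ _ _ H2 A2)].
  intros x _; unfold minus, plus, opp, Re, Im; simpl; ring. }
split; [split; eexists; eassumption|].
unfold Cint; rewrite (is_RInt_unique _ _ _ _ C1), (is_RInt_unique _ _ _ _ C2),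
  (is_RInt_unique _ _ _ _ H1), (is_RInt_unique _ _ _ _ H2).
clear; destruct al, be; apply injective_projections; simpl; eq_as_R; field.
Qed.

(** The counterclockwise contour integral over the boundary of [a, b] x [c, d], with dz = dx on
    horizontal and dz = i dy on vertical sides. *)
Definition rect_int (f : C -> C) (a b c d : R) : C :=
  (Cint (fun x => f (x, c)) a b - Cint (fun x => f (x, d)) a b
   + Ci * (Cint (fun y => f (b, y)) c d - Cint (fun y => f (a, y)) c d))%C.

Definition rect_cont (f : C -> C) (a b c d : R) : Prop :=
  (forall x, a <= x <= b -> ccont f (x, c) /\ ccont f (x, d)) /\
  (forall y, c <= y <= d -> ccont f (a, y) /\ ccont f (b, y)).

Lemma rect_int_split_hor (f : C -> C) (a m b c d : R) : a <= m <= b ->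
  rect_cont f a b c d -> rect_int f a b c d = (rect_int f a m c d + rect_int f m b c d)%C.
Proof.
intros Hm [H _]; unfold rect_int.
rewrite (Cint_Chasles _ a m b), (Cint_Chasles (fun x => f (x, d)) a m b);
 try (apply ex_Cint_cont; [lra|]; intros t Ht;
   apply rcont_hor, H; lra); ring.
Qed.

Lemma rect_int_split_ver (f : C -> C) (a b c m d : R) : c <= m <= d ->
  rect_cont f a b c d -> rect_int f a b c d = (rect_int f a b c m + rect_int f a b m d)%C.
Proof.
intros Hm [_ H]; unfold rect_int.
rewrite (Cint_Chasles (fun y => f (b, y)) c m d), (Cint_Chasles (fun y => f (a, y)) c m d);
 try (apply ex_Cint_cont; [lra|]; intros t Ht;
   apply rcont_ver, H; lra); ring.
Qed.

(* The boundary integral of the affine part [al + be * z] vanishes. *)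
Lemma rect_int_affine_bound (f : C -> C) (al be : C) (a b c d M : R) : a <= b -> c <= d ->
  rect_cont f a b c d ->
  (forall x y, a <= x <= b -> c <= y <= d -> Cmod (f (x, y) - (al + be * (x, y)))%C <= M) ->
  Cmod (rect_int f a b c d) <= 4 * M * ((b - a) + (d - c)).
Proof.
intros Hab Hcd [Hx Hy] HM; unfold rect_int.
assert (Eh : forall x y : R, (al + be * (x, y) = (al + be * (0, y)) + be * RtoC x)%C).
{ intros; apply injective_projections; simpl; ring. }
assert (Ev : forall x y : R, (al + be * (x, y) = (al + be * RtoC x) + (be * Ci) * RtoC y)%C).
{ intros; apply injective_projections; simpl; ring. }
destruct (Cint_minus_affine (fun x => f (x, c)) (al + be * (0, c)) be a b) as [X1 E1].
{ apply ex_Cint_cont; auto; intros; apply rcont_hor, Hx; auto. }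
destruct (Cint_minus_affine (fun x => f (x, d)) (al + be * (0, d)) be a b) as [X2 E2].
{ apply ex_Cint_cont; auto; intros; apply rcont_hor, Hx; auto. }
destruct (Cint_minus_affine (fun y => f (b, y)) (al + be * RtoC b) (be * Ci) c d) as [X3 E3].
{ apply ex_Cint_cont; auto; intros; apply rcont_ver, Hy; auto. }
destruct (Cint_minus_affine (fun y => f (a, y)) (al + be * RtoC a) (be * Ci) c d) as [X4 E4].
{ apply ex_Cint_cont; auto; intros; apply rcont_ver, Hy; auto. }
rewrite E1, E2, E3, E4.
assert (B1 := Cint_bound _ a b M Hab X1 ltac:(intros; cbv beta; rewrite <- Eh; apply HM; lra)).
assert (B2 := Cint_bound _ a b M Hab X2 ltac:(intros; cbv beta; rewrite <- Eh; apply HM; lra)).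
assert (B3 := Cint_bound _ c d M Hcd X3 ltac:(intros; cbv beta; rewrite <- Ev; apply HM; lra)).
assert (B4 := Cint_bound _ c d M Hcd X4 ltac:(intros; cbv beta; rewrite <- Ev; apply HM; lra)).
clear E1 E2 E3 E4 X1 X2 X3 X4.
match type of B1 with Cmod ?X <= _ => set (i1 := X) in * end.
match type of B2 with Cmod ?X <= _ => set (i2 := X) in * end.
match type of B3 with Cmod ?X <= _ => set (i3 := X) in * end.
match type of B4 with Cmod ?X <= _ => set (i4 := X) in * end.
clearbody i1 i2 i3 i4.
match goal with |- Cmod ?A <= _ =>
 replace A with (i1 - i2 + Ci * (i3 - i4))%C end.
- replace (4 * M * (b - a + (d - c))) with
    ((2 * M * (b - a) + 2 * M * (b - a)) + 1 * (2 * M * (d - c) + 2 * M * (d - c))) by ring.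
  apply Cmod_triangle_le; [apply Cmod_minus_le; auto|].
  apply Cmod_mult_le; [rewrite Cmod_Ci; lra|apply Cmod_minus_le; auto].
- apply injective_projections; simpl; field.
Qed.

Lemma rect_int_bound (f : C -> C) (a b c d M : R) : a <= b -> c <= d -> rect_cont f a b c d ->
  (forall x, a <= x <= b -> Cmod (f (x, c)) <= M /\ Cmod (f (x, d)) <= M) ->
  (forall y, c <= y <= d -> Cmod (f (a, y)) <= M /\ Cmod (f (b, y)) <= M) ->
  Cmod (rect_int f a b c d) <= 4 * M * ((b - a) + (d - c)).
Proof.
intros Hab Hcd [Hx Hy] H1 H2; unfold rect_int.
replace (4 * M * (b - a + (d - c))) with
    ((2 * M * (b - a) + 2 * M * (b - a)) + 1 * (2 * M * (d - c) + 2 * M * (d - c))) by ring.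
apply Cmod_triangle_le; [apply Cmod_minus_le|apply Cmod_mult_le;
  [rewrite Cmod_Ci; lra|apply Cmod_minus_le]];
 (apply Cint_bound; [auto|apply ex_Cint_cont; auto; intros|]);
 try (apply rcont_hor, Hx; auto); try (apply rcont_ver, Hy; auto);
 intros t Ht; try apply (H1 t Ht); apply (H2 t Ht).
Qed.

(** The left endpoints increase and stay below every right endpoint, so their supremum lies in all
    the intervals. *)
Lemma nested_point (a : nat -> R) (L : R) : 0 <= L ->
  (forall n, a n <= a (S n) <= a n + L / 2 ^ (S n)) ->
  exists x, forall n, a n <= x <= a n + L / 2 ^ n.
Proof.
intros HL H.
assert (Hp : forall n, 0 < 2 ^ n) by (intros; apply pow_lt; lra).
assert (Hmono : forall n k, a n <= a (n + k)%nat <= a n + L / 2 ^ n - L / 2 ^ (n + k)).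
{ intros n; induction k as [|k IH].
  - rewrite Nat.add_0_r; lra.
  - replace (n + S k)%nat with (S (n + k)) by lia.
    specialize (H (n + k)%nat).
    assert (L / 2 ^ (n + k) = 2 * (L / 2 ^ (S (n + k)))).
    { simpl; field; apply pow_nonzero; lra. }
    lra. }
assert (Hub : forall n m, a m <= a n + L / 2 ^ n).
{ intros n m. assert (0 <= L / 2 ^ n) by (apply Rdiv_le_0_compat; auto).
  assert (0 <= L / 2 ^ m) by (apply Rdiv_le_0_compat; auto).
  destruct (Nat.le_gt_cases n m) as [Hnm|Hnm].
  - replace m with (n + (m - n))%nat at 1 by lia.
    pose proof (Hmono n (m - n)%nat) as Q.
    replace (n + (m - n))%nat with m in * by lia. lra.
  - pose proof (Hmono m (n - m)%nat) as Q.
    replace (m + (n - m))%nat with n in Q by lia. lra. }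
destruct (completeness (fun x => exists n, x = a n)) as [x [Hx1 Hx2]].
- exists (a 0%nat + L / 2 ^ 0); intros y [n ->]; apply Hub.
- exists (a 0%nat), 0%nat; auto.
- exists x; intros n; split.
  + apply Hx1; exists n; auto.
  + apply Hx2; intros y [m ->]; apply Hub.
Qed.

Lemma rect_cont_sub (f : C -> C) (a b c d a' b' c' d' : R) :
  (forall x y, a <= x <= b -> c <= y <= d -> ccont f (x, y)) ->
  a <= a' <= b -> a <= b' <= b -> c <= c' <= d -> c <= d' <= d ->
  rect_cont f a' b' c' d'.
Proof. intros H ? ? ? ?; split; intros; split; apply H; lra. Qed.

Lemma Cmod_le_abs (x y : R) : Cmod (x, y) <= Rabs x + Rabs y.
Proof. apply (Cmod_le_Re_Im (x, y)). Qed.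

(** Repeated quartering: from a nonzero integral one obtains nested rectangles whose integrals decay
    no faster than 4^(-n). At their common point, differentiability makes the integral small
    compared with the squared half-perimeter, which also decays like 4^(-n). *)
Lemma Goursat (f : C -> C) (a b c d : R) : a <= b -> c <= d ->
  (forall x y, a <= x <= b -> c <= y <= d -> cdiff f (x, y)) ->
  rect_int f a b c d = 0.
Proof.
intros Hab Hcd Hf.
assert (Hc : forall x y, a <= x <= b -> c <= y <= d -> ccont f (x, y))
 by (intros; apply cdiff_ccont; auto).
apply NNPP; intros Hneq; apply Cmod_gt_0 in Hneq.
(* Half of the modulus, so that the whole rectangle satisfies the strict inequality in [Bad]. *)
set (eps := Cmod (rect_int f a b c d) / 2).
assert (He : 0 < eps) by (unfold eps; lra).
set (W := b - a); set (H := d - c).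
assert (Hp : forall n, 0 < 2 ^ n) by (intros; apply pow_lt; lra).
assert (HW : 0 <= W) by (unfold W; lra); assert (HH : 0 <= H) by (unfold H; lra).
assert (HWn : forall n, 0 <= W / 2 ^ n) by (intros; apply Rdiv_le_0_compat; auto).
assert (HHn : forall n, 0 <= H / 2 ^ n) by (intros; apply Rdiv_le_0_compat; auto).
set (In := fun n (p : R * R) => a <= fst p /\ fst p + W / 2 ^ n <= b /\
   c <= snd p /\ snd p + H / 2 ^ n <= d).
set (J := fun n (p : R * R) =>
  rect_int f (fst p) (fst p + W / 2 ^ n) (snd p) (snd p + H / 2 ^ n)).
set (Bad := fun n p => In n p /\ eps / 4 ^ n < Cmod (J n p)).
(* Stated for every lower left corner, bad or not, so that choice yields a total function; a corner
   that is not bad stays where it is. *)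
assert (Hstep : forall np : nat * (R * R), exists p' : R * R,
  let (n, p) := np in
  (Bad n p -> Bad (S n) p') /\ fst p <= fst p' <= fst p + W / 2 ^ (S n) /\
  snd p <= snd p' <= snd p + H / 2 ^ (S n)).
{ intros [n [x y]].
  destruct (classic (Bad n (x, y))) as [HB|HB].
  2: { exists (x, y); split; [tauto|]; simpl fst; simpl snd.
       pose proof (HWn (S n)); pose proof (HHn (S n)); lra. }
  set (w := W / 2 ^ S n); set (h := H / 2 ^ S n).
  assert (Ew : W / 2 ^ n = w + w) by (unfold w; simpl; field; apply pow_nonzero; lra).
  assert (Eh : H / 2 ^ n = h + h) by (unfold h; simpl; field; apply pow_nonzero; lra).
  assert (Hw : 0 <= w) by apply HWn; assert (Hh : 0 <= h) by apply HHn.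
  apply NNPP; intros Hno.
  destruct HB as [[I1 [I2 [I3 I4]]] HB]; simpl in I1, I2, I3, I4.
  rewrite Ew in I2; rewrite Eh in I4.
  assert (Hch : forall p, (p = (x, y) \/ p = (x + w, y) \/ p = (x, y + h) \/ p = (x + w, y + h)) ->
     Cmod (J (S n) p) <= eps / 4 ^ (S n)).
  { intros p Hpp; apply Rnot_lt_le; intros Hlt; apply Hno; exists p.
    split; [intros _; split; auto|]; unfold In; fold w h;
    destruct Hpp as [->|[->|[->| ->]]]; simpl fst; simpl snd; lra. }
  apply (Rlt_irrefl (eps / 4 ^ n)); eapply Rlt_le_trans; [exact HB|].
  replace (eps / 4 ^ n) with ((eps / 4 ^ S n + eps / 4 ^ S n) + (eps / 4 ^ S n + eps / 4 ^ S n))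
    by (simpl; field; apply pow_nonzero; lra).
  assert (C1 := Hch (x, y) ltac:(tauto)); assert (C2 := Hch (x + w, y) ltac:(tauto)).
  assert (C3 := Hch (x, y + h) ltac:(tauto)); assert (C4 := Hch (x + w, y + h) ltac:(tauto)).
  unfold J in *; simpl fst in *; simpl snd in *. fold w h in C1, C2, C3, C4.
  rewrite Ew, Eh.
  rewrite (rect_int_split_hor f x (x + w)) by (try lra; apply (rect_cont_sub f a b c d); auto; lra).
  rewrite (rect_int_split_ver f x _ y (y + h)) by (try lra; apply (rect_cont_sub f a b c d); auto; lra).
  rewrite (rect_int_split_ver f (x + w) _ y (y + h)) by (try lra; apply (rect_cont_sub f a b c d); auto; lra).
  replace (x + w + w) with (x + (w + w)) in * by ring.
  replace (y + h + h) with (y + (h + h)) in * by ring.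
  repeat apply Cmod_triangle_le; auto. }
set (step := fun np => proj1_sig (constructive_indefinite_description _ (Hstep np))).
assert (Hst : forall np : nat * (R * R), let (n, p) := np in
  (Bad n p -> Bad (S n) (step np)) /\ fst p <= fst (step np) <= fst p + W / 2 ^ (S n) /\
  snd p <= snd (step np) <= snd p + H / 2 ^ (S n))
 by (intros np; exact (proj2_sig (constructive_indefinite_description _ (Hstep np)))).
clearbody step.
set (P := fix P n := match n with O => (a, c) | S n => step (n, P n) end).
assert (HP : forall n, Bad n (P n)).
{ induction n as [|n IH].
  - split.
    + unfold In, W, H; simpl; repeat split; lra.
    + unfold J, P, W, H; simpl fst; simpl snd; rewrite !pow_O, !Rdiv_1_r.
      replace (a + (b - a)) with b by ring; replace (c + (d - c)) with d by ring.
      unfold eps; lra.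
  - apply (Hst (n, P n)), IH. }
destruct (nested_point (fun n => fst (P n)) W HW) as [x Hx].
{ intros n; apply (Hst (n, P n)). }
destruct (nested_point (fun n => snd (P n)) H HH) as [y Hy].
{ intros n; apply (Hst (n, P n)). }
assert (Hxin : a <= x <= b /\ c <= y <= d).
{ specialize (Hx 0%nat); specialize (Hy 0%nat); simpl in Hx, Hy; unfold W, H in *; lra. }
destruct (Hf x y (proj1 Hxin) (proj2 Hxin)) as [l Hl].
(* Sized so that the bound 4 e (W + H)^2 / 4^n obtained on the last rectangle is at most
   [eps / 4 ^ n]. *)
set (e := eps / (8 * (W + H) ^ 2 + 8)).
assert (He' : 0 < e) by (apply Rdiv_lt_0_compat; nra).
destruct (Hl e He') as [r [Hr Hd]].
assert (Hn : exists n, (W + H) / 2 ^ n < r).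
{ destruct (pow_lt_1_zero (/ 2) ltac:(rewrite Rabs_pos_eq; lra) (r / (W + H + 1))
    ltac:(apply Rdiv_lt_0_compat; lra)) as [n Hn].
  exists n; specialize (Hn n (le_n n)).
  rewrite Rabs_pos_eq in Hn by (apply pow_le; lra).
  rewrite pow_inv in Hn. unfold Rdiv.
  assert (0 < / 2 ^ n) by (apply Rinv_0_lt_compat; auto).
  apply Rle_lt_trans with ((W + H + 1) * / 2 ^ n); [nra|].
  apply Rlt_le_trans with ((W + H + 1) * (r / (W + H + 1)));
  [apply Rmult_lt_compat_l; lra|right; field; lra]. }
destruct Hn as [n Hn].
destruct (HP n) as [[I1 [I2 [I3 I4]]] HJ]; unfold J in HJ.
specialize (Hx n); specialize (Hy n); cbv beta in Hx, Hy.
set (p := fst (P n)) in *; set (q := snd (P n)) in *.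
pose proof (HWn n) as Hw0; pose proof (HHn n) as Hh0.
assert (Ewh : (W + H) / 2 ^ n = W / 2 ^ n + H / 2 ^ n) by (unfold Rdiv; ring).
set (w := W / 2 ^ n) in *; set (h := H / 2 ^ n) in *.
pose proof (rect_int_affine_bound f (f (x, y) - l * (x, y)) l p (p + w) q (q + h) (e * (w + h))
  ltac:(lra) ltac:(lra)) as HA.
assert (HB : Cmod (rect_int f p (p + w) q (q + h)) <= 4 * (e * (w + h)) * (p + w - p + (q + h - q))).
{ apply HA.
  - apply (rect_cont_sub f a b c d); auto; lra.
  - intros u v Hu Hv.
    set (k := (u - x, v - y)).
    assert (Hk : Cmod k <= w + h).
    { eapply Rle_trans; [apply Cmod_le_abs|].
      apply Rplus_le_compat; apply Rabs_le; lra. }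
    specialize (Hd k I ltac:(lra)).
    replace ((x, y) + k)%C with (u, v) in Hd
      by (unfold k; apply injective_projections; simpl; ring).
    replace (f (u, v) - (f (x, y) - l * (x, y) + l * (u, v)))%C with
      (f (u, v) - f (x, y) - l * k)%C
      by (unfold k; apply injective_projections; simpl; ring).
    eapply Rle_trans; [exact Hd|]. apply Rmult_le_compat_l; lra. }
apply (Rlt_irrefl (eps / 4 ^ n)).
eapply Rlt_le_trans; [exact HJ|]; eapply Rle_trans; [exact HB|].
replace (4 * (e * (w + h)) * (p + w - p + (q + h - q))) with (4 * e * ((w + h) * (w + h))) by ring.
rewrite <- Ewh.
replace (4 * e * ((W + H) / 2 ^ n * ((W + H) / 2 ^ n))) with (4 * e * (W + H) ^ 2 / 4 ^ n).
2: { replace (4 ^ n) with (2 ^ n * 2 ^ n).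
     - field; apply pow_nonzero; lra.
     - rewrite <- Rpow_mult_distr; f_equal; lra. }
apply Rmult_le_compat_r; [left; apply Rinv_0_lt_compat, pow_lt; lra|].
unfold e. set (X := (W + H) ^ 2). assert (0 <= X) by (unfold X; nra).
replace (4 * (eps / (8 * X + 8)) * X) with (eps * (4 * X / (8 * X + 8))) by (field; lra).
assert (4 * X / (8 * X + 8) <= 1) by (apply Rle_div_l; lra). nra.
Qed.

Lemma rect_cont_of_cdiff (f : C -> C) (a b c d : R) :
  (forall x y, a <= x <= b -> c <= y <= d -> x = a \/ x = b \/ y = c \/ y = d -> cdiff f (x, y)) ->
  a <= b -> c <= d -> rect_cont f a b c d.
Proof.
intros H Hab Hcd; split; intros t Ht; split; apply cdiff_ccont, H; auto; lra.
Qed.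

(* At the point [z0] itself the function need only be bounded: the integral over a square
   of side [2 eta] around [z0] tends to [0]. *)
Lemma Goursat_except (f : C -> C) (a b c d x0 y0 M r : R) :
  a < x0 < b -> c < y0 < d -> 0 < r ->
  (forall x y, a <= x <= b -> c <= y <= d -> (x, y) <> (x0, y0) -> cdiff f (x, y)) ->
  (forall x y, Rabs (x - x0) <= r -> Rabs (y - y0) <= r -> Cmod (f (x, y)) <= M) ->
  rect_int f a b c d = 0.
Proof.
intros Hx0 Hy0 Hr Hf HM.
assert (HM0 : 0 <= M).
{ eapply Rle_trans; [apply Cmod_ge_0|apply (HM x0 y0)]; rewrite Rminus_diag, Rabs_R0; lra. }
assert (Hfx : forall x y, a <= x <= b -> c <= y <= d -> x <> x0 -> cdiff f (x, y)).
{ intros x y ? ? Hn; apply Hf; auto; intros E; injection E; auto. }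
assert (Hfy : forall x y, a <= x <= b -> c <= y <= d -> y <> y0 -> cdiff f (x, y)).
{ intros x y ? ? Hn; apply Hf; auto; intros E; injection E; auto. }
apply NNPP; intros Hn; apply Cmod_gt_0 in Hn.
set (B := Cmod (rect_int f a b c d)) in *.
(* The square of half-side [e] lies inside the rectangle and inside the region where [M] applies,
   and its boundary integral, at most 16 M e, is smaller than [B]. *)
set (e := Rmin (Rmin r (B / (16 * M + 16 + B)))
  (Rmin (Rmin ((x0 - a) / 2) ((b - x0) / 2)) (Rmin ((y0 - c) / 2) ((d - y0) / 2)))).
assert (He : 0 < e).
{ unfold e; repeat apply Rmin_pos; try lra. apply Rdiv_lt_0_compat; lra. }
assert (He1 : (e <= r /\ e <= B / (16 * M + 16 + B)) /\
  (e <= (x0 - a) / 2 /\ e <= (b - x0) / 2) /\ e <= (y0 - c) / 2 /\ e <= (d - y0) / 2).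
{ unfold e, Rmin; repeat destruct Rle_dec; lra. }
clearbody e.
assert (E : rect_int f a b c d = rect_int f (x0 - e) (x0 + e) (y0 - e) (y0 + e)).
{ rewrite (rect_int_split_hor f a (x0 - e) b), (rect_int_split_hor f (x0 - e) (x0 + e) b),
   (rect_int_split_ver f (x0 - e) (x0 + e) c (y0 - e) d),
   (rect_int_split_ver f (x0 - e) (x0 + e) (y0 - e) (y0 + e) d); try lra;
  try (apply rect_cont_of_cdiff; [intros x y Hx Hy Hb; apply Hf; [lra..|];
   intros E; injection E; lra|lra..]).
  rewrite (Goursat f a (x0 - e)), (Goursat f (x0 + e) b),
   (Goursat f (x0 - e) (x0 + e) c (y0 - e)), (Goursat f (x0 - e) (x0 + e) (y0 + e) d);
   try lra; try ring; intros; (apply Hfx; lra) || (apply Hfy; lra). }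
assert (HB : B <= 4 * M * ((x0 + e - (x0 - e)) + (y0 + e - (y0 - e)))).
{ unfold B; rewrite E; apply rect_int_bound; try lra.
  - apply rect_cont_of_cdiff; try lra; intros x y Hx Hy Hb; apply Hf; [lra..|].
    intros E'; injection E'; lra.
  - intros x Hx; split; apply HM; apply Rabs_le; lra.
  - intros x Hx; split; apply HM; apply Rabs_le; lra. }
assert (e * (16 * M + 16 + B) <= B).
{ apply Rle_trans with (B / (16 * M + 16 + B) * (16 * M + 16 + B)).
  - apply Rmult_le_compat_r; lra.
  - right; field; lra. }
nra.
Qed.

(** * Rules for holomorphic functions, Cauchy's estimate and its consequences *)

Lemma cdiff_const (c z : C) : cdiff (fun _ => c) z.
Proof. eexists; apply derw_const. Qed.
Lemma cdiff_id (z : C) : cdiff (fun z => z) z.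
Proof. eexists; apply derw_id. Qed.
Lemma cdiff_plus (f g : C -> C) z : cdiff f z -> cdiff g z -> cdiff (fun z => f z + g z)%C z.
Proof. intros [a Ha] [b Hb]; eexists; apply derw_plus; eassumption. Qed.
Lemma cdiff_minus (f g : C -> C) z : cdiff f z -> cdiff g z -> cdiff (fun z => f z - g z)%C z.
Proof. intros [a Ha] [b Hb]; eexists; apply derw_minus; eassumption. Qed.
Lemma cdiff_mult (f g : C -> C) z : cdiff f z -> cdiff g z -> cdiff (fun z => f z * g z)%C z.
Proof. intros [a Ha] [b Hb]; eexists; apply derw_mult; eassumption. Qed.
Lemma cdiff_comp (F f : C -> C) z : cdiff f z -> cdiff F (f z) -> cdiff (fun z => F (f z)) z.
Proof. intros [a Ha] [b Hb]; eexists; apply derw_comp; eassumption. Qed.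
Lemma cdiff_inv (f : C -> C) z : cdiff f z -> f z <> 0 -> cdiff (fun z => / f z)%C z.
Proof. intros; apply (cdiff_comp Cinv); auto; eexists; apply cder_inv; auto. Qed.
Lemma cdiff_pow (f : C -> C) z n : cdiff f z -> cdiff (fun z => f z ^ n)%C z.
Proof.
intros; induction n; simpl; [apply cdiff_const|apply cdiff_mult; auto].
Qed.

Lemma Cminus_neq (z w : C) : z <> w -> (z - w)%C <> 0.
Proof.
intros H E; apply H.
replace z with (z - w + w)%C by ring; rewrite E; ring.
Qed.

Lemma cdiff_inv_shift (z0 z : C) : z <> z0 -> cdiff (fun z => / (z - z0))%C z.
Proof.
intros H; apply cdiff_inv; [|apply Cminus_neq, H].
apply cdiff_minus; [apply cdiff_id|apply cdiff_const].
Qed.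

Lemma Cint_mult_const (k : C) (g : R -> C) (a b : R) :
  ex_Cint g a b -> Cint (fun t => k * g t)%C a b = (k * Cint g a b)%C.
Proof.
intros [[i1 H1] [i2 H2]]; change R in i1, i2.
unfold Cint; rewrite (is_RInt_unique _ _ _ _ H1), (is_RInt_unique _ _ _ _ H2).
assert (P1 := is_RInt_minus _ _ _ _ _ _ (is_RInt_scal _ _ _ (Re k) _ H1)
  (is_RInt_scal _ _ _ (Im k) _ H2)).
assert (P2 := is_RInt_plus _ _ _ _ _ _ (is_RInt_scal _ _ _ (Re k) _ H2)
  (is_RInt_scal _ _ _ (Im k) _ H1)).
apply injective_projections; simpl.
- apply is_RInt_unique; eapply is_RInt_ext; [|exact P1].
  intros x _; unfold minus, plus, opp, scal, Re, Im; simpl; unfold mult; simpl; eq_as_R; ring.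
- apply is_RInt_unique; eapply is_RInt_ext; [|exact P2].
  intros x _; unfold minus, plus, opp, scal, Re, Im; simpl; unfold mult; simpl; eq_as_R; ring.
Qed.

Lemma Cint_minus (g h : R -> C) (a b : R) :
  ex_Cint g a b -> ex_Cint h a b ->
  Cint (fun t => g t - h t)%C a b = (Cint g a b - Cint h a b)%C.
Proof.
intros [[i1 H1] [i2 H2]] [[j1 H3] [j2 H4]]; change R in i1, i2, j1, j2.
unfold Cint; rewrite (is_RInt_unique _ _ _ _ H1), (is_RInt_unique _ _ _ _ H2),
 (is_RInt_unique _ _ _ _ H3), (is_RInt_unique _ _ _ _ H4).
apply injective_projections; simpl; apply is_RInt_unique.
- exact (is_RInt_minus _ _ _ _ _ _ H1 H3).
- exact (is_RInt_minus _ _ _ _ _ _ H2 H4).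
Qed.

Lemma rect_cont_ex_Cint (f : C -> C) (a b c d : R) : a <= b -> c <= d -> rect_cont f a b c d ->
  ex_Cint (fun x => f (x, c)) a b /\ ex_Cint (fun x => f (x, d)) a b /\
  ex_Cint (fun y => f (a, y)) c d /\ ex_Cint (fun y => f (b, y)) c d.
Proof.
intros Hab Hcd [H1 H2]; split; [|split; [|split]]; apply ex_Cint_cont; auto; intros;
 (apply rcont_hor, H1; auto) || (apply rcont_ver, H2; auto).
Qed.

Lemma rect_int_minus (f g : C -> C) (a b c d : R) : a <= b -> c <= d ->
  rect_cont f a b c d -> rect_cont g a b c d ->
  rect_int (fun z => f z - g z)%C a b c d = (rect_int f a b c d - rect_int g a b c d)%C.
Proof.
intros Hab Hcd Hf Hg.
apply rect_cont_ex_Cint in Hf; auto; apply rect_cont_ex_Cint in Hg; auto.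
destruct Hf as [F1 [F2 [F3 F4]]], Hg as [G1 [G2 [G3 G4]]].
unfold rect_int; rewrite !Cint_minus by auto; ring.
Qed.

Lemma rect_int_mult_const (k : C) (f : C -> C) (a b c d : R) : a <= b -> c <= d ->
  rect_cont f a b c d -> rect_int (fun z => k * f z)%C a b c d = (k * rect_int f a b c d)%C.
Proof.
intros Hab Hcd Hf; apply rect_cont_ex_Cint in Hf; auto.
destruct Hf as [F1 [F2 [F3 F4]]].
unfold rect_int; rewrite !Cint_mult_const by auto; ring.
Qed.

(* Each of the four sides contributes a nonnegative amount to [Im (rect_int (1/(z-z0)))]. *)
Lemma rect_int_inv_neq_0 (a b c d x0 y0 : R) : a < x0 < b -> c < y0 < d ->
  rect_int (fun z => / (z - (x0, y0)))%C a b c d <> 0.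
Proof.
intros Hx Hy Habs.
set (f := fun z => (/ (z - (x0, y0)))%C) in Habs.
assert (Hf : rect_cont f a b c d).
{ apply rect_cont_of_cdiff; try lra; intros x y Hx' Hy' Hb.
  apply cdiff_inv_shift; intros E; injection E; lra. }
apply rect_cont_ex_Cint in Hf; try lra.
destruct Hf as [[F1 F1'] [[F2 F2'] [[F3 F3'] [F4 F4']]]].
assert (Ef : forall x y, f (x, y) = ((x - x0) / ((x - x0) ^ 2 + (y - y0) ^ 2),
   - (y - y0) / ((x - x0) ^ 2 + (y - y0) ^ 2))) by reflexivity.
assert (H2 : RInt (fun x => Im (f (x, d))) a b <= 0).
{ assert (R0 : RInt (fun _ => 0) a b = 0) by (rewrite RInt_const; exact (Rmult_0_r _)); rewrite <- R0.
  apply RInt_le; auto; [lra|apply ex_RInt_const|].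
  intros x Hx'; rewrite Ef; cbn [Re Im fst snd];
  pose proof (pow2_ge_0 (x - x0)).
  apply Rle_div_l; [apply Rlt_gt; nra|nra]. }
assert (H3 : RInt (fun y => Re (f (a, y))) c d <= 0).
{ assert (R0 : RInt (fun _ => 0) c d = 0) by (rewrite RInt_const; exact (Rmult_0_r _)); rewrite <- R0.
  apply RInt_le; auto; [lra|apply ex_RInt_const|].
  intros x Hx'; rewrite Ef; cbn [Re Im fst snd];
  pose proof (pow2_ge_0 (x - y0)).
  apply Rle_div_l; [apply Rlt_gt; nra|nra]. }
assert (H4 : 0 <= RInt (fun y => Re (f (b, y))) c d).
{ apply RInt_ge_0; auto; [lra|].
  intros x Hx'; rewrite Ef; cbn [Re Im fst snd];
  pose proof (pow2_ge_0 (x - y0)).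
  apply Rdiv_le_0_compat; [lra|nra]. }
(* The bottom side makes the inequality strict: its integrand is at least [m], the height of the
   point above that side divided by the squared diagonal. *)
assert (H1 : 0 < RInt (fun x => Im (f (x, c))) a b).
{ set (m := (y0 - c) / ((b - a) ^ 2 + (d - c) ^ 2)).
  assert (Hden : 0 < (b - a) ^ 2 + (d - c) ^ 2) by nra.
  assert (Hm : 0 < m) by (apply Rdiv_lt_0_compat; lra).
  apply Rlt_le_trans with (RInt (fun _ => m) a b).
  - rewrite RInt_const. apply Rmult_lt_0_compat; lra.
  - apply RInt_le; auto; [lra|apply ex_RInt_const|].
    intros x Hx'; rewrite Ef; cbn [Re Im fst snd];
    pose proof (pow2_ge_0 (x - x0)).
    unfold m. replace (- (c - y0)) with (y0 - c) by ring.
    apply Rmult_le_compat_l; [lra|]. apply Rinv_le_contravar; [|nra].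
    nra. }
apply (f_equal Im) in Habs; unfold rect_int, Cint, Im, Re in *; simpl in *; lra.
Qed.

Lemma rect_boundary_inv (a b c d x0 y0 r x y : R) : 0 < r ->
  (r <= x0 - a /\ r <= b - x0) /\ r <= y0 - c /\ r <= d - y0 ->
  x = a \/ x = b \/ y = c \/ y = d ->
  (x, y) <> (x0, y0) /\ Cmod (/ ((x, y) - (x0, y0)))%C <= / r.
Proof.
intros Hr Hd Hb.
assert (N : (x, y) <> (x0, y0)) by (intros E; injection E; lra).
split; auto. rewrite Cmod_inv by (apply Cminus_neq; auto).
apply Rinv_le_contravar; auto.
destruct Hb as [->|[->|[->| ->]]];
[eapply Rle_trans; [|apply re_le_Cmod]; unfold Re; simpl ..|
 eapply Rle_trans; [|apply im_le_Cmod]; unfold Im; simpl |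
 eapply Rle_trans; [|apply im_le_Cmod]; unfold Im; simpl ];
try (rewrite Rabs_left1; lra); try (rewrite Rabs_pos_eq; lra).
Qed.

(** Cauchy's formula with the integral [w] of 1 / (z - z0) left unevaluated. The quotient (g z - g
    z0) / (z - z0) is bounded near z0, so it integrates to 0 and g z0 * w is the contour integral of
    g z / (z - z0); then divide by [w], which is nonzero. That [K] depends only on the rectangle and
    the point allows an application to a whole sequence of functions. *)
Lemma Cauchy_estimate (a b c d x0 y0 : R) : a < x0 < b -> c < y0 < d ->
  exists K, 0 <= K /\ forall (g : C -> C) (M : R),
   (forall x y, a <= x <= b -> c <= y <= d -> cdiff g (x, y)) ->
   (forall x, a <= x <= b -> Cmod (g (x, c)) <= M /\ Cmod (g (x, d)) <= M) ->
   (forall y, c <= y <= d -> Cmod (g (a, y)) <= M /\ Cmod (g (b, y)) <= M) ->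
   Cmod (g (x0, y0)) <= K * M.
Proof.
intros Hx Hy.
set (z0 := (x0, y0) : C).
set (w := rect_int (fun z => / (z - z0))%C a b c d).
assert (Hw : 0 < Cmod w) by (apply Cmod_gt_0, rect_int_inv_neq_0; auto).
set (dd := Rmin (Rmin (x0 - a) (b - x0)) (Rmin (y0 - c) (d - y0))).
assert (Hdd : 0 < dd) by (repeat apply Rmin_pos; lra).
assert (Hdd1 : (dd <= x0 - a /\ dd <= b - x0) /\ dd <= y0 - c /\ dd <= d - y0).
{ unfold dd, Rmin; repeat destruct Rle_dec; lra. }
clearbody dd.
assert (Hinv : forall x y, a <= x <= b -> c <= y <= d -> x = a \/ x = b \/ y = c \/ y = d ->
   (x, y) <> z0 /\ Cmod (/ ((x, y) - z0))%C <= / dd)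
 by (intros; apply (rect_boundary_inv a b c d); auto).
exists (4 * / dd * ((b - a) + (d - c)) / Cmod w); split.
{ apply Rdiv_le_0_compat; auto.
  assert (0 < / dd) by (apply Rinv_0_lt_compat; auto).
  apply Rmult_le_pos; lra. }
intros g M Hg Hg1 Hg2.
assert (Hci : rect_cont (fun z => / (z - z0))%C a b c d).
{ apply rect_cont_of_cdiff; try lra; intros x y Hx' Hy' Hb; apply cdiff_inv_shift, (Hinv x y); auto. }
assert (Hcg : rect_cont (fun z => g z * / (z - z0))%C a b c d).
{ apply rect_cont_of_cdiff; try lra; intros x y Hx' Hy' Hb; apply cdiff_mult; [apply Hg; auto|].
  apply cdiff_inv_shift, (Hinv x y); auto. }
assert (Hcgi : rect_cont (fun z => g z0 * / (z - z0))%C a b c d).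
{ apply rect_cont_of_cdiff; try lra; intros x y Hx' Hy' Hb; apply cdiff_mult; [apply cdiff_const|].
  apply cdiff_inv_shift, (Hinv x y); auto. }
destruct (Hg x0 y0 ltac:(lra) ltac:(lra)) as [l Hl].
destruct (derw_lip _ _ _ _ Hl) as [r [Hr Hl']].
assert (HG : rect_int (fun z => g z * / (z - z0) - g z0 * / (z - z0))%C a b c d = 0).
{ apply (Goursat_except _ a b c d x0 y0 (Cmod l + 1) (r / 4)); auto; try lra.
  - intros x y Hx' Hy' N.
    assert (cdiff (fun z => / (z - z0))%C (x, y)).
    { apply cdiff_inv_shift; auto. }
    apply cdiff_minus; apply cdiff_mult; auto. apply cdiff_const.
  - intros x y Hx' Hy'.
    set (h := (x - x0, y - y0) : C).
    replace ((x, y) - z0)%C with h by reflexivity.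
    assert (Hh : Cmod h < r) by (eapply Rle_lt_trans; [apply Cmod_le_abs|]; lra).
    replace (x, y) with (z0 + h)%C
      by (unfold h, z0; apply injective_projections; simpl; ring).
    specialize (Hl' h I Hh).
    replace (g (z0 + h)%C * / h - g z0 * / h)%C with ((g (z0 + h)%C - g z0) * / h)%C by ring.
    rewrite Cmod_mult.
    pose proof (Cmod_ge_0 l).
    (* At [z0] itself the expression is 0, because its numerator vanishes. *)
    destruct (Req_dec (Cmod h) 0) as [E|E].
    + apply Cmod_eq_0 in E. rewrite E in *.
      replace (z0 + 0)%C with z0 by ring.
      replace (g z0 - g z0)%C with (RtoC 0) by ring.
      rewrite Cmod_0; lra.
    + assert (h <> 0) by (intros E'; apply E; rewrite E'; apply Cmod_0).
      rewrite Cmod_inv by auto.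
      pose proof (Cmod_ge_0 h).
      apply (Rle_div_l _ _ (Cmod h)); [lra|exact Hl']. }
rewrite rect_int_minus, rect_int_mult_const in HG; auto; try lra.
fold w in HG.
assert (E : (g z0 * w)%C = rect_int (fun z => g z * / (z - z0))%C a b c d).
{ replace (g z0 * w)%C with (rect_int (fun z => g z * / (z - z0)) a b c d
   - (rect_int (fun z => g z * / (z - z0)) a b c d - g z0 * w))%C by ring.
  rewrite HG; ring. }
assert (HB : Cmod (g z0 * w)%C <= 4 * (M * / dd) * ((b - a) + (d - c))).
{ rewrite E; apply rect_int_bound; auto; try lra.
  - intros x Hx'; split; apply Cmod_mult_le; (apply Hg1; auto) || (apply Hinv; auto; lra).
  - intros x Hx'; split; apply Cmod_mult_le; (apply Hg2; auto) || (apply Hinv; auto; lra). }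
rewrite Cmod_mult in HB.
apply Rle_div_r in HB; auto.
eapply Rle_trans; [exact HB|right; field; split; lra].
Qed.

(* Apply the Cauchy estimate to [f z / (z - c0) ^ n], which is differentiable at [c0]
   because [f] vanishes there, and let [n] tend to infinity. *)
Lemma zero_in_disc (f : C -> C) (p q r rho : R) (z0 : C) :
  0 < rho ->
  (forall x y, p - r <= x <= p + r -> q - r <= y <= q + r -> cdiff f (x, y)) ->
  (forall z, Cmod (z - (p, q)) < rho -> f z = 0) ->
  Cmod (z0 - (p, q)) < r -> f z0 = 0.
Proof.
intros Hrho Hf Hz Hz0.
set (c0 := (p, q) : C) in *.
pose proof (Cmod_ge_0 (z0 - c0)) as Hge.
assert (Hr : 0 < r) by lra.
destruct z0 as [x0 y0].
assert (Hre := re_le_Cmod ((x0, y0) - c0)); assert (Him := im_le_Cmod ((x0, y0) - c0)).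
unfold Re in Hre; unfold Im in Him; simpl in Hre, Him.
assert (Hx0 : p - r < x0 < p + r) by (destruct (Rabs_def2 (x0 + - p) r); lra).
assert (Hy0 : q - r < y0 < q + r) by (destruct (Rabs_def2 (y0 + - q) r); lra).
destruct (Cauchy_estimate (p - r) (p + r) (q - r) (q + r) x0 y0 Hx0 Hy0) as [K [HK HKe]].
assert (Hfc : forall x y, p - r <= x <= p + r -> q - r <= y <= q + r -> ccont f (x, y))
  by (intros; apply cdiff_ccont, Hf; auto).
destruct (rcont_bounded (fun x => f (x, q - r)) (p - r) (p + r)) as [M1 HM1];
 [lra|intros; apply rcont_hor, Hfc; lra|].
destruct (rcont_bounded (fun x => f (x, q + r)) (p - r) (p + r)) as [M2 HM2];
 [lra|intros; apply rcont_hor, Hfc; lra|].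
destruct (rcont_bounded (fun y => f (p - r, y)) (q - r) (q + r)) as [M3 HM3];
 [lra|intros; apply rcont_ver, Hfc; lra|].
destruct (rcont_bounded (fun y => f (p + r, y)) (q - r) (q + r)) as [M4 HM4];
 [lra|intros; apply rcont_ver, Hfc; lra|].
set (M := Rabs M1 + Rabs M2 + Rabs M3 + Rabs M4).
assert (HM : M1 <= M /\ M2 <= M /\ M3 <= M /\ M4 <= M).
{ unfold M; pose proof (Rabs_pos M1); pose proof (Rabs_pos M2); pose proof (Rabs_pos M3);
  pose proof (Rabs_pos M4); pose proof (Rle_abs M1); pose proof (Rle_abs M2);
  pose proof (Rle_abs M3); pose proof (Rle_abs M4); lra. }
assert (HM0 : 0 <= M) by (unfold M; pose proof (Rabs_pos M1); pose proof (Rabs_pos M2);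
  pose proof (Rabs_pos M3); pose proof (Rabs_pos M4); lra).
clearbody M.
set (q' := Cmod ((x0, y0) - c0)) in *.
assert (Hb : forall x y, p - r <= x <= p + r -> q - r <= y <= q + r ->
   x = p - r \/ x = p + r \/ y = q - r \/ y = q + r ->
   (x, y) <> c0 /\ Cmod (/ ((x, y) - c0))%C <= / r)
 by (intros; apply (rect_boundary_inv (p - r) (p + r) (q - r) (q + r)); auto; lra).
assert (Hest : forall n, Cmod (f (x0, y0)) * (/ q') ^ n <= K * (M * (/ r) ^ n) \/ q' = 0).
{ intros n. destruct (Req_dec q' 0) as [E|E]; [right; auto|left].
  assert (Nz : (x0, y0) <> c0).
  { intros E'; apply E; unfold q'; rewrite E'.
    replace (c0 - c0)%C with (RtoC 0) by ring; apply Cmod_0. }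
  replace (Cmod (f (x0, y0)) * (/ q') ^ n) with
   (Cmod (f (x0, y0) * (/ ((x0, y0) - c0)) ^ n)%C).
  2: { rewrite Cmod_mult, Cmod_pow, Cmod_inv by (apply Cminus_neq; auto); reflexivity. }
  apply (HKe (fun z => f z * (/ (z - c0)) ^ n)%C).
  - intros x y Hx Hy.
    destruct (Rlt_dec (Cmod ((x, y) - c0)) rho) as [Hl|Hl].
    + exists 0.
      apply (derw_ext_loc _ (fun _ => 0) _ _ _ (rho - Cmod ((x, y) - c0)));
       [lra| |apply derw_const].
      intros w Hw; rewrite Hz; [ring|].
      replace (w - c0)%C with ((w - (x, y)) + ((x, y) - c0))%C by ring.
      eapply Rle_lt_trans; [apply Cmod_triangle|lra].
    + apply cdiff_mult; [apply Hf; auto|].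
      apply cdiff_pow, cdiff_inv.
      * apply cdiff_minus; [apply cdiff_id|apply cdiff_const].
      * apply Cminus_neq; intros E'; apply Hl; rewrite E'.
        replace (c0 - c0)%C with (RtoC 0) by ring; rewrite Cmod_0; lra.
  - intros x Hx; split; (apply Cmod_mult_le;
     [eapply Rle_trans; [(apply HM1; lra) || (apply HM2; lra)|lra]|
      rewrite Cmod_pow; apply pow_incr; split; [apply Cmod_ge_0|apply Hb; lra]]).
  - intros x Hx; split; (apply Cmod_mult_le;
     [eapply Rle_trans; [(apply HM3; lra) || (apply HM4; lra)|lra]|
      rewrite Cmod_pow; apply pow_incr; split; [apply Cmod_ge_0|apply Hb; lra]]). }
destruct (Req_dec q' 0) as [E|E].
{ apply Hz; fold q'; lra. }
assert (Hq' : 0 < q') by lra.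
apply Cmod_eq_0, Rle_antisym; [|apply Cmod_ge_0].
apply Rnot_lt_le; intros Hpos.
destruct (pow_lt_1_zero (q' / r)) with (y := Cmod (f (x0, y0)) / (K * M + 1)) as [n Hn].
- rewrite Rabs_pos_eq; [apply Rlt_div_l; lra|apply Rdiv_le_0_compat; lra].
- apply Rdiv_lt_0_compat; nra.
- specialize (Hn n (le_n n)).
  destruct (Hest n) as [Hn'|]; [|lra].
  rewrite Rabs_pos_eq in Hn by (apply pow_le, Rdiv_le_0_compat; lra).
  unfold Rdiv in Hn; rewrite Rpow_mult_distr in Hn.
  assert (Hqn : 0 < q' ^ n) by (apply pow_lt; auto).
  rewrite (pow_inv q') in Hn'.
  assert (H1 : Cmod (f (x0, y0)) <= K * M * (q' ^ n * (/ r) ^ n)).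
  { apply Rmult_le_compat_r with (r := q' ^ n) in Hn'; [|lra].
    replace (Cmod (f (x0, y0)) * / q' ^ n * q' ^ n) with (Cmod (f (x0, y0))) in Hn' by (field; lra).
    lra. }
  set (X := q' ^ n * (/ r) ^ n) in *.
  assert (HX : 0 < X) by (apply Rmult_lt_0_compat; auto; apply pow_lt, Rinv_0_lt_compat; auto).
  assert (HKM : 0 <= K * M) by nra.
  assert (X * (K * M + 1) < Cmod (f (x0, y0))).
  { apply Rlt_le_trans with (Cmod (f (x0, y0)) * / (K * M + 1) * (K * M + 1)).
    - apply Rmult_lt_compat_r; lra.
    - right; field; lra. }
  nra.
Qed.

(** A march to the left along the horizontal line through the given point, in steps of r / 2. The
    square of half-side [r] about x + r/2 stays in the quadrant, so vanishing near x + r/2 spreads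
    to the disc of radius [r] about it, which contains the disc of radius r/2 about x. *)
Lemma identity_quadrant (f : C -> C) (X : R) :
  (forall z, 0 < Re z -> 0 < Im z -> cdiff f z) ->
  (forall z, 0 < Im z -> X < Re z -> f z = 0) ->
  forall z, 0 < Re z -> 0 < Im z -> f z = 0.
Proof.
intros Hf HX [x0 y0] Hx0 Hy0; unfold Re in Hx0; unfold Im in Hy0; simpl in Hx0, Hy0.
set (r := Rmin x0 y0 / 2).
assert (Hr : 0 < r) by (unfold r; assert (0 < Rmin x0 y0) by (apply Rmin_pos; auto); lra).
assert (Hrx : r <= x0 / 2) by (unfold r; pose proof (Rmin_l x0 y0); lra).
assert (Hry : r <= y0 / 2) by (unfold r; pose proof (Rmin_r x0 y0); lra).
clearbody r.
assert (HQ : forall j : nat, forall x, x0 <= x -> X + r - INR j * (r / 2) <= x ->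
   exists rho, 0 < rho /\ forall z, Cmod (z - (x, y0)) < rho -> f z = 0).
{ induction j as [|j IH]; intros x Hx Hxj.
  - simpl in Hxj. exists r; split; auto; intros z Hz.
    pose proof (re_le_Cmod (z - (x, y0))) as H1; pose proof (im_le_Cmod (z - (x, y0))) as H2.
    unfold Re in H1; unfold Im in H2; simpl in H1, H2.
    destruct (Rabs_def2 (fst z + - x) r ltac:(lra)).
    destruct (Rabs_def2 (snd z + - y0) r ltac:(lra)).
    apply HX; unfold Re, Im; lra.
  - rewrite S_INR in Hxj.
    destruct (IH (x + r / 2)) as [rho [Hrho H]]; [lra..|].
    exists (r / 2); split; [lra|]; intros z Hz.
    apply (zero_in_disc f (x + r / 2) y0 r rho); auto.
    + intros u v Hu Hv; apply Hf; unfold Re, Im; simpl; lra.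
    + replace (z - ((x + r / 2)%R, y0))%C with ((z - (x, y0)) - RtoC (r / 2))%C
       by (apply injective_projections; simpl; field).
      replace r with (r / 2 + r / 2) at 2 by field.
      eapply Rle_lt_trans; [apply Cmod_triangle|].
      rewrite Cmod_opp, Cmod_R, Rabs_pos_eq; lra. }
destruct (nfloor_ex (Rabs (X + r - x0) / (r / 2))) as [n [_ Hn]].
{ apply Rdiv_le_0_compat; [apply Rabs_pos|lra]. }
destruct (HQ (S n) x0) as [rho [Hrho H]]; [lra| |].
- rewrite S_INR.
  apply (Rlt_div_l _ _ (r / 2)) in Hn; [|lra].
  pose proof (Rle_abs (X + r - x0)); lra.
- apply H. replace ((x0, y0) - (x0, y0))%C with (RtoC 0)
    by (apply injective_projections; simpl; ring).
  rewrite Cmod_0; auto.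
Qed.

(** * Finite sums and limits of complex sequences *)

Fixpoint csum (f : nat -> C) (n : nat) : C :=
  match n with O => RtoC 0 | S n => (csum f n + f n)%C end.

Fixpoint rsum (f : nat -> R) (n : nat) : R :=
  match n with O => 0 | S n => rsum f n + f n end.

Lemma csum_ext (f g : nat -> C) n :
  (forall i, (i < n)%nat -> f i = g i) -> csum f n = csum g n.
Proof. induction n; simpl; intros H; auto; rewrite IHn, H; auto. Qed.

Lemma rsum_ext (f g : nat -> R) n :
  (forall i, (i < n)%nat -> f i = g i) -> rsum f n = rsum g n.
Proof. induction n; simpl; intros H; auto; rewrite IHn, H; auto. Qed.

Lemma csum_plus (f g : nat -> C) n :
  csum (fun i => f i + g i)%C n = (csum f n + csum g n)%C.
Proof. induction n; simpl; [ring|rewrite IHn; ring]. Qed.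

Lemma csum_minus (f g : nat -> C) n :
  csum (fun i => f i - g i)%C n = (csum f n - csum g n)%C.
Proof. induction n; simpl; [ring|rewrite IHn; ring]. Qed.

Lemma csum_mult (c : C) (f : nat -> C) n :
  csum (fun i => c * f i)%C n = (c * csum f n)%C.
Proof. induction n; simpl; [ring|rewrite IHn; ring]. Qed.

Lemma rsum_plus (f g : nat -> R) n :
  rsum (fun i => f i + g i) n = rsum f n + rsum g n.
Proof. induction n; simpl; [ring|rewrite IHn; ring]. Qed.

Lemma rsum_mult (c : R) (f : nat -> R) n : rsum (fun i => c * f i) n = c * rsum f n.
Proof. induction n; simpl; [ring|rewrite IHn; ring]. Qed.

Lemma rsum_le (f g : nat -> R) n :
  (forall i, (i < n)%nat -> f i <= g i) -> rsum f n <= rsum g n.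
Proof.
induction n; simpl; intros H; [lra|].
apply Rplus_le_compat; auto.
Qed.

Lemma rsum_const (c : R) n : rsum (fun _ => c) n = INR n * c.
Proof. induction n; [simpl; ring|rewrite S_INR; cbn [rsum]; rewrite IHn; ring]. Qed.

Lemma rsum_telescope (V : nat -> R) n : rsum (fun i => V i - V (S i)) n = V O - V n.
Proof. induction n; simpl; [ring|rewrite IHn; ring]. Qed.

Lemma Cmod_csum_le (f : nat -> C) n : Cmod (csum f n) <= rsum (fun i => Cmod (f i)) n.
Proof.
induction n; simpl; [rewrite Cmod_0; lra|].
eapply Rle_trans; [apply Cmod_triangle|lra].
Qed.

Lemma csum_add (f : nat -> C) n m :
  csum f (n + m) = (csum f n + csum (fun i => f (n + i)%nat) m)%C.
Proof.
induction m; [rewrite Nat.add_0_r; simpl; ring|].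
rewrite Nat.add_succ_r; simpl; rewrite IHm; ring.
Qed.

Lemma rsum_add (f : nat -> R) n m :
  rsum f (n + m) = rsum f n + rsum (fun i => f (n + i)%nat) m.
Proof.
induction m; [rewrite Nat.add_0_r; simpl; ring|].
rewrite Nat.add_succ_r; simpl; rewrite IHm; ring.
Qed.

(** [V] acts as a potential: terms dominated by its decrements have tails dominated by [V]. All
    convergence proofs below take this form, so no series of absolute values has to be
    introduced. *)
Lemma csum_tail_le (f : nat -> C) (V : nat -> R) (N M : nat) : (N <= M)%nat ->
  (forall k, (N <= k < M)%nat -> Cmod (f k) <= V k - V (S k)) ->
  Cmod (csum f M - csum f N) <= V N - V M.
Proof.
intros HNM; induction HNM as [|M HNM IH]; intros H.
- replace (csum f N - csum f N)%C with (RtoC 0) by ring; rewrite Cmod_0; lra.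
- replace (csum f (S M) - csum f N)%C with ((csum f M - csum f N) + f M)%C by (simpl; ring).
  replace (V N - V (S M)) with ((V N - V M) + (V M - V (S M))) by ring.
  apply Cmod_triangle_le; [apply IH; intros; apply H; lia|apply H; lia].
Qed.

Definition clim (u : nat -> C) (l : C) : Prop :=
  forall eps, 0 < eps -> exists N, forall n, (N <= n)%nat -> Cmod (u n - l) < eps.

Definition tendsto0 (V : nat -> R) : Prop :=
  forall eps, 0 < eps -> exists N, forall n, (N <= n)%nat -> V n < eps.

(** A total operator, meaningful once [clim] is known; it lets the continued functions be written as
    closed expressions before convergence is proved. *)
Definition Clim (u : nat -> C) : C :=
  (real (Lim_seq (fun n => Re (u n))), real (Lim_seq (fun n => Im (u n)))).

Lemma clim_Clim (u : nat -> C) (l : C) : clim u l -> Clim u = l.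
Proof.
intros H.
assert (H1 : is_lim_seq (fun n => Re (u n)) (Re l)).
{ apply is_lim_seq_spec; intros eps; destruct (H eps (cond_pos eps)) as [N HN].
  exists N; intros n Hn; eapply Rle_lt_trans; [|apply (HN n Hn)].
  apply (re_le_Cmod (u n - l)). }
assert (H2 : is_lim_seq (fun n => Im (u n)) (Im l)).
{ apply is_lim_seq_spec; intros eps; destruct (H eps (cond_pos eps)) as [N HN].
  exists N; intros n Hn; eapply Rle_lt_trans; [|apply (HN n Hn)].
  apply (im_le_Cmod (u n - l)). }
unfold Clim; rewrite (is_lim_seq_unique _ _ H1), (is_lim_seq_unique _ _ H2).
destruct l; reflexivity.
Qed.

Lemma clim_unique (u : nat -> C) (l l' : C) : clim u l -> clim u l' -> l = l'.
Proof. intros H H'; rewrite <- (clim_Clim _ _ H), <- (clim_Clim _ _ H'); auto. Qed.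

Lemma clim_bound (u : nat -> C) (l z : C) (B : R) (N0 : nat) :
  clim u l -> (forall n, (N0 <= n)%nat -> Cmod (u n - z) <= B) -> Cmod (l - z) <= B.
Proof.
intros H HB; apply Rnot_lt_le; intros Hlt.
destruct (H (Cmod (l - z) - B) ltac:(lra)) as [N HN].
specialize (HN (N + N0)%nat ltac:(lia)); specialize (HB (N + N0)%nat ltac:(lia)).
assert (Cmod (l - z) <= Cmod (u (N + N0)%nat - z) + Cmod (u (N + N0)%nat - l)); [|lra].
replace (l - z)%C with ((u (N + N0)%nat - z) - (u (N + N0)%nat - l))%C by ring.
apply Cmod_minus_le; lra.
Qed.

Lemma clim_plus (u v : nat -> C) (a b : C) :
  clim u a -> clim v b -> clim (fun n => u n + v n)%C (a + b)%C.
Proof.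
intros Hu Hv eps He.
destruct (Hu (eps / 2) ltac:(lra)) as [N1 H1].
destruct (Hv (eps / 2) ltac:(lra)) as [N2 H2].
exists (N1 + N2)%nat; intros n Hn.
specialize (H1 n ltac:(lia)); specialize (H2 n ltac:(lia)).
replace (u n + v n - (a + b))%C with ((u n - a) + (v n - b))%C by ring.
eapply Rle_lt_trans; [apply Cmod_triangle|lra].
Qed.

Lemma clim_mult_const (c : C) (u : nat -> C) (a : C) :
  clim u a -> clim (fun n => c * u n)%C (c * a)%C.
Proof.
intros Hu eps He; pose proof (Cmod_ge_0 c) as Hc.
destruct (Hu (eps / (Cmod c + 1)) ltac:(apply Rdiv_lt_0_compat; lra)) as [N H].
exists N; intros n Hn; specialize (H n Hn).
replace (c * u n - c * a)%C with (c * (u n - a))%C by ring; rewrite Cmod_mult.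
pose proof (Cmod_ge_0 (u n - a)).
apply Rle_lt_trans with ((Cmod c + 1) * Cmod (u n - a)); [nra|].
apply Rlt_le_trans with ((Cmod c + 1) * (eps / (Cmod c + 1)));
  [apply Rmult_lt_compat_l; lra|right; field; lra].
Qed.

Lemma clim_of_bound (u : nat -> C) (l : C) (V : nat -> R) :
  tendsto0 V -> (forall n, Cmod (l - u n) <= V n) -> clim u l.
Proof.
intros HV H eps He; destruct (HV eps He) as [N HN]; exists N; intros n Hn.
rewrite Cmod_minus_sym; eapply Rle_lt_trans; [apply H|auto].
Qed.

(** The Cauchy modulus [V] serves twice: it gives convergence, and it remains as the error bound for
    the limit. *)
Lemma clim_complete (u : nat -> C) (V : nat -> R) : tendsto0 V ->
  (forall N M, (N <= M)%nat -> Cmod (u M - u N) <= V N) ->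
  clim u (Clim u) /\ forall N, Cmod (Clim u - u N) <= V N.
Proof.
intros HV H.
assert (HC : forall g : C -> R, (forall z w, Rabs (g z - g w) <= Cmod (z - w)) ->
  exists l : R, is_lim_seq (fun n => g (u n)) l).
{ intros g Hg; apply ex_lim_seq_cauchy_corr; intros eps.
  destruct (HV eps (cond_pos eps)) as [N HN]. exists N; intros n m Hn Hm.
  assert (forall a b, (N <= a)%nat -> (a <= b)%nat -> Rabs (g (u b) - g (u a)) < eps).
  { intros a b Ha Hb; eapply Rle_lt_trans; [apply Hg|].
    eapply Rle_lt_trans; [apply H; auto|auto]. }
  destruct (Nat.le_gt_cases n m).
  - rewrite Rabs_minus_sym; auto.
  - apply H0; auto; lia. }
destruct (HC Re) as [x Hx].
{ intros z w; apply (re_le_Cmod (z - w)). }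
destruct (HC Im) as [y Hy].
{ intros z w; apply (im_le_Cmod (z - w)). }
assert (HL : clim u (x, y)).
{ intros eps He.
  apply is_lim_seq_spec in Hx, Hy.
  destruct (Hx (mkposreal (eps / 2) ltac:(lra))) as [N1 H1].
  destruct (Hy (mkposreal (eps / 2) ltac:(lra))) as [N2 H2].
  exists (N1 + N2)%nat; intros n Hn.
  specialize (H1 n ltac:(lia)); specialize (H2 n ltac:(lia)); simpl in H1, H2.
  eapply Rle_lt_trans; [apply Cmod_le_Re_Im|].
  unfold Re, Im in *; simpl in *; unfold Rminus in *; lra. }
rewrite (clim_Clim _ _ HL); split; auto.
intros N; apply (clim_bound u _ _ _ N HL); auto.
Qed.

(** * Series of holomorphic functions *)

Lemma cder_csum (F F' : nat -> C -> C) (z : C) n :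
  (forall i, cder (F i) z (F' i z)) ->
  cder (fun w => csum (fun i => F i w) n) z (csum (fun i => F' i z) n).
Proof.
intros H; induction n; simpl; [apply derw_const|apply derw_plus; auto; apply H].
Qed.

(** Domination is asked of the derivatives. The mean value inequality on the segment from [s0] to
    [s0 + h] turns it into the bound V N |h| for the tail of the increments, uniformly in [h], while
    the first [N] terms form a finite sum. *)
Lemma series_cdiff (F F' : nat -> C -> C) (V : nat -> R) (f : C -> C) (s0 : C) (r : R) :
  0 < r -> tendsto0 V -> (forall n, 0 <= V n) ->
  (forall i z, Cmod (z - s0) < r -> cder (F i) z (F' i z)) ->
  (forall i z, Cmod (z - s0) < r -> Cmod (F' i z) <= V i - V (S i)) ->
  (forall z, Cmod (z - s0) < r -> clim (fun n => csum (fun i => F i z) n) (f z)) ->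
  cdiff f s0.
Proof.
intros Hr HV HV0 Hd Hb Hl.
assert (Hs0 : Cmod (s0 - s0) < r).
{ replace (s0 - s0)%C with (RtoC 0) by ring; rewrite Cmod_0; auto. }
destruct (clim_complete (fun n => csum (fun i => F' i s0) n) V HV) as [_ HL].
{ intros N M HNM.
  eapply Rle_trans; [apply (csum_tail_le _ V); auto|].
  specialize (HV0 M); lra. }
set (l := Clim (fun n => csum (fun i => F' i s0) n)) in *.
exists l; intros eps He.
destruct (HV (eps / 3) ltac:(lra)) as [N HN]; specialize (HN N (le_n N)).
destruct (cder_csum F F' s0 N (fun i => Hd i s0 Hs0) (eps / 3) ltac:(lra)) as [d [Hd0 Hdd]].
exists (Rmin d r); split; [apply Rmin_pos; auto|].
intros h _ Hh; apply Rmin_Rgt in Hh as [Hh1 Hh2].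
specialize (Hdd h I Hh1); cbv beta in Hdd.
pose proof (Cmod_ge_0 h) as Hh0.
set (A := fun z n => csum (fun i => F i z) n).
assert (Hseg : forall t, 0 <= t <= 1 -> Cmod (s0 + RtoC t * ((s0 + h) - s0) - s0)%C < r).
{ intros t Ht; replace (s0 + RtoC t * ((s0 + h) - s0) - s0)%C with (RtoC t * h)%C by ring.
  rewrite Cmod_mult, Cmod_R, Rabs_pos_eq by lra; nra. }
assert (Hsh : Cmod (s0 + h - s0) < r).
{ replace (s0 + h - s0)%C with h by ring; lra. }
assert (HT : Cmod ((f (s0 + h) - f s0) - (A (s0 + h)%C N - A s0 N))%C <= V N * Cmod h).
{ apply (clim_bound (fun n => A (s0 + h)%C n + - (1) * A s0 n)%C _ _ _ N).
  - replace (f (s0 + h) - f s0)%C with (f (s0 + h) + - (1) * f s0)%C by ring.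
    apply clim_plus; [apply Hl; auto|apply clim_mult_const, Hl; auto].
  - intros M HM.
    replace (A (s0 + h)%C M + - (1) * A s0 M - (A (s0 + h)%C N - A s0 N))%C with
     (csum (fun i => F i (s0 + h) - F i s0)%C M - csum (fun i => F i (s0 + h) - F i s0)%C N)%C
      by (unfold A; rewrite !csum_minus; ring).
    eapply Rle_trans.
    + apply (csum_tail_le _ (fun n => V n * Cmod h)); auto.
      intros k Hk; rewrite <- Rmult_minus_distr_r.
      eapply Rle_trans; [apply (mean_value_ineq_line (F k) (F' k) s0 (s0 + h) (V k - V (S k)))|].
      * intros t Ht; apply Hd, Hseg; auto.
      * intros t Ht; apply Hb, Hseg; auto.
      * replace (s0 + h - s0)%C with h by ring; lra.
    + specialize (HV0 M); nra. }
specialize (HL N); cbv beta in HL.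
replace (f (s0 + h) - f s0 - l * h)%C with
 (((f (s0 + h) - f s0) - (A (s0 + h)%C N - A s0 N)) +
  (A (s0 + h)%C N - A s0 N - csum (fun i => F' i s0) N * h)
  - (l - csum (fun i => F' i s0) N) * h)%C by ring.
eapply Rle_trans; [apply Cmod_minus_le; [apply Cmod_triangle_le; [exact HT|exact Hdd]|
  apply Cmod_mult_le; [exact HL|apply Rle_refl]]|].
nra.
Qed.

(** * Sums of powers *)

Lemma Rpower_MVT (x e : R) : 0 < x -> exists c, x <= c <= x + 1 /\
  Rpower (x + 1) e - Rpower x e = e * Rpower c (e - 1).
Proof.
intros Hx.
destruct (MVT_gen (fun y => Rpower y e) x (x + 1) (fun y => e * Rpower y (e - 1)))
  as [c [Hc Ec]].
- intros y Hy; rewrite Rmin_left, Rmax_right in Hy by lra; apply is_derive_Rpower; lra.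
- intros y Hy; rewrite Rmin_left, Rmax_right in Hy by lra.
  apply continuity_pt_filterlim, (ex_derive_continuous (fun y => Rpower y e)).
  eexists; apply is_derive_Rpower; lra.
- rewrite Rmin_left, Rmax_right in Hc by lra.
  exists c; split; [auto|rewrite Ec; ring].
Qed.

(** The mean value theorem gives the power at a point c <= x + 1 <= 2 x; the factor 2^(1+e) pays for
    the return from 2 x to x. *)
Lemma Rpower_diff_lower (x e : R) : 1 <= x -> 0 < e ->
  Rpower x (- 1 - e) <= Rpower 2 (1 + e) / e * (Rpower x (- e) - Rpower (x + 1) (- e)).
Proof.
intros Hx He.
destruct (Rpower_MVT x (- e)) as [c [Hc Ec]]; [lra|].
replace (Rpower x (- e) - Rpower (x + 1) (- e)) with (e * Rpower c (- e - 1)) by lra.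
assert (H1 : Rpower (2 * x) (- e - 1) <= Rpower c (- e - 1)).
{ apply Rpower_le_base_neg; lra. }
rewrite <- Rpower_mult_distr in H1 by lra.
replace (-1 - e) with (- e - 1) by ring.
replace (Rpower 2 (1 + e) / e * (e * Rpower c (- e - 1))) with
 (Rpower 2 (1 + e) * Rpower c (- e - 1)) by (field; lra).
apply Rle_trans with (Rpower 2 (1 + e) * (Rpower 2 (- e - 1) * Rpower x (- e - 1))).
- rewrite <- Rmult_assoc, <- Rpower_plus.
  replace (1 + e + (- e - 1)) with 0 by ring. rewrite Rpower_O; lra.
- apply Rmult_le_compat_l; [left; apply Rpower_pos|auto].
Qed.

Lemma INR_S_ge_1 (i : nat) : 1 <= INR (S i).
Proof. rewrite S_INR; pose proof (pos_INR i); lra. Qed.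

Lemma INR_S_pos (i : nat) : 0 < INR (S i).
Proof. pose proof (INR_S_ge_1 i); lra. Qed.

Lemma Rpower_tendsto0 (K e : R) : 0 <= K -> 0 < e ->
  tendsto0 (fun n => K * Rpower (INR (S n)) (- e)).
Proof.
intros HK He eps Heps.
set (X := Rpower ((K + 1) / eps) (/ e)).
assert (HKe : 0 < (K + 1) / eps) by (apply Rdiv_lt_0_compat; lra).
destruct (nfloor_ex X) as [N [_ HN]]; [left; apply Rpower_pos|].
exists N; intros n Hn.
assert (HX : X <= INR (S n)).
{ rewrite S_INR; apply le_INR in Hn; lra. }
assert (H1 : Rpower (INR (S n)) (- e) <= eps / (K + 1)).
{ eapply Rle_trans; [apply (Rpower_le_base_neg X); [lra|split; [apply Rpower_pos|auto]]|].
  unfold X; rewrite Rpower_mult.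
  replace (/ e * - e) with (- (1)) by (field; lra).
  rewrite Rpower_Ropp, Rpower_1 by auto. right; field; lra. }
apply Rle_lt_trans with (K * (eps / (K + 1))); [apply Rmult_le_compat_l; lra|].
apply Rlt_le_trans with ((K + 1) * (eps / (K + 1))); [|right; field; lra].
apply Rmult_lt_compat_r; [apply Rdiv_lt_0_compat; lra|lra].
Qed.

(** A potential for the series of K k^(-1-e): its decrements dominate the terms, so it bounds every
    tail. *)
Definition ptail (K e : R) (n : nat) : R :=
  K * (Rpower 2 (1 + e) / e) * Rpower (INR (S n)) (- e).

Lemma ptail_diff (K e : R) (i : nat) : 0 <= K -> 0 < e ->
  K * Rpower (INR (S i)) (- 1 - e) <= ptail K e i - ptail K e (S i).
Proof.
intros HK He; unfold ptail.
rewrite (S_INR (S i)).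
pose proof (Rpower_diff_lower (INR (S i)) e (INR_S_ge_1 i) He) as H.
apply (Rmult_le_compat_l K) in H; auto. lra.
Qed.

Lemma ptail_const_pos (e : R) : 0 < e -> 0 < Rpower 2 (1 + e) / e.
Proof. intros; apply Rdiv_lt_0_compat; auto; apply Rpower_pos. Qed.

Lemma ptail_pos (K e : R) n : 0 <= K -> 0 < e -> 0 <= ptail K e n.
Proof.
intros HK He; unfold ptail; pose proof (ptail_const_pos e He).
apply Rmult_le_pos; [nra|left; apply Rpower_pos].
Qed.

Lemma ptail_tendsto0 (K e : R) : 0 <= K -> 0 < e -> tendsto0 (ptail K e).
Proof.
intros HK He; unfold ptail; pose proof (ptail_const_pos e He).
apply Rpower_tendsto0; auto; apply Rmult_le_pos; lra.
Qed.

Lemma Rpower_diff_lower_pos (x b : R) : 1 <= x -> 0 <= b < 1 ->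
  Rpower x (- b) <= 2 / (1 - b) * (Rpower (x + 1) (1 - b) - Rpower x (1 - b)).
Proof.
intros Hx Hb.
destruct (Rpower_MVT x (1 - b)) as [c [Hc Ec]]; [lra|].
rewrite Ec. replace (1 - b - 1) with (- b) by ring.
assert (H1 : Rpower (2 * x) (- b) <= Rpower c (- b)) by (apply Rpower_le_base_neg; lra).
rewrite <- Rpower_mult_distr in H1 by lra.
replace (2 / (1 - b) * ((1 - b) * Rpower c (- b))) with
 (2 * Rpower c (- b)) by (field; lra).
apply Rle_trans with (2 * (Rpower 2 (- b) * Rpower x (- b))); [|lra].
assert (1 <= 2 * Rpower 2 (- b)).
{ rewrite <- Rpower_succ by lra; apply Rpower_ge_1; lra. }
pose proof (Rpower_pos x (- b)). nra.
Qed.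

Lemma rsum_Rpower_le (b : R) n : 0 <= b < 1 ->
  rsum (fun i => Rpower (INR (S i)) (- b)) n <= 2 / (1 - b) * Rpower (INR (S n)) (1 - b).
Proof.
intros Hb.
assert (0 < 2 / (1 - b)) by (apply Rdiv_lt_0_compat; lra).
induction n as [|n IH].
- cbn [rsum]; apply Rmult_le_pos; [lra|left; apply Rpower_pos].
- cbn [rsum]. pose proof (Rpower_diff_lower_pos (INR (S n)) b (INR_S_ge_1 n) Hb).
  rewrite (S_INR (S n)). lra.
Qed.

(** * The zeta function in the right half-plane *)

(* The index [i] stands for the integer [i + 1]: the terms are [(i + 1) ^ (- s)]. *)
Definition dterm (s : C) (i : nat) : C := xpow (INR (S i)) (- s).

(** With k = i + 1, this is s - 1 times the difference between k^(-s) and the integral of x^(-s)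
    over [k, k + 1]. The factor s - 1 clears the denominator of the integral and makes each term
    entire in s. *)
Definition zeta_term (i : nat) (s : C) : C :=
  ((s - 1) * dterm s i - xpow (INR (S i)) (1 - s) + xpow (INR (S (S i))) (1 - s))%C.

Definition zeta_term_deriv (i : nat) (s : C) : C :=
  (dterm s i - (s - 1) * RtoC (ln (INR (S i))) * dterm s i
   + RtoC (ln (INR (S i))) * xpow (INR (S i)) (1 - s)
   - RtoC (ln (INR (S (S i)))) * xpow (INR (S (S i))) (1 - s))%C.

(* [sum_i zeta_term i s = (s - 1) * zeta(s) - 1], and the series converges for [Re s > 0]. *)
Definition zeta_cont (s : C) : C := ((1 + Clim (fun n => csum (fun i => zeta_term i s) n)) / (s - 1))%C.

Lemma csum_zeta_term (s : C) n :
  csum (fun i => zeta_term i s) n = ((s - 1) * csum (dterm s) n - 1 + xpow (INR (S n)) (1 - s))%C.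
Proof.
induction n as [|n IH].
- cbn [csum]; simpl INR; rewrite xpow_base_1; ring.
- cbn [csum]; rewrite IH; unfold zeta_term; ring.
Qed.

Lemma xpow_diff_bound (x y : R) (s : C) : 0 < x <= y -> - 1 <= Re s ->
  Cmod (xpow y (- s) - xpow x (- s)) <= Cmod s * Rpower x (- Re s - 1) * (y - x).
Proof.
intros Hxy Hs; rewrite Rmult_minus_distr_l.
apply (mean_value_ineq (fun t => xpow t (- s)) (fun t => - s * xpow t (- s - 1))%C
  (fun t => Cmod s * Rpower x (- Re s - 1) * t) (fun _ => Cmod s * Rpower x (- Re s - 1))).
- lra.
- intros t Ht; apply rder_xpow; lra.
- intros t Ht; auto_derive; auto; ring.
- intros t Ht; apply Cmod_mult_le; [rewrite Cmod_opp; lra|].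
  rewrite Cmod_xpow; replace (Re (- s - 1)%C) with (- Re s - 1) by (unfold Re; simpl; ring).
  apply Rpower_le_base_neg; lra.
Qed.

(** Replacing x^(-s) by k^(-s) on [k, k + 1] gains one power of k. The primitive of the difference
    is fed directly to the mean value inequality, so no integral appears. *)
Lemma Cmod_zeta_term_le (i : nat) (s : C) : - 1 <= Re s ->
  Cmod (zeta_term i s) <= Cmod (1 - s) * Cmod s * Rpower (INR (S i)) (- 1 - Re s).
Proof.
intros Hs; unfold zeta_term, dterm; rewrite (S_INR (S i)).
pose proof (INR_S_ge_1 i) as Hk; set (k := INR (S i)) in *; clearbody k.
pose proof (mean_value_ineq
  (fun t => xpow t (1 - s) + RtoC t * ((s - 1) * xpow k (- s)))%C
  (fun t => (1 - s) * (xpow t (- s) - xpow k (- s)))%C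
  (fun t => Cmod (1 - s) * Cmod s * Rpower k (- 1 - Re s) * t)
  (fun _ => Cmod (1 - s) * Cmod s * Rpower k (- 1 - Re s)) k (k + 1) ltac:(lra)) as H.
cbv beta in H.
replace (Cmod (1 - s) * Cmod s * Rpower k (- 1 - Re s)) with
  (Cmod (1 - s) * Cmod s * Rpower k (- 1 - Re s) * (k + 1) -
   Cmod (1 - s) * Cmod s * Rpower k (- 1 - Re s) * k) by ring.
replace ((s - 1) * xpow k (- s) - xpow k (1 - s) + xpow (k + 1) (1 - s))%C with
 (xpow (k + 1) (1 - s) + RtoC (k + 1) * ((s - 1) * xpow k (- s)) -
  (xpow k (1 - s) + RtoC k * ((s - 1) * xpow k (- s))))%C by (rewrite RtoC_plus; ring).
apply H; clear H.
- intros t Ht; unfold rder.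
  eapply derw_eq; [|apply derw_plus; [apply rder_xpow; lra|
   apply derw_mult; [apply rder_RtoC, (is_derive_id (K:=R_AbsRing))|apply derw_const]]].
  simpl; change one with 1.
  replace (1 - s - 1)%C with (- s)%C by ring. ring.
- intros t Ht; auto_derive; auto; ring.
- intros t Ht; rewrite Rmult_assoc; apply Cmod_mult_le; [lra|].
  eapply Rle_trans; [apply xpow_diff_bound; lra|].
  replace (- Re s - 1) with (- 1 - Re s) by ring.
  pose proof (Rpower_pos k (- 1 - Re s)); pose proof (Cmod_ge_0 s).
  assert (0 <= Cmod s * Rpower k (- 1 - Re s)) by nra. nra.
Qed.

Lemma ln_le_Rpower (x d : R) : 1 <= x -> 0 < d -> ln x <= Rpower x d / d.
Proof.
intros Hx Hd; apply Rle_div_r; auto.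
unfold Rpower. pose proof (exp_ineq1_le (d * ln x)). lra.
Qed.

(** As for [zeta_term], with [eta], the derivative of ln t * t^(1-s), in place of a power: the term
    is the increment of a function with derivative eta k - eta t. The logarithm costs t^d, paid for
    by the margin [d + e <= Re s]; the constant is uniform in |s| <= S0, as differentiation of the
    series requires. *)
Lemma Cmod_zeta_term_deriv_le (i : nat) (s : C) (S0 d e : R) : Cmod s <= S0 -> 0 < d -> 0 < e ->
  d + e <= Re s ->
  Cmod (zeta_term_deriv i s) <= 2 * (1 + S0) ^ 2 * (1 + / d) * Rpower (INR (S i)) (- 1 - e).
Proof.
intros HS Hd He Hs; unfold zeta_term_deriv, dterm; rewrite (S_INR (S i)).
pose proof (INR_S_ge_1 i) as Hk; set (k := INR (S i)) in *; clearbody k.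
pose proof (Cmod_ge_0 s) as Hs0.
set (K := 2 * (1 + S0) ^ 2 * (1 + / d) * Rpower k (- 1 - e)).
assert (Hd' : 0 < / d) by (apply Rinv_0_lt_compat; auto).
assert (HK : 0 <= K).
{ unfold K; repeat apply Rmult_le_pos; try nra. left; apply Rpower_pos. }
set (eta := fun t => (xpow t (- s) * (1 + (1 - s) * RtoC (ln t)))%C).
set (eta' := fun t => (- s * xpow t (- s - 1) * (1 + (1 - s) * RtoC (ln t))
  + xpow t (- s) * ((1 - s) * RtoC (/ t)))%C).
assert (Heta : forall t, k <= t <= k + 1 -> Cmod (eta k - eta t) <= K).
{ intros t Ht; rewrite Cmod_minus_sym.
  apply Rle_trans with (K * t - K * k); [|nra].
  apply (mean_value_ineq eta eta' (fun t => K * t) (fun _ => K)); [lra| | |].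
  - intros u Hu; unfold rder, eta, eta'.
    eapply derw_eq; [|apply derw_mult; [apply rder_xpow; lra|
     apply derw_plus; [apply derw_const|apply derw_scal, (rder_RtoC ln u (/ u))]]].
    + simpl; ring.
    + auto_derive; [lra|field; lra].
  - intros u Hu; auto_derive; auto; ring.
  - intros u Hu; unfold eta'.
    replace (xpow u (- s)) with (RtoC u * xpow u (- s - 1))%C.
    2: { rewrite <- xpow_succ by lra; f_equal; ring. }
    replace (- s * xpow u (- s - 1) * (1 + (1 - s) * RtoC (ln u)) +
      RtoC u * xpow u (- s - 1) * ((1 - s) * RtoC (/ u)))%C with
     (xpow u (- s - 1) * (- s * (1 + (1 - s) * RtoC (ln u)) + (1 - s) * (RtoC u * RtoC (/ u))))%C
     by ring.
    rewrite <- RtoC_mult, Rinv_r by lra.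
    rewrite Cmod_mult, Cmod_xpow.
    replace (Re (- s - 1)%C) with (- Re s - 1) by (unfold Re; simpl; ring).
    pose proof (ln_nonneg u ltac:(lra)) as Hl0.
    pose proof (ln_le_Rpower u d ltac:(lra) Hd) as Hl.
    assert (H1s : Cmod (1 - s) <= 1 + S0).
    { apply Cmod_minus_le; [rewrite Cmod_1; lra|auto]. }
    assert (HE : Cmod (- s * (1 + (1 - s) * RtoC (ln u)) + (1 - s) * 1)%C
       <= S0 * (1 + (1 + S0) * ln u) + (1 + S0) * 1).
    { apply Cmod_triangle_le; apply Cmod_mult_le; auto.
      - rewrite Cmod_opp; auto.
      - apply Cmod_triangle_le; [rewrite Cmod_1; lra|].
        apply Cmod_mult_le; auto. rewrite Cmod_R, Rabs_pos_eq; lra.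
      - rewrite Cmod_1; lra. }
    assert (Hud : 1 <= Rpower u d) by (apply Rpower_ge_1; lra).
    assert (HE2 : Cmod (- s * (1 + (1 - s) * RtoC (ln u)) + (1 - s) * 1)%C
       <= 2 * (1 + S0) ^ 2 * (1 + / d) * Rpower u d).
    { eapply Rle_trans; [exact HE|].
      apply Rle_trans with (2 * (1 + S0) ^ 2 * (1 + ln u)); [nra|].
      rewrite (Rmult_assoc (2 * (1 + S0) ^ 2)); apply Rmult_le_compat_l; [nra|].
      unfold Rdiv in Hl; nra. }
    eapply Rle_trans; [apply Rmult_le_compat_l, HE2; left; apply Rpower_pos|].
    replace (Rpower u (- Re s - 1) * (2 * (1 + S0) ^ 2 * (1 + / d) * Rpower u d)) with
     (2 * (1 + S0) ^ 2 * (1 + / d) * (Rpower u (- Re s - 1) * Rpower u d)) by ring.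
    unfold K; apply Rmult_le_compat_l; [repeat apply Rmult_le_pos; nra|].
    rewrite <- Rpower_plus.
    apply Rle_trans with (Rpower u (- 1 - e)); [apply Rpower_le_exp; lra|].
    apply Rpower_le_base_neg; lra. }
pose proof (mean_value_ineq
  (fun t => RtoC t * eta k - RtoC (ln t) * xpow t (1 - s))%C
  (fun t => eta k - eta t)%C (fun t => K * t) (fun _ => K) k (k + 1) ltac:(lra)) as H.
cbv beta in H.
replace K with (K * (k + 1) - K * k) by ring.
match goal with |- Cmod ?A <= _ => replace A with
 (RtoC (k + 1) * eta k - RtoC (ln (k + 1)) * xpow (k + 1) (1 - s) -
  (RtoC k * eta k - RtoC (ln k) * xpow k (1 - s)))%C
 by (unfold eta; rewrite RtoC_plus; ring) end.
apply H; clear H.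
- intros t Ht; unfold rder.
  eapply derw_eq; [|apply derw_minus; [
   apply derw_mult; [apply rder_RtoC, (is_derive_id (K:=R_AbsRing))|apply derw_const]|
   apply derw_mult; [apply (rder_RtoC ln t (/ t)); auto_derive; [lra|field; lra]|
     apply rder_xpow; lra]]].
  simpl; change one with 1; unfold eta.
  replace (1 - s - 1)%C with (- s)%C by ring.
  replace (1 - s)%C with (- s + 1)%C by ring.
  rewrite (xpow_succ t) by lra.
  replace (RtoC (/ t) * (RtoC t * xpow t (- s)))%C with
    ((RtoC (/ t) * RtoC t) * xpow t (- s))%C by ring.
  rewrite <- (RtoC_mult (/ t) t), Rinv_l by lra. ring.
- intros t Ht; auto_derive; auto; ring.
- intros t Ht; apply Heta; lra.
Qed.

Lemma cder_xpow_neg (x : R) (s : C) :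
  cder (fun s => xpow x (- s)) s (- (RtoC (ln x) * xpow x (- s)))%C.
Proof.
eapply derw_eq; [|apply (derw_comp _ (xpow x) (fun s => - s)%C);
  [apply derw_opp, derw_id|apply cder_xpow]]. ring.
Qed.

Lemma cder_xpow_1_neg (x : R) (s : C) :
  cder (fun s => xpow x (1 - s)) s (- (RtoC (ln x) * xpow x (1 - s)))%C.
Proof.
eapply derw_eq; [|apply (derw_comp _ (xpow x) (fun s => 1 - s)%C);
  [apply derw_minus; [apply derw_const|apply derw_id]|apply cder_xpow]]. ring.
Qed.

Lemma cder_zeta_term (i : nat) (s : C) : cder (zeta_term i) s (zeta_term_deriv i s).
Proof.
unfold zeta_term, dterm.
eapply derw_eq; [|apply derw_plus; [apply derw_minus; [
  apply derw_mult; [apply derw_minus; [apply derw_id|apply derw_const]|apply cder_xpow_neg]|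
  apply cder_xpow_1_neg]|apply cder_xpow_1_neg]].
unfold zeta_term_deriv, dterm; ring.
Qed.

Lemma csum_zeta_term_cauchy (s : C) : 0 < Re s ->
  forall N M, (N <= M)%nat ->
  Cmod (csum (fun i => zeta_term i s) M - csum (fun i => zeta_term i s) N)
   <= ptail (Cmod (1 - s) * Cmod s) (Re s) N.
Proof.
intros Hs N M HNM.
assert (HK : 0 <= Cmod (1 - s) * Cmod s) by (apply Rmult_le_pos; apply Cmod_ge_0).
eapply Rle_trans.
- apply (csum_tail_le _ (ptail (Cmod (1 - s) * Cmod s) (Re s))); auto.
  intros k Hk; eapply Rle_trans; [apply Cmod_zeta_term_le; lra|apply ptail_diff; auto].
- pose proof (ptail_pos _ (Re s) M HK Hs); lra.
Qed.

Lemma csum_zeta_term_lim (s : C) : 0 < Re s ->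
  clim (fun n => csum (fun i => zeta_term i s) n) (Clim (fun n => csum (fun i => zeta_term i s) n)) /\
  forall N, Cmod (Clim (fun n => csum (fun i => zeta_term i s) n) - csum (fun i => zeta_term i s) N)
   <= ptail (Cmod (1 - s) * Cmod s) (Re s) N.
Proof.
intros Hs; apply clim_complete; [|apply csum_zeta_term_cauchy; auto].
apply ptail_tendsto0; auto; apply Rmult_le_pos; apply Cmod_ge_0.
Qed.

Lemma cdiff_zeta_cont (s : C) : 0 < Re s -> s <> 1 -> cdiff zeta_cont s.
Proof.
intros Hs Hs1; unfold zeta_cont, Cdiv; apply cdiff_mult.
2: { apply cdiff_inv; [apply cdiff_minus; [apply cdiff_id|apply cdiff_const]|].
     apply Cminus_neq; auto. }
apply cdiff_plus; [apply cdiff_const|].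
(* On the disc of radius [r] one has Re z > r = 2 d, and this margin is shared equally between the
   logarithm and the decay of the terms. *)
set (r := Re s / 2); set (d := Re s / 4).
set (S0 := Cmod s + r).
set (K := 2 * (1 + S0) ^ 2 * (1 + / d)).
assert (Hd : 0 < / d) by (apply Rinv_0_lt_compat; unfold d; lra).
assert (HK : 0 <= K).
{ unfold K; apply Rmult_le_pos; [|lra]. pose proof (pow2_ge_0 (1 + S0)); lra. }
assert (Hball : forall z, Cmod (z - s) < r -> r < Re z /\ Cmod z <= S0).
{ intros z Hz; split.
  - pose proof (re_le_Cmod (z - s)) as H; unfold Re in H; simpl in H.
    destruct (Rabs_def2 (fst z + - fst s) r ltac:(lra)).
    unfold r, Re in *; lra.
  - replace z with (s + (z - s))%C by ring; apply Cmod_triangle_le; lra. }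
apply (series_cdiff zeta_term zeta_term_deriv (ptail K d) _ s r).
- unfold r; lra.
- apply ptail_tendsto0; auto; unfold d; lra.
- intros; apply ptail_pos; auto; unfold d; lra.
- intros; apply cder_zeta_term.
- intros i z Hz; destruct (Hball z Hz).
  eapply Rle_trans; [apply (Cmod_zeta_term_deriv_le i z S0 d d); auto; unfold d, r in *; lra|].
  apply ptail_diff; auto; unfold d; lra.
- intros z Hz; destruct (Hball z Hz); apply csum_zeta_term_lim; unfold r in *; lra.
Qed.

(** An exact error term, from which every approximation of zeta by its partial sums starts. *)
Lemma zeta_cont_partial (s : C) n : s <> 1 ->
  ((s - 1) * (zeta_cont s - csum (dterm s) n))%C =
  ((Clim (fun n => csum (fun i => zeta_term i s) n) - csum (fun i => zeta_term i s) n)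
   + xpow (INR (S n)) (1 - s))%C.
Proof.
intros Hs; rewrite csum_zeta_term; unfold zeta_cont. field. apply Cminus_neq; auto.
Qed.

Lemma zeta_cont_series (s : C) : 1 < Re s -> clim (csum (dterm s)) (zeta_cont s).
Proof.
intros Hs.
assert (Hs1 : s <> 1) by (intros E; rewrite E in Hs; simpl in Hs; lra).
assert (HC := Cmod_gt_0 (s - 1)); destruct HC as [HC _].
specialize (HC (Cminus_neq _ _ Hs1)).
set (K := Cmod (1 - s) * Cmod s).
assert (HK : 0 <= K) by (apply Rmult_le_pos; apply Cmod_ge_0).
pose proof (ptail_const_pos (Re s) ltac:(lra)) as Hp.
set (K' := (K * (Rpower 2 (1 + Re s) / Re s) + 1) * / Cmod (s - 1)).
assert (HK' : 0 <= K').
{ apply Rmult_le_pos; [nra|left; apply Rinv_0_lt_compat; auto]. }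
apply (clim_of_bound _ _ (fun n => K' * Rpower (INR (S n)) (- (Re s - 1)))).
{ apply Rpower_tendsto0; auto; lra. }
intros n.
replace (zeta_cont s - csum (dterm s) n)%C with (((s - 1) * (zeta_cont s - csum (dterm s) n)) * / (s - 1))%C
 by (field; apply Cminus_neq; auto).
rewrite zeta_cont_partial, Cmod_mult, Cmod_inv by (auto; apply Cminus_neq; auto).
replace (K' * Rpower (INR (S n)) (- (Re s - 1))) with
  ((K * (Rpower 2 (1 + Re s) / Re s) * Rpower (INR (S n)) (- (Re s - 1)) +
   Rpower (INR (S n)) (- (Re s - 1))) * / Cmod (s - 1)) by (unfold K'; ring).
apply Rmult_le_compat_r; [left; apply Rinv_0_lt_compat; auto|].
apply Cmod_triangle_le.
- eapply Rle_trans; [apply csum_zeta_term_lim; lra|].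
  unfold ptail; fold K. apply Rmult_le_compat_l; [nra|].
  apply Rpower_le_exp; [apply INR_S_ge_1|lra].
- rewrite Cmod_xpow; right; f_equal; unfold Re; simpl; ring.
Qed.

(** * Approximation of the zeta function by partial sums *)

(** The function 1 / (e^z - 1) without its polar part at 0; it stays bounded and Lipschitz near
    0. *)
Definition expm1_reg (z : C) : C := (/ (cexp z - 1) - / z)%C.

Lemma exp_half_le_2 : exp (1 / 2) <= 2.
Proof.
assert (exp (1/2) * exp (1/2) <= 3).
{ rewrite <- exp_plus; replace (1/2 + 1/2) with 1 by field; apply exp_le_3. }
pose proof (exp_pos (1/2)). nra.
Qed.

Lemma exp_Cmod_le_2 (z : C) : Cmod z <= 1 / 2 -> exp (Cmod z) <= 2.
Proof. intros; eapply Rle_trans; [apply exp_le; eassumption|apply exp_half_le_2]. Qed.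

Lemma cexp_minus_1_lower (z : C) : Cmod z <= 1 / 2 -> Cmod z / 2 <= Cmod (cexp z - 1).
Proof.
intros Hz; pose proof (exp_Cmod_le_2 z Hz) as He.
pose proof (cexp_taylor2 z) as H; pose proof (Cmod_ge_0 z) as H0.
pose proof (Cmod_ge_minus z (cexp z - 1 - z)) as H1.
replace (z + (cexp z - 1 - z))%C with (cexp z - 1)%C in H1 by ring.
assert (Cmod (cexp z - 1 - z) <= Cmod z * Cmod z) by nra.
nra.
Qed.

Lemma cexp_minus_1_neq (z : C) : z <> 0 -> Cmod z <= 1 / 2 -> (cexp z - 1)%C <> 0.
Proof.
intros Hn Hz E; pose proof (cexp_minus_1_lower z Hz) as H; rewrite E, Cmod_0 in H.
apply Cmod_gt_0 in Hn; lra.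
Qed.

Lemma expm1_reg_bound (z : C) : z <> 0 -> Cmod z <= 1 / 2 -> Cmod (expm1_reg z) <= 2.
Proof.
intros Hn Hz; pose proof (cexp_minus_1_neq z Hn Hz) as Hn'.
unfold expm1_reg.
replace (/ (cexp z - 1) - / z)%C with (- ((cexp z - 1 - z) / (z * (cexp z - 1))))%C
 by (field; auto).
rewrite Cmod_opp, Cmod_div, Cmod_mult by (apply Cmult_neq_0; auto).
pose proof (exp_Cmod_le_2 z Hz) as He.
pose proof (cexp_taylor2 z) as H; pose proof (cexp_minus_1_lower z Hz) as H1.
apply Cmod_gt_0 in Hn.
assert (Cmod (cexp z - 1 - z) <= Cmod z * Cmod z) by nra.
apply Rle_div_l; nra.
Qed.

Lemma cder_expm1_reg (z : C) : z <> 0 -> Cmod z <= 1 / 2 ->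
  cder expm1_reg z (- (/ ((cexp z - 1) * (cexp z - 1)) * cexp z) + / (z * z))%C.
Proof.
intros Hn Hz; pose proof (cexp_minus_1_neq z Hn Hz) as Hn'; unfold expm1_reg.
eapply derw_eq; [|apply derw_minus; [
  apply (derw_comp _ Cinv (fun z => cexp z - 1)%C);
   [apply derw_minus; [apply cder_cexp|apply derw_const]|apply cder_inv; auto]|
  apply cder_inv; auto]].
field; auto.
Qed.

Lemma expm1_reg_derivative_bound (z : C) : z <> 0 -> Cmod z <= 1 / 2 ->
  Cmod (- (/ ((cexp z - 1) * (cexp z - 1)) * cexp z) + / (z * z))%C <= 5.
Proof.
intros Hn Hz; pose proof (cexp_minus_1_neq z Hn Hz) as Hn'.
(* The numerator (e^z - 1)^2 - z^2 e^z has order z^4, like the denominator; written through the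
   third-order remainder [r], its lower-order terms cancel identically. *)
set (r := (cexp z - 1 - z - z * z / 2)%C).
replace (- (/ ((cexp z - 1) * (cexp z - 1)) * cexp z) + / (z * z))%C with
  ((2 * z * r + r * r - z * z * z * z / 4) / (z * z * ((cexp z - 1) * (cexp z - 1))))%C
  by (unfold r; field; auto).
pose proof (exp_Cmod_le_2 z Hz) as He.
pose proof (cexp_taylor3 z) as H; fold r in H; pose proof (cexp_minus_1_lower z Hz) as H1.
apply Cmod_gt_0 in Hn; apply Cmod_gt_0 in Hn'.
rewrite Cmod_div by (repeat apply Cmult_neq_0; apply Cmod_gt_0; auto).
rewrite !Cmod_mult.
set (m := Cmod z) in *.
assert (Hm3 : 0 < m ^ 3) by (apply pow_lt; auto).
assert (Hr : Cmod r <= m ^ 3 / 3) by nra.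
pose proof (Cmod_ge_0 r) as Hr0.
assert (HN : Cmod (2 * z * r + r * r - z * z * z * z / 4) <= 5 / 4 * m ^ 4).
{ eapply Rle_trans.
  - apply Cmod_minus_le; [apply Cmod_triangle_le|].
    + rewrite !Cmod_mult; apply Rle_refl.
    + rewrite !Cmod_mult; apply Rle_refl.
    + unfold Cdiv; rewrite !Cmod_mult, Cmod_inv by (intros E; injection E; lra); apply Rle_refl.
  - fold m. rewrite !Cmod_R, !Rabs_pos_eq by lra.
    assert (m * Cmod r <= m ^ 4 / 3) by (simpl in *; nra).
    assert (Cmod r * Cmod r <= m ^ 4 / 36).
    { apply Rle_trans with (m ^ 3 / 3 * (m ^ 3 / 3)); [apply Rmult_le_compat; lra|].
      replace (m ^ 3 / 3 * (m ^ 3 / 3)) with (m ^ 4 * (m * m) / 9) by field.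
      assert (0 < m ^ 4) by (apply pow_lt; auto).
      assert (m * m <= 1/4) by nra. nra. }
    simpl in *; nra. }
set (q := Cmod (cexp z - 1)) in *.
assert (Hq : m * m / 4 <= q * q) by nra.
apply Rle_div_l; [apply Rlt_gt; repeat apply Rmult_lt_0_compat; auto|].
eapply Rle_trans; [exact HN|].
replace (5 / 4 * m ^ 4) with (5 * (m * m * (m * m / 4))) by field.
apply Rmult_le_compat_l; [lra|]. apply Rmult_le_compat_l; nra.
Qed.

Lemma expm1_reg_lipschitz (a : C) (L L' : R) : a <> 0 -> 0 < L' <= L -> Cmod a * L <= 1 / 2 ->
  Cmod (expm1_reg (a * RtoC L') - expm1_reg (a * RtoC L))%C <= 5 * Cmod a * (L - L').
Proof.
intros Ha HL HaL; pose proof (proj1 (Cmod_gt_0 a) Ha) as Ha'.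
replace (5 * Cmod a * (L - L')) with (5 * Cmod (a * RtoC L' - a * RtoC L)%C).
2: { replace (a * RtoC L' - a * RtoC L)%C with (a * - RtoC (L - L'))%C
      by (rewrite RtoC_minus; ring).
     rewrite Cmod_mult, Cmod_opp, Cmod_R, Rabs_pos_eq by lra; ring. }
assert (Hz : forall t, 0 <= t <= 1 ->
  (a * RtoC L + RtoC t * (a * RtoC L' - a * RtoC L))%C <> 0 /\
  Cmod (a * RtoC L + RtoC t * (a * RtoC L' - a * RtoC L))%C <= 1 / 2).
{ intros t Ht.
  replace (a * RtoC L + RtoC t * (a * RtoC L' - a * RtoC L))%C with
   (a * RtoC (L + t * (L' - L)))%C by (rewrite RtoC_plus, RtoC_mult, RtoC_minus; ring).
  assert (0 < L + t * (L' - L) <= L) by nra.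
  split.
  - apply Cmult_neq_0; auto. intros E; injection E; lra.
  - rewrite Cmod_mult, Cmod_R, Rabs_pos_eq by lra. nra. }
apply (mean_value_ineq_line expm1_reg
  (fun z => - (/ ((cexp z - 1) * (cexp z - 1)) * cexp z) + / (z * z))%C).
- intros t Ht; apply cder_expm1_reg; apply Hz; auto.
- intros t Ht; apply expm1_reg_derivative_bound; apply Hz; auto.
Qed.

(** * The Kusmin-Landau telescoping *)

Definition log_step (k : R) : R := ln (k + 1) - ln k.

Lemma log_step_bounds (k : R) : 0 < k -> 0 < log_step k <= / k.
Proof.
intros Hk; unfold log_step; split.
- pose proof (ln_increasing k (k + 1) Hk ltac:(lra)); lra.
- rewrite <- ln_div by lra.
  replace ((k + 1) / k) with (1 + / k) by (field; lra).
  assert (Hi : 0 < / k) by (apply Rinv_0_lt_compat; auto).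
  rewrite <- (ln_exp (/ k)) at 2.
  left; apply ln_increasing; [lra|apply exp_ineq1; lra].
Qed.

Lemma exp_log_step (k : R) : 0 < k -> exp (log_step k) = 1 + / k.
Proof.
intros Hk; unfold log_step; rewrite <- ln_div, exp_ln by (try apply Rdiv_lt_0_compat; lra).
field; lra.
Qed.

Lemma log_step_decr (k : R) : 1 < k -> log_step k <= log_step (k - 1).
Proof.
intros Hk.
assert (Hexp : exp (log_step k) <= exp (log_step (k - 1))).
{ rewrite !exp_log_step by lra. apply Rplus_le_compat_l, Rinv_le_contravar; lra. }
destruct (Rle_lt_dec (log_step k) (log_step (k - 1))) as [H|H]; auto.
apply exp_increasing in H; lra.
Qed.

(** With L = [log_step k], the weight below has polar part -1 / (s L). Since e^L - 1 = 1/k, the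
    first summand equals (k - 1/L) / s, and so exchanges this polar part for -k / s. *)
Definition kl_reg (s : C) (k : R) : C :=
  (expm1_reg (1 * RtoC (log_step k)) / s + expm1_reg (- s * RtoC (log_step k)))%C.
(** The ratio c of (k+1)^(-s) to k^(-s) is the exponential here, and 1 / (c - 1) is the weight that
    turns the difference (k+1)^(-s) - k^(-s) back into k^(-s). *)
Definition kl_weight (s : C) (k : R) : C := (/ (cexp (- s * RtoC (log_step k)) - 1))%C.

Lemma expm1_reg_log_step (k : R) : 0 < k ->
  expm1_reg (1 * RtoC (log_step k)) = (RtoC k - / RtoC (log_step k))%C.
Proof.
intros Hk; unfold expm1_reg; rewrite Cmult_1_l, cexp_RtoC, exp_log_step by auto.
f_equal. rewrite <- RtoC_minus. replace (1 + / k - 1) with (/ k) by ring.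
rewrite <- RtoC_inv; [f_equal; field|apply Rinv_neq_0_compat]; lra.
Qed.

Lemma kl_weight_split (s : C) (k : R) : s <> 0 -> 0 < k ->
  kl_weight s k = (- (RtoC k / s) + kl_reg s k)%C.
Proof.
intros Hs Hk; unfold kl_reg; rewrite expm1_reg_log_step by auto; unfold expm1_reg, kl_weight.
pose proof (log_step_bounds k Hk) as HL.
assert (RtoC (log_step k) <> 0) by (intros E; injection E; lra).
set (e := cexp _); set (q := (/ (e - 1))%C).
field; auto.
Qed.

(* The Kusmin--Landau device: [k^-s (1 + kl_weight k - kl_weight (k-1))] telescopes, and
   [kl_weight k = - k / s + kl_reg k] with [kl_reg] bounded and slowly varying. *)
Lemma dterm_telescope (s : C) (k : R) : s <> 0 -> 1 < k -> Cmod s * log_step k <= 1 / 2 ->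
  ((s - 1) * xpow k (- s))%C =
  ((s * (kl_reg s k * xpow (k + 1) (- s) - kl_reg s (k - 1) * xpow k (- s))
   - (RtoC k * xpow (k + 1) (- s) - (RtoC k - 1) * xpow k (- s)))
   - s * (kl_reg s k - kl_reg s (k - 1)) * xpow k (- s))%C.
Proof.
intros Hs Hk Hsk; pose proof (log_step_bounds k ltac:(lra)) as HL.
set (z := (- s * RtoC (log_step k))%C).
assert (Hz : z <> 0).
{ unfold z; apply Cmult_neq_0; [|intros E; injection E; lra].
  intros E; apply Hs; replace s with (- - s)%C by ring; rewrite E; ring. }
assert (Hz2 : Cmod z <= 1 / 2).
{ unfold z; rewrite Cmod_mult, Cmod_opp, Cmod_R, Rabs_pos_eq; lra. }
pose proof (cexp_minus_1_neq z Hz Hz2) as Hn.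
assert (E1 : xpow (k + 1) (- s) = (xpow k (- s) * cexp z)%C).
{ unfold z, xpow, log_step; rewrite <- cexp_plus, RtoC_minus; f_equal; ring. }
assert (Ec : (kl_weight s k * cexp z)%C = (kl_weight s k + 1)%C).
{ unfold kl_weight; fold z; field; auto. }
assert (Ew : kl_reg s k = (kl_weight s k + RtoC k / s)%C)
 by (rewrite kl_weight_split by (auto; lra); ring).
rewrite E1.
replace (kl_reg s k * (xpow k (- s) * cexp z))%C with
  ((kl_weight s k + 1) * xpow k (- s) + RtoC k / s * (xpow k (- s) * cexp z))%C
  by (rewrite Ew, <- Ec; ring).
rewrite Ew. field; auto.
Qed.

(** The tail bound by absolute values is quadratic in |s|. Using the oscillation makes it linear,
    once the cutoff exceeds a multiple of |s|: what remains after telescoping are boundary terms and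
    the variation of [kl_reg], at most 10 |s| [log_step] at the cutoff, hence at most 5. *)
Lemma csum_zeta_term_tail (s : C) (n m : nat) : 0 < Re s <= 1 -> 2 <= Im s ->
  2 * Cmod s + 2 <= INR (S n) -> (n <= m)%nat ->
  Cmod (csum (fun i => zeta_term i s) m - csum (fun i => zeta_term i s) n)
  <= 50 * Cmod (s - 1) * Rpower (INR (S n)) (- Re s).
Proof.
intros Hre Him HN Hnm.
pose proof (Rle_trans _ _ _ (Rle_abs _) (im_le_Cmod s)) as Hs2.
assert (Hs1 : 2 <= Cmod (s - 1)).
{ eapply Rle_trans; [|apply im_le_Cmod]. eapply Rle_trans; [|apply Rle_abs].
  unfold Im in *; simpl; lra. }
assert (Hs : s <> 0) by (apply Cmod_gt_0; lra).
assert (Hss1 : Cmod s <= 3 / 2 * Cmod (s - 1)).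
{ replace s with ((s - 1) + 1)%C at 1 by ring.
  eapply Rle_trans; [apply Cmod_triangle|]; rewrite Cmod_1; lra. }
pose proof (Rpower_pos (INR (S n)) (- Re s)) as HP.
set (P := Rpower (INR (S n)) (- Re s)) in *.
set (u := fun i : nat => xpow (INR (S i)) (- s)).
set (w := fun i : nat => kl_reg s (INR i)).
assert (HL : forall k, (n <= k)%nat -> 2 * Cmod s + 1 <= INR k).
{ intros k Hk; rewrite S_INR in HN; apply le_INR in Hk; lra. }
assert (HLk : forall k, (n <= k)%nat -> 0 < log_step (INR k) /\ Cmod s * log_step (INR k) <= 1 / 2
   /\ 1 * log_step (INR k) <= 1 / 2).
{ intros k Hk; specialize (HL k Hk).
  destruct (log_step_bounds (INR k) ltac:(lra)) as [H1 H2].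
  assert (INR k * log_step (INR k) <= 1).
  { apply (Rmult_le_compat_l (INR k)) in H2; [|lra].
    rewrite Rinv_r in H2; lra. }
  split; [auto|split; nra]. }
assert (Hu : forall k, (n <= k)%nat -> Cmod (u k) <= P).
{ intros k Hk; unfold u, P; rewrite Cmod_xpow.
  replace (Re (- s)%C) with (- Re s) by (unfold Re; reflexivity).
  apply Rpower_le_base_neg; [lra|]. split; [apply INR_S_pos|apply le_INR; lia]. }
assert (Hns : (- s)%C <> 0).
{ intros E; apply Hs; replace s with (- - s)%C by ring; rewrite E; ring. }
(* The two summands of [kl_reg] are at most 2 / |s| <= 1 and 2. *)
assert (Hw : forall k, (n <= k)%nat -> Cmod (w k) <= 3).
{ intros k Hk; destruct (HLk k Hk) as [H1 [H2 H3]]; unfold w, kl_reg.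
  assert (RtoC (log_step (INR k)) <> 0) by (intros E; injection E; lra).
  replace 3 with (1 + 2) by ring. apply Cmod_triangle_le.
  - rewrite Cmod_div by auto.
    assert (Cmod (expm1_reg (1 * RtoC (log_step (INR k)))) <= 2).
    { apply expm1_reg_bound; [rewrite Cmult_1_l; auto|].
      rewrite Cmod_mult, Cmod_1, Cmod_R, Rabs_pos_eq; lra. }
    apply Rle_div_l; lra.
  - apply expm1_reg_bound; [apply Cmult_neq_0; auto|].
    rewrite Cmod_mult, Cmod_opp, Cmod_R, Rabs_pos_eq; lra. }
assert (Hdw : forall k, (n <= k)%nat ->
  Cmod (w (S k) - w k) <= 10 * Cmod s * (log_step (INR k) - log_step (INR (S k)))).
{ intros k Hk; destruct (HLk k Hk) as [H1 [H2 H3]].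
  destruct (HLk (S k) ltac:(lia)) as [H1' [H2' H3']].
  assert (HLL : log_step (INR (S k)) <= log_step (INR k)).
  { pose proof (HL k Hk). rewrite S_INR.
    replace (INR k) with (INR k + 1 - 1) at 2 by ring. apply log_step_decr; lra. }
  set (L := log_step (INR k)) in *; set (L' := log_step (INR (S k))) in *.
  unfold w, kl_reg; fold L L'.
  replace (expm1_reg (1 * RtoC L') / s + expm1_reg (- s * RtoC L') -
    (expm1_reg (1 * RtoC L) / s + expm1_reg (- s * RtoC L)))%C
   with ((expm1_reg (1 * RtoC L') - expm1_reg (1 * RtoC L)) / s +
    (expm1_reg (- s * RtoC L') - expm1_reg (- s * RtoC L)))%C
   by (field; auto).
  assert (A1 : Cmod (expm1_reg (1 * RtoC L') - expm1_reg (1 * RtoC L))%C <= 5 * Cmod 1 * (L - L')).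
  { apply expm1_reg_lipschitz; [intros E; injection E; lra|lra|rewrite Cmod_1; auto]. }
  assert (A2 : Cmod (expm1_reg (- s * RtoC L') - expm1_reg (- s * RtoC L))%C <= 5 * Cmod (- s) * (L - L')).
  { apply expm1_reg_lipschitz; [auto|lra|rewrite Cmod_opp; auto]. }
  rewrite Cmod_opp in A2; rewrite Cmod_1 in A1.
  apply Rle_trans with (5 * (L - L') + 5 * Cmod s * (L - L')); [|nra].
  apply Cmod_triangle_le; auto.
  rewrite Cmod_div by auto. apply Rle_div_l; nra. }
(* Only the variation of [w] fails to telescope, and it is dominated by the decrements of
   [log_step], which telescope in turn. *)
assert (Hid : forall m, (n <= m)%nat ->
  Cmod ((csum (fun i => zeta_term i s) m - csum (fun i => zeta_term i s) n)
    - (s * (w m * u m - w n * u n) + (u m - u n)))%C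
  <= 10 * Cmod s * Cmod s * P * (log_step (INR n) - log_step (INR m))).
{ clear m Hnm; intros m Hm; induction Hm as [|m Hm IH].
  - match goal with |- Cmod ?A <= _ => replace A with (RtoC 0) by ring end.
    rewrite Cmod_0; lra.
  - pose proof (HL m Hm). destruct (HLk (S m) ltac:(lia)) as [_ [HS _]].
    pose proof (dterm_telescope s (INR (S m)) Hs ltac:(rewrite S_INR; lra) HS) as HT.
    (* The unbounded multiples of k left over by [dterm_telescope] cancel against the integral part
       of [zeta_term], down to the single difference u (S m) - u m. *)
    assert (Hz : zeta_term m s = (s * (w (S m) * u (S m) - w m * u m) + (u (S m) - u m)
       - s * (w (S m) - w m) * u m)%C).
    { unfold zeta_term, dterm; fold (u m); change (xpow (INR (S m)) (- s)) with (u m) in HT.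
      rewrite HT. replace (INR (S m) + 1) with (INR (S (S m))) by (rewrite (S_INR (S m)); ring).
      replace (INR (S m) - 1) with (INR m) by (rewrite (S_INR m); ring).
      change (kl_reg s (INR (S m))) with (w (S m)); change (kl_reg s (INR m)) with (w m).
      change (xpow (INR (S (S m))) (- s)) with (u (S m)).
      replace (1 - s)%C with (- s + 1)%C by ring.
      rewrite !xpow_succ by apply INR_S_pos.
      change (xpow (INR (S (S m))) (- s)) with (u (S m)).
      change (xpow (INR (S m)) (- s)) with (u m).
      rewrite (S_INR (S m)), (RtoC_plus (INR (S m)) 1). ring. }
    cbn [csum]; rewrite Hz.
    replace (10 * Cmod s * Cmod s * P * (log_step (INR n) - log_step (INR (S m)))) with
      (10 * Cmod s * Cmod s * P * (log_step (INR n) - log_step (INR m)) +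
       Cmod s * (10 * Cmod s * (log_step (INR m) - log_step (INR (S m)))) * P) by ring.
    match goal with |- Cmod ?A <= _ => replace A with
      ((csum (fun i => zeta_term i s) m - csum (fun i => zeta_term i s) n
    - (s * (w m * u m - w n * u n) + (u m - u n))) - s * (w (S m) - w m) * u m)%C by ring end.
    apply Cmod_minus_le; [exact IH|].
    apply Cmod_mult_le; [apply Cmod_mult_le; [lra|apply Hdw; auto]|apply Hu; auto]. }
specialize (Hid m Hnm).
replace (csum (fun i => zeta_term i s) m - csum (fun i => zeta_term i s) n)%C with
 ((csum (fun i => zeta_term i s) m - csum (fun i => zeta_term i s) n
    - (s * (w m * u m - w n * u n) + (u m - u n)))
  + (s * (w m * u m - w n * u n) + (u m - u n)))%C by ring.
eapply Rle_trans.
- apply Cmod_triangle_le; [exact Hid|]. apply Cmod_triangle_le.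
  + apply Cmod_mult_le; [apply Rle_refl|].
    apply Cmod_minus_le; apply Cmod_mult_le; try apply Hw; try apply Hu; auto.
  + apply Cmod_minus_le; apply Hu; auto.
- destruct (HLk n ltac:(lia)) as [H1 [H2 _]]; destruct (HLk m Hnm) as [H3 _].
  assert (Cmod s * (log_step (INR n) - log_step (INR m)) <= 1 / 2) by nra.
  assert (10 * Cmod s * Cmod s * P * (log_step (INR n) - log_step (INR m)) <= 10 * Cmod s * P * (1/2)).
  { replace (10 * Cmod s * Cmod s * P * (log_step (INR n) - log_step (INR m))) with
     (10 * Cmod s * P * (Cmod s * (log_step (INR n) - log_step (INR m)))) by ring.
    apply Rmult_le_compat_l; [|auto]. repeat apply Rmult_le_pos; lra. }
  nra.
Qed.

Lemma zeta_cont_approx (s : C) (n : nat) : 0 < Re s <= 1 -> 2 <= Im s ->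
  2 * Cmod s + 2 <= INR (S n) ->
  Cmod (zeta_cont s - csum (dterm s) n) <=
    Rpower (INR (S n)) (1 - Re s) / Cmod (s - 1) + 50 * Rpower (INR (S n)) (- Re s).
Proof.
intros Hre Him HN.
assert (Hs : s <> 1) by (intros E; rewrite E in Him; simpl in Him; lra).
pose proof (Cminus_neq _ _ Hs) as Hs'; pose proof (proj1 (Cmod_gt_0 _) Hs') as Hc.
replace (zeta_cont s - csum (dterm s) n)%C with (((s - 1) * (zeta_cont s - csum (dterm s) n)) / (s - 1))%C
 by (field; auto).
rewrite zeta_cont_partial, Cmod_div by auto.
apply Rle_div_l; auto.
replace ((Rpower (INR (S n)) (1 - Re s) / Cmod (s - 1) + 50 * Rpower (INR (S n)) (- Re s))
  * Cmod (s - 1)) with (50 * Cmod (s - 1) * Rpower (INR (S n)) (- Re s) +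
   Rpower (INR (S n)) (1 - Re s)) by (field; lra).
apply Cmod_triangle_le.
- apply (clim_bound (fun n => csum (fun i => zeta_term i s) n) _ _ _ n).
  + apply csum_zeta_term_lim; lra.
  + intros m Hm; apply csum_zeta_term_tail; auto.
- rewrite Cmod_xpow; right; reflexivity.
Qed.

Lemma RtoC_neq_0 (x : R) : x <> 0 -> RtoC x <> 0.
Proof. intros H E; apply H; exact (RtoC_inj _ _ E). Qed.

(** * Riemann sums of functions of bounded variation *)

Lemma csum_mul (f : nat -> C) (k l : nat) :
  csum f (k * l) = csum (fun m => csum (fun i => f (m * l + i)%nat) l) k.
Proof.
induction k as [|k IH]; [reflexivity|].
cbn [csum]; rewrite <- IH, <- csum_add; f_equal; lia.
Qed.

Lemma csum_const (c : C) n : csum (fun _ => c) n = (RtoC (INR n) * c)%C.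
Proof.
induction n; [cbn [csum]; simpl; ring|].
rewrite S_INR, RtoC_plus; cbn [csum]; rewrite IHn; ring.
Qed.

(** Sampling at left endpoints. The sampled function is controlled on the open interval only, so the
    node 0 is given the value 0; the point 1 is not a node. *)
Definition node (g : R -> C) (k j : nat) : C :=
  match j with O => RtoC 0 | S _ => g (INR j / INR k) end.

Definition nodes (g : R -> C) (k : nat) : C := csum (node g k) k.

Lemma Cmod_csum_diff (f : nat -> C) (z : C) (B : R) n :
  (forall i, (i < n)%nat -> Cmod (f i - z) <= B) ->
  Cmod (csum f n - RtoC (INR n) * z) <= INR n * B.
Proof.
intros H; rewrite <- csum_const, <- csum_minus, <- (rsum_const B).
eapply Rle_trans; [apply Cmod_csum_le|apply rsum_le; auto].
Qed.

(** Each coarse cell contains [l] fine nodes, and each of them differs from the coarse node by at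
    most the variation over the cell; the variations telescope to a bound independent of [k]. *)
Lemma nodes_refine (g : R -> C) (v : R -> R) (V G : R) (k l : nat) :
  0 <= V -> 0 <= G ->
  (forall x, 0 < x < 1 -> Cmod (g x) <= G) ->
  (forall x, 0 < x < 1 -> Rabs (v x) <= V) ->
  (forall x y, 0 < x -> x <= y -> y < 1 -> Cmod (g y - g x) <= v y - v x) ->
  (0 < k)%nat -> (0 < l)%nat ->
  Cmod (nodes g (k * l) - RtoC (INR l) * nodes g k) <= INR l * (2 * V + 4 * G).
Proof.
intros HV HG Hg Hv Hgv Hk Hl.
assert (HkR : 0 < INR k) by (apply lt_0_INR; auto).
assert (HlR : 0 < INR l) by (apply lt_0_INR; auto).
set (Phi := fun m : nat => if Nat.eq_dec m 0 then - (V + 2 * G)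
  else if le_lt_dec k m then V + 2 * G else v (INR m / INR k)).
unfold nodes at 1; rewrite csum_mul.
unfold nodes; rewrite <- csum_mult, <- csum_minus.
eapply Rle_trans; [apply Cmod_csum_le|].
replace (INR l * (2 * V + 4 * G)) with (rsum (fun m => INR l * (Phi (S m) - Phi m)) k).
2: { rewrite rsum_mult.
     replace (rsum (fun m => Phi (S m) - Phi m) k) with
      (- 1 * rsum (fun m => Phi m - Phi (S m)) k).
     - rewrite rsum_telescope; unfold Phi.
       destruct (Nat.eq_dec 0 0); [|lia]. destruct (Nat.eq_dec k 0); [lia|].
       destruct (le_lt_dec k k); [ring|lia].
     - rewrite <- rsum_mult; apply rsum_ext; intros; ring. }
apply rsum_le; intros m Hm.
apply Cmod_csum_diff; intros i Hi.
assert (Hnode : forall n j : nat, (0 < n)%nat -> (j < n)%nat -> Cmod (node g n j) <= G).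
{ intros n j Hn Hj; destruct j; simpl; [rewrite Cmod_0; auto|].
  apply Hg. assert (0 < INR n) by (apply lt_0_INR; auto).
  change (match j with 0%nat => 1 | S _ => INR j + 1 end) with (INR (S j)).
  split; [apply Rdiv_lt_0_compat; auto; apply INR_S_pos|].
  apply -> Rdiv_lt_1; auto. apply lt_INR; auto. }
assert (Hdiff : Cmod (node g (k * l) (m * l + i) - node g k m) <= 2 * G).
{ replace (2 * G) with (G + G) by ring.
  apply Cmod_minus_le; apply Hnode; auto; nia. }
unfold Phi at 2; destruct (Nat.eq_dec m 0) as [->|Hm0].
{ unfold Phi; destruct (Nat.eq_dec 1 0); [lia|].
  destruct (le_lt_dec k 1); [lra|].
  assert (Rabs (v (INR 1 / INR k)) <= V).
  { apply Hv; simpl; split; [apply Rdiv_lt_0_compat; lra|].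
    apply -> Rdiv_lt_1; auto. apply (lt_INR 1); auto. }
  pose proof (Rabs_def2 (v (INR 1 / INR k))).
  assert (- V <= v (INR 1 / INR k)) by (pose proof (Rle_abs (- v (INR 1 / INR k))); rewrite Rabs_Ropp in *; lra).
  lra. }
destruct (le_lt_dec k m); [lia|].
assert (Hmk : 0 < INR m / INR k < 1).
{ split; [apply Rdiv_lt_0_compat; auto; apply lt_0_INR; lia|].
  apply -> Rdiv_lt_1; auto. apply lt_INR; auto. }
unfold Phi; destruct (Nat.eq_dec (S m) 0); [lia|].
destruct (le_lt_dec k (S m)).
{ pose proof (Hv _ Hmk). pose proof (Rle_abs (v (INR m / INR k))). lra. }
assert (Hsm : INR (S m) / INR k < 1).
{ apply -> Rdiv_lt_1; auto. apply lt_INR; auto. }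
destruct m as [|m']; [lia|]; set (m := S m') in *.
assert (E1 : node g k m = g (INR m / INR k)) by reflexivity.
assert (E2 : node g (k * l) (m * l + i) = g (INR (m * l + i) / INR (k * l))).
{ destruct (m * l + i)%nat eqn:E; [nia|reflexivity]. }
rewrite E1, E2.
set (x := INR m / INR k) in *; set (y := INR (m * l + i) / INR (k * l)).
assert (Hxy : x <= y <= INR (S m) / INR k).
{ unfold x, y; rewrite plus_INR, !mult_INR, S_INR.
  assert (Hi0 : 0 <= INR i <= INR l) by (split; [apply pos_INR|apply le_INR; lia]).
  replace (INR m / INR k) with ((INR m * INR l) / (INR k * INR l)) by (field; lra).
  replace ((INR m + 1) / INR k) with (((INR m + 1) * INR l) / (INR k * INR l)) by (field; lra).
  split; (apply Rmult_le_compat_r; [left; apply Rinv_0_lt_compat; nra|lra]). }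
assert (H1 := Hgv x y ltac:(lra) ltac:(lra) ltac:(lra)).
assert (H2 := Hgv y (INR (S m) / INR k) ltac:(lra) ltac:(lra) ltac:(lra)).
pose proof (Cmod_ge_0 (g (INR (S m) / INR k) - g y)). lra.
Qed.

(** Through the common refinement k * l, the averages over [k] and over [l] nodes differ by at most
    A/k + A/l. They therefore converge, and their limit [I] plays the role of the integral of
    [g]. *)
Lemma Riemann_sum_BV (g : R -> C) (v : R -> R) (V G : R) :
  0 <= V -> 0 <= G ->
  (forall x, 0 < x < 1 -> Cmod (g x) <= G) ->
  (forall x, 0 < x < 1 -> Rabs (v x) <= V) ->
  (forall x y, 0 < x -> x <= y -> y < 1 -> Cmod (g y - g x) <= v y - v x) ->
  exists I : C, forall k, (0 < k)%nat ->
    Cmod (nodes g k - RtoC (INR k) * I) <= 2 * (2 * V + 4 * G).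
Proof.
intros HV HG Hg Hv Hgv.
set (A := 2 * V + 4 * G); assert (HA : 0 <= A) by (unfold A; lra).
set (u := fun n => (nodes g (S n) / RtoC (INR (S n)))%C).
assert (Hkl : forall k l, (0 < k)%nat -> (0 < l)%nat ->
  Cmod (nodes g k / RtoC (INR k) - nodes g l / RtoC (INR l)) <= A / INR k + A / INR l).
{ intros k l Hk Hl.
  assert (HkR : 0 < INR k) by (apply lt_0_INR; auto).
  assert (HlR : 0 < INR l) by (apply lt_0_INR; auto).
  assert (Nk : RtoC (INR k) <> 0) by (intros E; injection E; lra).
  assert (Nl : RtoC (INR l) <> 0) by (intros E; injection E; lra).
  pose proof (nodes_refine g v V G k l HV HG Hg Hv Hgv Hk Hl) as H1.
  pose proof (nodes_refine g v V G l k HV HG Hg Hv Hgv Hl Hk) as H2.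
  rewrite (Nat.mul_comm l k) in H2; fold A in H1, H2.
  set (X := nodes g (k * l)) in *.
  replace (nodes g k / RtoC (INR k) - nodes g l / RtoC (INR l))%C with
   (((X - RtoC (INR k) * nodes g l) - (X - RtoC (INR l) * nodes g k))
     / (RtoC (INR k) * RtoC (INR l)))%C by (field; auto).
  rewrite Cmod_div, Cmod_mult, !Cmod_R, !Rabs_pos_eq by (try (apply Cmult_neq_0; auto); lra).
  apply Rle_div_l; [nra|].
  replace ((A / INR k + A / INR l) * (INR k * INR l)) with (INR k * A + INR l * A) by (field; lra).
  apply Cmod_minus_le; auto. }
destruct (clim_complete u (fun n => 2 * A * Rpower (INR (S n)) (- (1)))) as [_ HL].
- apply Rpower_tendsto0; lra.
- intros N M HNM; unfold u.
  pose proof (INR_S_pos N) as HN; pose proof (INR_S_pos M) as HM.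
  rewrite Rpower_Ropp, Rpower_1 by auto.
  eapply Rle_trans; [apply Hkl; lia|].
  assert (/ INR (S M) <= / INR (S N)) by (apply Rinv_le_contravar; auto; apply le_INR; lia).
  unfold Rdiv; nra.
- exists (Clim u); intros k Hk.
  destruct k as [|n]; [lia|]. specialize (HL n); cbv beta in HL.
  pose proof (INR_S_pos n) as Hn.
  rewrite Rpower_Ropp, Rpower_1 in HL by auto.
  assert (Nk : RtoC (INR (S n)) <> 0) by (apply RtoC_neq_0; lra).
  rewrite Cmod_minus_sym.
  replace (RtoC (INR (S n)) * Clim u - nodes g (S n))%C with
   (RtoC (INR (S n)) * (Clim u - u n))%C by (unfold u; field; auto).
  rewrite Cmod_mult, Cmod_R, Rabs_pos_eq by lra.
  apply (Rmult_le_compat_l (INR (S n))) in HL; [|lra].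
  replace (INR (S n) * (2 * A * / INR (S n))) with (2 * A) in HL by (field; lra). exact HL.
Qed.

(** * Asymptotics of the convolution *)

(** One formula for two effects: a simple zero at y = 1 and growth like y^(-Re q) at 0. Each is
    proved on its own half of the interval. *)
Lemma xpow_minus_1_bound (y : R) (q : C) : 0 < y < 1 -> 0 <= Re q ->
  Cmod (xpow y (- q) - 1) <= (4 + 2 * Cmod q) * (1 - y) * Rpower y (- Re q).
Proof.
intros Hy Hq; pose proof (Cmod_ge_0 q) as Hq0.
pose proof (Rpower_pos y (- Re q)) as HP.
destruct (Rle_lt_dec (1 / 2) y) as [H|H].
- rewrite Cmod_minus_sym, <- (xpow_base_1 (- q)).
  eapply Rle_trans; [apply xpow_diff_bound; lra|].
  assert (E : Rpower y (- Re q) = y * Rpower y (- Re q - 1)).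
  { rewrite <- Rpower_succ by lra; f_equal; ring. }
  rewrite E in *. pose proof (Rpower_pos y (- Re q - 1)) as HP'.
  set (P := Rpower y (- Re q - 1)) in *.
  replace (Cmod q * P * (1 - y)) with ((1 - y) * (Cmod q * P)) by ring.
  replace ((4 + 2 * Cmod q) * (1 - y) * (y * P)) with ((1 - y) * ((4 + 2 * Cmod q) * (y * P))) by ring.
  apply Rmult_le_compat_l; [lra|].
  assert (0 <= Cmod q * P) by nra. nra.
- assert (H1 : 1 <= Rpower y (- Re q)).
  { replace 1 with (Rpower 1 (- Re q)) by (unfold Rpower; rewrite ln_1, Rmult_0_r, exp_0; auto).
    apply Rpower_le_base_neg; lra. }
  eapply Rle_trans; [apply Cmod_minus_le; [rewrite Cmod_xpow|rewrite Cmod_1]; apply Rle_refl|].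
  change (Re (- q)%C) with (- Re q).
  set (P := Rpower y (- Re q)) in *. 
  assert (0 <= Cmod q * (1 - y) * P) by (repeat apply Rmult_le_pos; lra). nra.
Qed.

Lemma Rpower_le_1_base (x e : R) : 0 < x <= 1 -> 0 <= e -> Rpower x e <= 1.
Proof.
intros Hx He; replace 1 with (Rpower 1 e)
 by (unfold Rpower; rewrite ln_1, Rmult_0_r, exp_0; auto).
apply Rpower_le_base; lra.
Qed.

Lemma Rpower_neg_le_2 (x e : R) : 1 / 2 <= x -> 0 <= e <= 1 -> Rpower x (- e) <= 2.
Proof.
intros Hx He.
apply Rle_trans with (Rpower (/ 2) (- e)); [apply Rpower_le_base_neg; lra|].
unfold Rpower; rewrite ln_Rinv by lra.
replace (- e * - ln 2) with (e * ln 2) by ring.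
rewrite <- (exp_ln 2) at 2 by lra. apply exp_le.
pose proof (ln_nonneg 2 ltac:(lra)). nra.
Qed.

(** Each factor has a simple zero where the other is singular. Hence g is bounded, and |g'| is at
    most a multiple of x^(-a) (1-x)^(-b), integrable since a, b < 1; [v] is the primitive of a
    majorant. *)
Lemma conv_kernel_BV (p q : C) : 0 < Re p < 1 -> 0 < Re q < 1 ->
  let g := fun x => ((xpow x (- p) - 1) * (xpow (1 - x) (- q) - 1))%C in
  exists v V G, 0 <= V /\ 0 <= G /\
  (forall x, 0 < x < 1 -> Cmod (g x) <= G) /\
  (forall x, 0 < x < 1 -> Rabs (v x) <= V) /\
  (forall x y, 0 < x -> x <= y -> y < 1 -> Cmod (g y - g x) <= v y - v x).
Proof.
intros Hp Hq g.
pose proof (Cmod_ge_0 p) as Hp0; pose proof (Cmod_ge_0 q) as Hq0.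
set (Kp := 4 + 2 * Cmod p); set (Kq := 4 + 2 * Cmod q).
set (K := 2 * (Cmod p * Kq + Cmod q * Kp)).
assert (HKp : 0 <= Kp) by (unfold Kp; lra); assert (HKq : 0 <= Kq) by (unfold Kq; lra).
assert (HK : 0 <= K) by (unfold K; nra).
set (a := Re p); set (b := Re q).
assert (Ha' : 0 < a < 1) by exact Hp; assert (Hb' : 0 < b < 1) by exact Hq.
set (v := fun x => K * (Rpower x (1 - a) / (1 - a) - Rpower (1 - x) (1 - b) / (1 - b))).
set (V := K * (/ (1 - a) + / (1 - b))).
assert (Ha : 0 < / (1 - a)) by (apply Rinv_0_lt_compat; lra).
assert (Hb : 0 < / (1 - b)) by (apply Rinv_0_lt_compat; lra).
exists v, V, (Kp * Kq); repeat split.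
- unfold V; nra.
- nra.
- intros x Hx; unfold g.
  eapply Rle_trans; [apply Cmod_mult_le; apply xpow_minus_1_bound; lra|].
  fold Kp Kq a b.
  replace (1 - (1 - x)) with x by ring.
  replace (Kp * (1 - x) * Rpower x (- a) * (Kq * x * Rpower (1 - x) (- b))) with
   (Kp * Kq * ((x * Rpower x (- a)) * ((1 - x) * Rpower (1 - x) (- b)))) by ring.
  rewrite <- !Rpower_succ by lra.
  assert (Rpower x (- a + 1) <= 1) by (apply Rpower_le_1_base; lra).
  assert (Rpower (1 - x) (- b + 1) <= 1) by (apply Rpower_le_1_base; lra).
  pose proof (Rpower_pos x (- a + 1)); pose proof (Rpower_pos (1 - x) (- b + 1)).
  assert (0 <= Kp * Kq) by nra.
  rewrite <- (Rmult_1_r (Kp * Kq)) at 2. apply Rmult_le_compat_l; nra.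
- intros x Hx; unfold v, V; rewrite Rabs_mult, (Rabs_pos_eq K) by auto.
  apply Rmult_le_compat_l; auto.
  assert (Rpower x (1 - a) <= 1) by (apply Rpower_le_1_base; lra).
  assert (Rpower (1 - x) (1 - b) <= 1) by (apply Rpower_le_1_base; lra).
  pose proof (Rpower_pos x (1 - a)); pose proof (Rpower_pos (1 - x) (1 - b)).
  unfold Rdiv; apply Rabs_le; nra.
- intros x y Hx Hxy Hy.
  set (g' := fun t => (- p * xpow t (- p - 1) * (xpow (1 - t) (- q) - 1) +
     (xpow t (- p) - 1) * (q * xpow (1 - t) (- q - 1)))%C).
  set (v' := fun t => K * (Rpower t (- a) + Rpower (1 - t) (- b))).
  apply (mean_value_ineq g g' v v'); auto.
  + intros t Ht; unfold g, g', rder.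
    eapply derw_eq; [|apply derw_mult; [apply derw_minus; [apply rder_xpow; lra|apply derw_const]|
      apply derw_minus; [|apply derw_const]]].
    2: { apply (derw_ext _ (fun w => cexp (- q * RtoC (ln (1 - Re w))))); [reflexivity|].
         apply (derw_comp _ cexp (fun w => - q * RtoC (ln (1 - Re w)))%C);
          [|apply cder_cexp].
         apply derw_scal, (rder_RtoC (fun t => ln (1 - t)) t (- / (1 - t))).
         auto_derive; [lra|field; lra]. }
    simpl.
    change (cexp (- q * RtoC (ln (1 - t)))) with (xpow (1 - t) (- q)).
    replace (xpow (1 - t) (- q)) with (RtoC (1 - t) * xpow (1 - t) (- q - 1))%C.
    2: { rewrite <- xpow_succ by lra; f_equal; ring. }
    rewrite RtoC_opp, RtoC_inv by lra. 
    assert (RtoC (1 - t) <> 0) by (intros E; injection E; lra).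
    field; auto.
  + intros t Ht; unfold v, v'.
    assert (D1 := is_derive_Rpower t (1 - a) ltac:(lra)).
    unfold Rpower at 1 2. auto_derive; [lra|].
    change (exp ((1 - a) * ln t)) with (Rpower t (1 - a)).
    change (exp ((1 - b) * ln (1 + - t))) with (Rpower (1 - t) (1 - b)).
    replace (Rpower t (1 - a)) with (t * Rpower t (- a)) by (rewrite <- Rpower_succ by lra; f_equal; ring).
    replace (Rpower (1 - t) (1 - b)) with ((1 - t) * Rpower (1 - t) (- b))
      by (rewrite <- Rpower_succ by lra; f_equal; ring).
    field; lra.
  + intros t Ht; unfold g', v'.
    pose proof (xpow_minus_1_bound t p ltac:(lra) ltac:(fold a; lra)) as B1.
    pose proof (xpow_minus_1_bound (1 - t) q ltac:(lra) ltac:(fold b; lra)) as B2.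
    fold Kp a in B1; fold Kq b in B2. replace (1 - (1 - t)) with t in B2 by ring.
    pose proof (Rpower_pos t (- a)) as P1; pose proof (Rpower_pos (1 - t) (- b)) as P2.
    assert (E1 : Cmod (xpow t (- p - 1)) = / t * Rpower t (- a)).
    { rewrite Cmod_xpow. replace (Re (- p - 1)%C) with (- a + - (1)) by (unfold a, Re; simpl; ring).
      rewrite Rpower_plus, (Rpower_Ropp _ 1), Rpower_1 by lra; ring. }
    assert (E2 : Cmod (xpow (1 - t) (- q - 1)) = / (1 - t) * Rpower (1 - t) (- b)).
    { rewrite Cmod_xpow. replace (Re (- q - 1)%C) with (- b + - (1)) by (unfold b, Re; simpl; ring).
      rewrite Rpower_plus, (Rpower_Ropp _ 1), Rpower_1 by lra; ring. }
    apply Rle_trans with ((Cmod p * Kq + Cmod q * Kp) * (Rpower t (- a) * Rpower (1 - t) (- b))).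
    * rewrite Rmult_plus_distr_r; apply Cmod_triangle_le.
      -- rewrite !Cmod_mult, Cmod_opp, E1.
         apply Rle_trans with (Cmod p * (/ t * Rpower t (- a)) * (Kq * t * Rpower (1 - t) (- b))).
         ++ apply Rmult_le_compat_l; auto. apply Rmult_le_pos; [lra|].
            apply Rmult_le_pos; [left; apply Rinv_0_lt_compat|]; lra.
         ++ right; field; lra.
      -- rewrite !Cmod_mult, E2.
         apply Rle_trans with (Kp * (1 - t) * Rpower t (- a) * (Cmod q * (/ (1 - t) * Rpower (1 - t) (- b)))).
         ++ apply Rmult_le_compat_r; auto. apply Rmult_le_pos; [lra|].
            apply Rmult_le_pos; [left; apply Rinv_0_lt_compat|]; lra.
         ++ right; field; lra.
    * unfold K. rewrite (Rmult_comm 2), Rmult_assoc. apply Rmult_le_compat_l; [nra|].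
      (* One of t and 1 - t is at least 1/2, so one of the two powers is at most 2: the product
         splits into a sum with an elementary primitive, which is where the 2 in [K] comes from. *)
      destruct (Rle_lt_dec (1 / 2) t) as [H|H].
      -- pose proof (Rpower_neg_le_2 t a H ltac:(lra)). nra.
      -- pose proof (Rpower_neg_le_2 (1 - t) b ltac:(lra) ltac:(lra)). nra.
Qed.

(** * The convolution as a rescaled Riemann sum *)

Lemma fold_right_Cplus_init (l : list C) (z : C) :
  fold_right Cplus z l = (fold_right Cplus (RtoC 0) l + z)%C.
Proof. induction l; simpl; [ring|rewrite IHl; ring]. Qed.

Lemma fold_right_seq_csum (f : nat -> C) (a n : nat) :
  fold_right Cplus (RtoC 0) (map f (seq a n)) = csum (fun i => f (a + i)%nat) n.
Proof.
induction n; [reflexivity|].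
rewrite seq_S, map_app, fold_right_app; simpl fold_right at 2.
rewrite fold_right_Cplus_init, IHn; cbn [csum]; ring.
Qed.

(** All indices are shifted by one: for k = S n and m = S i, the index [n - S i] stands for k -
    m. *)
Lemma inner_conv_csum (p q : C) (n : nat) :
  inner_conv p q (S n) = csum (fun i => dterm p i * dterm q (n - S i)%nat)%C n.
Proof.
unfold inner_conv; rewrite fold_right_seq_csum.
replace (S n - 1)%nat with n by lia.
apply csum_ext; intros i Hi.
rewrite !npow_neg_xpow; unfold dterm.
replace (S n - (1 + i))%nat with (S (n - S i)) by lia. reflexivity.
Qed.

Lemma csum_shift (f : nat -> C) n : csum f (S n) = (f O + csum (fun i => f (S i)) n)%C.
Proof. change (S n) with (1 + n)%nat; rewrite csum_add; simpl; ring. Qed.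

Lemma csum_rev (f : nat -> C) n : csum (fun i => f (n - S i)%nat) n = csum f n.
Proof.
induction n; [reflexivity|].
rewrite csum_shift; cbn [csum]; rewrite <- IHn.
replace (S n - 1)%nat with n by lia. simpl. ring.
Qed.

Lemma csum_dterm_asymp (p : C) : 0 < Re p < 1 ->
  exists E, 0 <= E /\ forall n,
   Cmod (csum (dterm p) n - (zeta_cont p - xpow (INR (S n)) (1 - p) / (p - 1)))%C
   <= E * Rpower (INR (S n)) (- Re p).
Proof.
intros Hp.
assert (Hp1 : p <> 1) by (intros E; rewrite E in Hp; simpl in Hp; lra).
pose proof (Cminus_neq _ _ Hp1) as Hn; pose proof (proj1 (Cmod_gt_0 _) Hn) as Hc.
pose proof (ptail_const_pos (Re p) ltac:(lra)) as Hpt.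
set (E := Cmod (1 - p) * Cmod p * (Rpower 2 (1 + Re p) / Re p)).
assert (HE : 0 <= E) by (unfold E; apply Rmult_le_pos; [apply Rmult_le_pos; apply Cmod_ge_0|lra]).
exists (E / Cmod (p - 1)); split; [apply Rdiv_le_0_compat; auto|].
intros n; pose proof (zeta_cont_partial p n Hp1) as HZ.
replace (csum (dterm p) n - (zeta_cont p - xpow (INR (S n)) (1 - p) / (p - 1)))%C with
 (- (((p - 1) * (zeta_cont p - csum (dterm p) n) - xpow (INR (S n)) (1 - p)) / (p - 1)))%C
 by (field; auto).
rewrite HZ, Cmod_opp, Cmod_div by auto.
replace (E / Cmod (p - 1) * Rpower (INR (S n)) (- Re p)) with
 (E * Rpower (INR (S n)) (- Re p) / Cmod (p - 1)) by (field; lra).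
apply Rmult_le_compat_r; [left; apply Rinv_0_lt_compat; auto|].
match goal with |- Cmod (?A + ?B - ?B)%C <= _ => replace (A + B - B)%C with A by ring end.
apply (proj2 (csum_zeta_term_lim p (proj1 Hp))).
Qed.

Lemma Cmod_dterm (s : C) (n : nat) : Cmod (dterm s n) = Rpower (INR (S n)) (- Re s).
Proof. unfold dterm; rewrite Cmod_xpow; reflexivity. Qed.

Lemma xpow_div (x y : R) (s : C) : 0 < x -> 0 < y ->
  xpow (x / y) (- s) = (xpow x (- s) * xpow y s)%C.
Proof.
intros; unfold xpow; rewrite <- cexp_plus, ln_div, RtoC_minus by auto; f_equal; ring.
Qed.

Lemma xpow_neg_mult (x : R) (s : C) : (xpow x (- s) * xpow x s)%C = 1.
Proof. rewrite <- xpow_plus, <- (xpow_0 x); f_equal; ring. Qed.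

(* [x^-p (1-x)^-q = g x + x^-p + (1-x)^-q - 1] with [g] of bounded variation. *)
Lemma inner_conv_asymp (p q : C) : 0 < Re p < 1 -> 0 < Re q < 1 ->
  exists B E, 0 <= E /\ forall n,
   Cmod (inner_conv p q (S n) -
     (B * dterm (p + q - 1) n + zeta_cont p * dterm q n + zeta_cont q * dterm p n))%C
   <= E * Rpower (INR (S n)) (- (Re p + Re q)).
Proof.
intros Hp Hq.
assert (Hp1 : p <> 1) by (intros E; rewrite E in Hp; simpl in Hp; lra).
assert (Hq1 : q <> 1) by (intros E; rewrite E in Hq; simpl in Hq; lra).
apply Cminus_neq in Hp1; apply Cminus_neq in Hq1.
destruct (conv_kernel_BV p q Hp Hq) as [v [V [G [HV [HG [Hg [Hv Hgv]]]]]]].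
set (g := fun x => ((xpow x (- p) - 1) * (xpow (1 - x) (- q) - 1))%C) in *.
destruct (Riemann_sum_BV g v V G HV HG Hg Hv Hgv) as [J HJ].
destruct (csum_dterm_asymp p Hp) as [Ep [HEp HCp]].
destruct (csum_dterm_asymp q Hq) as [Eq [HEq HCq]].
set (A := 2 * (2 * V + 4 * G)) in *.
assert (HA : 0 <= A) by (unfold A; lra).
(* The integral of x^(-p) (1-x)^(-q) over (0, 1), that is the beta value B(1-p, 1-q): [J] accounts
   for [g], and the other terms for the integrals of x^(-p), (1-x)^(-q) and -1. *)
exists (J - 1 - / (p - 1) - / (q - 1))%C, (A + 1 + Ep + Eq); split; [lra|].
intros n; pose proof (INR_S_pos n) as Hn.
set (k := INR (S n)) in *.
assert (E1 : inner_conv p q (S n) =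
  (dterm p n * dterm q n * (nodes g (S n) - RtoC (INR n)) + dterm q n * csum (dterm p) n
    + dterm p n * csum (dterm q) n)%C).
{ rewrite inner_conv_csum, <- (csum_rev (dterm q) n).
  unfold nodes; rewrite csum_shift; simpl (node g (S n) 0).
  replace (RtoC (INR n)) with (csum (fun _ => RtoC 1) n) by (rewrite csum_const; ring).
  rewrite Cplus_0_l, <- csum_minus, <- !csum_mult, <- !csum_plus.
  apply csum_ext; intros i Hi; unfold node, g.
  fold k.
  pose proof (INR_S_pos i) as Hi0; pose proof (INR_S_pos (n - S i)) as Hi1.
  assert (Ei : 1 - INR (S i) / k = INR (S (n - S i)) / k).
  { replace (INR (S (n - S i))) with (k - INR (S i)); [field; lra|].
    unfold k; rewrite <- minus_INR by lia; f_equal; lia. }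
  rewrite Ei, !xpow_div by auto.
  unfold dterm; fold k.
  pose proof (xpow_neg_mult k p) as Kp; pose proof (xpow_neg_mult k q) as Kq.
  set (a := xpow k (- p)) in *; set (a' := xpow k p) in *.
  set (b := xpow k (- q)) in *; set (b' := xpow k q) in *.
  set (x := xpow (INR (S i)) (- p)); set (y := xpow (INR (S (n - S i))) (- q)).
  (* Inserting k^(-p) k^p = k^(-q) k^q = 1 passes from the integer m to the rescaled variable m /
     k. *)
  transitivity ((a * a') * (b * b') * x * y)%C; [rewrite Kp, Kq; ring|].
  transitivity (a * b * ((x * a' - 1) * (y * b' - 1) - 1) + (a * a') * b * x + a * (b * b') * y)%C;
   [ring|rewrite Kp, Kq; ring]. }
assert (En : RtoC (INR n) = (RtoC k - 1)%C).
{ unfold k; rewrite S_INR, RtoC_plus; ring. }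
specialize (HJ (S n) ltac:(lia)); specialize (HCp n); specialize (HCq n); fold k in HJ, HCp, HCq.
assert (Epq : dterm (p + q - 1) n = (RtoC k * (dterm p n * dterm q n))%C).
{ unfold dterm; fold k. replace (- (p + q - 1))%C with ((- p + - q) + 1)%C by ring.
  rewrite xpow_succ, xpow_plus by auto; ring. }
assert (Fp : xpow k (1 - p) = (RtoC k * dterm p n)%C).
{ unfold dterm; fold k; rewrite <- xpow_succ by auto; f_equal; ring. }
assert (Fq : xpow k (1 - q) = (RtoC k * dterm q n)%C).
{ unfold dterm; fold k; rewrite <- xpow_succ by auto; f_equal; ring. }
rewrite E1, En, Epq. rewrite Fp in HCp; rewrite Fq in HCq.
match goal with |- Cmod ?X <= _ => replace X with
 (dterm p n * dterm q n * ((nodes g (S n) - RtoC k * J) + 1)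
  + dterm q n * (csum (dterm p) n - (zeta_cont p - RtoC k * dterm p n / (p - 1)))
  + dterm p n * (csum (dterm q) n - (zeta_cont q - RtoC k * dterm q n / (q - 1))))%C by (field; auto) end.
replace ((A + 1 + Ep + Eq) * Rpower k (- (Re p + Re q))) with
 (Rpower k (- Re p) * Rpower k (- Re q) * (A + 1) +
  Rpower k (- Re q) * (Ep * Rpower k (- Re p)) + Rpower k (- Re p) * (Eq * Rpower k (- Re q))).
2: { replace (- (Re p + Re q)) with (- Re p + - Re q) by ring. rewrite Rpower_plus; ring. }
apply Cmod_triangle_le; [apply Cmod_triangle_le|]; apply Cmod_mult_le; auto;
 try (rewrite Cmod_dterm; apply Rle_refl).
- rewrite Cmod_mult, !Cmod_dterm; apply Rle_refl.
- apply Cmod_triangle_le; [auto|rewrite Cmod_1; lra].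
Qed.

(** * The double series in the region of absolute convergence *)

Lemma cdiff_of_ex_derive (f : C -> C) (z : C) :
  ex_derive (K := C_AbsRing) (V := C_NormedModule) f z -> cdiff f z.
Proof.
intros [l [_ H]]; exists l; intros eps He.
destruct (H z (fun P HP => HP) (mkposreal _ He)) as [d Hd].
exists d; split; [apply cond_pos|]; intros h _ Hh.
specialize (Hd (z + h)%C).
change (Cmod (z + h + - z)%C < d ->
  Cmod (f (z + h)%C + - f z + - ((z + h + - z) * l))%C <= eps * Cmod (z + h + - z)%C) in Hd.
replace (z + h + - z)%C with h in Hd by ring.
replace (f (z + h) - f z - l * h)%C with (f (z + h)%C + - f z + - (h * l))%C by ring.
exact (Hd Hh).
Qed.

Lemma sum_n_csum (f : nat -> C) n : sum_n (G := C_AbelianGroup) f n = csum f (S n).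
Proof.
induction n.
- rewrite sum_O; cbn [csum]; symmetry; apply Cplus_0_l.
- rewrite sum_Sn, IHn; reflexivity.
Qed.

Lemma is_series_clim (f : nat -> C) (v : C) :
  is_series (K := C_AbsRing) (V := C_NormedModule) f v -> clim (csum f) v.
Proof.
intros H eps He.
assert (He2 : 0 < eps / 2) by lra.
destruct (H (ball (v : C_UniformSpace) (mkposreal _ He2))) as [N HN].
{ exists (mkposreal _ He2); auto. }
exists (S N); intros n Hn; destruct n as [|n]; [lia|].
specialize (HN n ltac:(lia)).
rewrite <- sum_n_csum.
change (sum_n (G := NormedModule.AbelianGroup C_AbsRing C_NormedModule) f n) with
 (sum_n (G := C_AbelianGroup) f n) in HN.
set (w := sum_n (G := C_AbelianGroup) f n) in *.
destruct HN as [H1 H2].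
change (Rabs (fst w - fst v) < eps / 2) in H1; change (Rabs (snd w - snd v) < eps / 2) in H2.
eapply Rle_lt_trans; [apply Cmod_le_Re_Im|].
change (Rabs (fst w - fst v) + Rabs (snd w - snd v) < eps). lra.
Qed.

Lemma csum_triangle (F : nat -> nat -> C) M :
  csum (fun n => csum (fun i => F i (n - S i)%nat) n) M =
  csum (fun i => csum (F i) (M - S i)) M.
Proof.
induction M as [|M IH]; [reflexivity|].
cbn [csum]; rewrite IH.
replace (S M - S M)%nat with O by lia; cbn [csum].
rewrite Cplus_0_r, <- csum_plus.
apply csum_ext; intros i Hi.
replace (S M - S i)%nat with (S (M - S i)) by lia; reflexivity.
Qed.

(** Since (a + b)^2 >= a b, four powers of a + b yield two of each variable. The range Re s3 >= 4 is
    generous, but agreement far to the right is all that the identity theorem asks for. *)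
Lemma Cmod_MT_term_le (s1 s2 s3 : C) (m n : nat) : 0 <= Re s1 -> 0 <= Re s2 -> 4 <= Re s3 ->
  Cmod (MT_term s1 s2 s3 (S m) (S n)) <=
  Rpower (INR (S m)) (- 2) * Rpower (INR (S n)) (- 2).
Proof.
intros H1 H2 H3; unfold MT_term; rewrite !Cmod_mult, !npow_neg_xpow, !Cmod_xpow, plus_INR.
pose proof (INR_S_ge_1 m) as Hm; pose proof (INR_S_ge_1 n) as Hn.
set (a := INR (S m)) in *; set (b := INR (S n)) in *.
change (Re (- s1)%C) with (- Re s1); change (Re (- s2)%C) with (- Re s2);
change (Re (- s3)%C) with (- Re s3).
pose proof (Rpower_le_1 a (- Re s1) Hm ltac:(lra)); pose proof (Rpower_pos a (- Re s1)).
pose proof (Rpower_le_1 b (- Re s2) Hn ltac:(lra)); pose proof (Rpower_pos b (- Re s2)).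
assert (Rpower (a + b) (- Re s3) <= Rpower a (- 2) * Rpower b (- 2)).
{ rewrite Rpower_mult_distr by lra.
  apply Rle_trans with (Rpower (a + b) (2 * - 2)); [apply Rpower_le_exp; lra|].
  rewrite <- Rpower_mult.
  replace (Rpower (a + b) 2) with ((a + b) * (a + b)).
  - apply Rpower_le_base_neg; [lra|nra].
  - replace 2 with (1 + 1) by ring. rewrite Rpower_plus, Rpower_1; lra. }
pose proof (Rpower_pos (a + b) (- Re s3)).
rewrite <- (Rmult_1_l (Rpower a (-2) * Rpower b (-2))).
apply Rmult_le_compat; try nra.
Qed.

(** Bounds what the rows of the double series lose when it is cut to a triangle: row a = m + 1 loses
    O(a^(-2) / b) with a + b = M + 1. One factor 1/a joins 1/b to give at most 1/M, and the other is
    weakened to a^(-1/2) to avoid a logarithm. *)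
Lemma rsum_conv_tail_le M :
  rsum (fun m => Rpower (INR (S m)) (- 2) * / INR (S (M - S m))) M
  <= 8 * Rpower (INR (S M)) (- (1 / 2)).
Proof.
destruct M as [|M']; [cbn [rsum]; pose proof (Rpower_pos (INR 1) (- (1/2))); lra|].
set (M := S M') in *.
assert (HM : 1 <= INR M) by apply INR_S_ge_1.
apply Rle_trans with (rsum (fun m => / INR M * Rpower (INR (S m)) (- (1 / 2))) M).
- apply rsum_le; intros m Hm.
  pose proof (INR_S_ge_1 m) as H1; pose proof (INR_S_ge_1 (M - S m)) as H2.
  assert (E : INR (S (M - S m)) = INR M - INR (S m) + 1).
  { rewrite S_INR, minus_INR by lia; ring. }
  replace (- 2) with (- (1) + - (1)) by ring.
  rewrite Rpower_plus, (Rpower_Ropp _ 1), Rpower_1 by lra.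
  set (a := INR (S m)) in *; set (b := INR (S (M - S m))) in *.
  assert (Ha : / a <= Rpower a (- (1 / 2))).
  { replace (/ a) with (Rpower a (- (1))) by (rewrite Rpower_Ropp, Rpower_1; lra).
    apply Rpower_le_exp; lra. }
  assert (Hab : / a * / b <= / INR M).
  { rewrite <- Rinv_mult. apply Rinv_le_contravar; nra. }
  assert (0 < / a) by (apply Rinv_0_lt_compat; lra).
  assert (0 < / b) by (apply Rinv_0_lt_compat; lra).
  replace (/ a * / a * / b) with (/ a * / b * / a) by ring.
  apply Rmult_le_compat; nra.
- rewrite rsum_mult.
  pose proof (rsum_Rpower_le (1 / 2) M ltac:(lra)) as H.
  replace (2 / (1 - 1 / 2)) with 4 in H by field.
  replace (1 - 1 / 2) with (- (1 / 2) + 1) in H by field.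
  rewrite Rpower_succ in H by (apply INR_S_pos).
  set (X := Rpower (INR (S M)) (- (1 / 2))) in *.
  assert (HX : 0 < X) by apply Rpower_pos.
  assert (HMi : 0 < / INR M) by (apply Rinv_0_lt_compat; lra).
  eapply Rle_trans; [apply Rmult_le_compat_l, H; lra|].
  rewrite S_INR.
  replace (/ INR M * (4 * ((INR M + 1) * X))) with (4 * X * ((INR M + 1) / INR M)) by (field; lra).
  assert ((INR M + 1) / INR M <= 2) by (apply Rle_div_l; lra).
  nra.
Qed.

(** The double series is given as an iterated sum over rows, while grouping by k = m + n sums over
    the triangles m + n <= M. The rows cut off by the triangle lose a total that tends to 0. *)
Lemma MT_series_partial (s1 s2 s3 v : C) : 0 <= Re s1 -> 0 <= Re s2 -> 4 <= Re s3 ->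
  MT_series_value s1 s2 s3 v ->
  clim (csum (fun n => inner_conv s1 s2 (S n) * dterm s3 n)%C) v.
Proof.
intros H1 H2 H3 [inner [Hin Hv]].
set (x := fun m n => MT_term s1 s2 s3 (S m) (S n)).
assert (HA : forall M, csum (fun n => inner_conv s1 s2 (S n) * dterm s3 n)%C M =
   csum (fun i => csum (x i) (M - S i)) M).
{ intros M; rewrite <- csum_triangle; apply csum_ext; intros n Hn.
  rewrite inner_conv_csum, Cmult_comm, <- csum_mult; apply csum_ext; intros i Hi.
  unfold x, MT_term; rewrite !npow_neg_xpow; unfold dterm.
  replace (S i + S (n - S i))%nat with (S n) by lia. ring. }
assert (Htail : forall m N, Cmod (inner m - csum (x m) N) <=
   Rpower (INR (S m)) (- 2) * ptail 1 1 N).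
{ intros m N.
  apply (clim_bound (csum (x m)) _ _ _ N); [apply is_series_clim, Hin|].
  intros n Hn. eapply Rle_trans.
  - apply (csum_tail_le _ (fun n => Rpower (INR (S m)) (- 2) * ptail 1 1 n)); auto.
    intros k Hk; eapply Rle_trans; [apply Cmod_MT_term_le; auto|].
    rewrite <- Rmult_minus_distr_l; apply Rmult_le_compat_l; [left; apply Rpower_pos|].
    pose proof (ptail_diff 1 1 k ltac:(lra) ltac:(lra)) as H.
    replace (-1 - 1) with (- 2) in H by ring. lra.
  - pose proof (Rpower_pos (INR (S m)) (- 2)).
    pose proof (ptail_pos 1 1 n ltac:(lra) ltac:(lra)). nra. }
assert (Hdiff : forall M, Cmod (csum inner M - csum (fun i => csum (x i) (M - S i)) M) <=
   32 * Rpower (INR (S M)) (- (1 / 2))).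
{ intros M; rewrite <- csum_minus.
  eapply Rle_trans; [apply Cmod_csum_le|].
  apply Rle_trans with (rsum (fun m => 4 * (Rpower (INR (S m)) (- 2) * / INR (S (M - S m)))) M).
  - apply rsum_le; intros m Hm; eapply Rle_trans; [apply Htail|].
    right; unfold ptail. rewrite Rpower_Ropp, Rpower_1 by apply INR_S_pos.
    replace (1 + 1) with 2 by ring.
    replace (Rpower 2 2) with 4; [field|].
    + apply not_0_INR; lia.
    + replace 2 with (1 + 1) at 2 by ring; rewrite Rpower_plus, Rpower_1; lra.
  - rewrite rsum_mult. pose proof (rsum_conv_tail_le M). lra. }
apply is_series_clim in Hv.
replace v with (v + 0)%C by ring.
intros eps He.
destruct (Hv (eps / 2) ltac:(lra)) as [N1 HN1].
destruct (Rpower_tendsto0 32 (1 / 2) ltac:(lra) ltac:(lra) (eps / 2) ltac:(lra)) as [N2 HN2].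
exists (N1 + N2)%nat; intros n Hn.
specialize (HN1 n ltac:(lia)); specialize (HN2 n ltac:(lia)); specialize (Hdiff n).
rewrite HA.
replace (csum (fun i => csum (x i) (n - S i)) n - (v + 0))%C with
 ((csum inner n - v) - (csum inner n - csum (fun i => csum (x i) (n - S i)) n))%C by ring.
apply Rle_lt_trans with (Cmod (csum inner n - v) +
  Cmod (csum inner n - csum (fun i => csum (x i) (n - S i)) n)); [|lra].
apply Cmod_minus_le; apply Rle_refl.
Qed.

(** * Mean squares of Dirichlet polynomials *)

Definition oscillation (c : C) (mu t : R) : C := (c * cexp (0, (mu * t)%R))%C.

Lemma Cmod_oscillation (c : C) (mu t : R) : Cmod (oscillation c mu t) = Cmod c.
Proof. unfold oscillation; rewrite Cmod_mult, Cmod_cexp; simpl; rewrite exp_0; ring. Qed.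

Lemma is_RInt_oscillation (c : C) (mu a b : R) : mu <> 0 ->
  exists v : R, is_RInt (fun t => Re (oscillation c mu t)) a b v /\ Rabs v <= 2 * Cmod c / Rabs mu.
Proof.
intros Hmu.
exists (Im (oscillation c mu b) / mu - Im (oscillation c mu a) / mu); split.
- apply (is_RInt_derive (V := R_CompleteNormedModule) (fun t => Im (oscillation c mu t) / mu)).
  + intros t _; unfold oscillation, cexp; simpl. auto_derive; auto.
    rewrite exp_0; eq_as_R; unfold Re; simpl; field; auto.
  + intros t _; apply (ex_derive_continuous (fun t => Re (oscillation c mu t))).
    unfold oscillation, cexp; simpl. auto_derive; auto.
- unfold Rdiv, Rminus; rewrite Ropp_mult_distr_l, <- Rmult_plus_distr_r, Rabs_mult, Rabs_inv.
  apply Rmult_le_compat_r; [left; apply Rinv_0_lt_compat, Rabs_pos_lt; auto|].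
  eapply Rle_trans; [apply Rabs_triang|]; rewrite Rabs_Ropp.
  pose proof (im_le_Cmod (oscillation c mu a)); pose proof (im_le_Cmod (oscillation c mu b)).
  rewrite Cmod_oscillation in *. lra.
Qed.

Lemma is_RInt_zero (a b : R) : is_RInt (fun _ => 0) a b 0.
Proof.
pose proof (is_RInt_const (V := R_NormedModule) a b 0) as H.
change (scal (b - a) 0) with ((b - a) * 0) in H.
rewrite Rmult_0_r in H; exact H.
Qed.

Lemma is_RInt_rsum_bound (g : nat -> R -> R) (B : nat -> R) (a b : R) n :
  (forall i, (i < n)%nat -> exists v : R, is_RInt (g i) a b v /\ Rabs v <= B i) ->
  exists v : R, is_RInt (fun t => rsum (fun i => g i t) n) a b v /\ Rabs v <= rsum B n.
Proof.
induction n as [|n IH]; intros H.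
- exists 0; split; [|cbn [rsum]; rewrite Rabs_R0; lra].
  apply is_RInt_zero.
- destruct IH as [v [Hv Bv]]; [intros; apply H; lia|].
  destruct (H n ltac:(lia)) as [w [Hw Bw]].
  exists (v + w); split; [exact (is_RInt_plus _ _ _ _ _ _ Hv Hw)|].
  cbn [rsum]; eapply Rle_trans; [apply Rabs_triang|lra].
Qed.

Lemma Re_csum (f : nat -> C) n : Re (csum f n) = rsum (fun i => Re (f i)) n.
Proof. induction n; cbn [csum rsum]; [reflexivity|rewrite <- IHn; reflexivity]. Qed.

Lemma Cmod2_plus (a b : C) : Cmod (a + b) ^ 2 = Cmod a ^ 2 + (Cmod b ^ 2 + 2 * Re (a * Cconj b)%C).
Proof. rewrite !Cmod2_alt; destruct a, b; unfold Re, Im; simpl; ring. Qed.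

Definition dirichlet_poly (b : nat -> C) (lam : nat -> R) (n : nat) (t : R) : C :=
  csum (fun i => oscillation (b i) (- lam i) t) n.

Lemma oscillation_conj (a b : C) (x y t : R) :
  (oscillation a x t * Cconj (oscillation b y t))%C = oscillation (a * Cconj b) (x - y) t.
Proof.
unfold oscillation.
replace (Cconj (b * cexp (0, (y * t)%R)))%C with (Cconj b * cexp (0, (- (y * t))%R))%C.
- transitivity (a * Cconj b * (cexp (0, (x * t)%R) * cexp (0, (- (y * t))%R)))%C; [ring|].
  rewrite <- cexp_plus; f_equal; f_equal.
  apply injective_projections; simpl; ring.
- unfold cexp, Cconj; simpl. rewrite cos_neg, sin_neg.
  destruct b; apply injective_projections; simpl; ring.
Qed.

(** Induction on the length: a new term contributes its own square and its cross terms with all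
    earlier ones. The constant 4 is 2 for the doubled real part times 2 for the two endpoints of the
    integral. *)
Lemma dirichlet_mean_square (b : nat -> C) (lam : nat -> R) (u w : R) n : u <= w ->
  (forall i j, (i < j)%nat -> lam i < lam j) ->
  exists v : R, is_RInt (fun t => Cmod (dirichlet_poly b lam n t) ^ 2) u w v /\
   Rabs (v - (w - u) * rsum (fun i => Cmod (b i) ^ 2) n) <=
   rsum (fun l => rsum (fun i => 4 * (Cmod (b i) * Cmod (b l)) / (lam l - lam i)) l) n.
Proof.
intros Huw Hlam; induction n as [|n [v [Hv Bv]]].
- exists 0; split.
  + apply (is_RInt_ext (fun _ => 0)).
    * intros t _; unfold dirichlet_poly; cbn [csum]; rewrite Cmod_0; symmetry; apply Rmult_0_l.
    * apply is_RInt_zero.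
  + cbn [rsum]; rewrite Rmult_0_r, Rminus_0_r, Rabs_R0; lra.
- destruct (is_RInt_rsum_bound
   (fun i t => 2 * Re (oscillation (b i * Cconj (b n)) (lam n - lam i) t))
   (fun i => 4 * (Cmod (b i) * Cmod (b n)) / (lam n - lam i)) u w n) as [z [Hz Bz]].
  { intros i Hi; pose proof (Hlam i n Hi) as HL.
    destruct (is_RInt_oscillation (b i * Cconj (b n)) (lam n - lam i) u w ltac:(lra)) as [z [Hz Bz]].
    exists (2 * z); split; [exact (is_RInt_scal _ _ _ 2 _ Hz)|].
    rewrite Rabs_mult, (Rabs_pos_eq 2) by lra.
    rewrite Cmod_mult, Cmod_conj, (Rabs_pos_eq (lam n - lam i)) in Bz by lra.
    replace (4 * (Cmod (b i) * Cmod (b n)) / (lam n - lam i)) with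
     (2 * (2 * (Cmod (b i) * Cmod (b n)) / (lam n - lam i))) by (field; lra). lra. }
  exists (v + ((w - u) * Cmod (b n) ^ 2 + z)); split.
  + eapply is_RInt_ext; [|exact (is_RInt_plus _ _ _ _ _ _ Hv
      (is_RInt_plus _ _ _ _ _ _ (is_RInt_const u w (Cmod (b n) ^ 2)) Hz))].
    intros t _. unfold plus; simpl AbelianGroup.sort; cbv beta.
    unfold dirichlet_poly; cbn [csum]; rewrite Cmod2_plus, Cmod_oscillation.
    change (@eq R (Cmod (csum (fun i => oscillation (b i) (- lam i) t) n) ^ 2 +
      (Cmod (b n) ^ 2 + rsum (fun i => 2 * Re (oscillation (b i * Cconj (b n)) (lam n - lam i) t)) n))
      (Cmod (csum (fun i => oscillation (b i) (- lam i) t) n) ^ 2 +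
        (Cmod (b n) ^ 2 + 2 * Re (csum (fun i => oscillation (b i) (- lam i) t) n * Cconj (oscillation (b n) (- lam n) t))%C))).
    f_equal; f_equal. rewrite rsum_mult; f_equal.
    rewrite Cmult_comm, <- csum_mult, Re_csum; apply rsum_ext; intros i Hi.
    rewrite (Cmult_comm (Cconj _)), oscillation_conj; do 2 f_equal; ring.
  + cbn [rsum].
    replace (v + ((w - u) * Cmod (b n) ^ 2 + z) -
     (w - u) * (rsum (fun i => Cmod (b i) ^ 2) n + Cmod (b n) ^ 2)) with
     ((v - (w - u) * rsum (fun i => Cmod (b i) ^ 2) n) + z) by ring.
    eapply Rle_trans; [apply Rabs_triang|]. lra.
Qed.

(** * Off-diagonal terms *)

Lemma rsum_shift (f : nat -> R) n : rsum f (S n) = f O + rsum (fun i => f (S i)) n.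
Proof. change (S n) with (1 + n)%nat; rewrite rsum_add; simpl; ring. Qed.

Lemma rsum_rev (f : nat -> R) n : rsum (fun i => f (n - S i)%nat) n = rsum f n.
Proof.
induction n; [reflexivity|].
rewrite rsum_shift; cbn [rsum]; rewrite <- IHn.
replace (S n - 1)%nat with n by lia. simpl. ring.
Qed.

(** This is ln y <= y - 1 at the ratio y of the two integers; the numerator on the left is their
    difference. *)
Lemma ln_diff_lower (i l : nat) : (i < l)%nat ->
  INR (S (l - S i)) / INR (S l) <= ln (INR (S l)) - ln (INR (S i)).
Proof.
intros Hil; pose proof (INR_S_pos i) as Hi; pose proof (INR_S_pos l) as Hl.
assert (E : INR (S (l - S i)) = INR (S l) - INR (S i)).
{ rewrite <- minus_INR by lia; f_equal; lia. }
rewrite E.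
assert (H : ln (INR (S i) / INR (S l)) <= INR (S i) / INR (S l) - 1).
{ pose proof (exp_ineq1_le (ln (INR (S i) / INR (S l)))) as H.
  rewrite exp_ln in H by (apply Rdiv_lt_0_compat; auto). lra. }
rewrite ln_div in H by auto.
replace ((INR (S l) - INR (S i)) / INR (S l)) with (1 - INR (S i) / INR (S l)) by (field; lra).
lra.
Qed.

(** With K = l + 1, k = i + 1 and j = K - k, one has K/j = 1 + k/j. The first part is a plain power
    sum. In the second, k^(1-be) <= K^(1-be), and 1/j is weakened to K^d j^(-1-d), whose sum over j
    converges; the cost K^d raises K^(1-be) exactly to K^(1/2). *)
Lemma offdiag_inner (be : R) (l : nat) : 1 / 2 < be < 1 ->
  rsum (fun i => Rpower (INR (S i)) (- be) / (ln (INR (S l)) - ln (INR (S i)))) l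
  <= (2 / (1 - be) + ptail 1 (be - 1 / 2) 0) * Rpower (INR (S l)) (1 / 2).
Proof.
intros Hbe; pose proof (INR_S_ge_1 l) as HK; set (K := INR (S l)) in *.
set (d := be - 1 / 2) in *.
assert (Hd : 0 < d) by (unfold d; lra).
apply Rle_trans with (rsum (fun i => Rpower (INR (S i)) (- be)
  + Rpower K (1 - be) * (Rpower K d * Rpower (INR (S (l - S i))) (- 1 - d))) l).
- apply rsum_le; intros i Hi.
  pose proof (INR_S_ge_1 i) as Hk; pose proof (INR_S_ge_1 (l - S i)) as Hj.
  pose proof (ln_diff_lower i l Hi) as HL; fold K in HL.
  assert (E : INR (S (l - S i)) = K - INR (S i)).
  { unfold K; rewrite <- minus_INR by lia; f_equal; lia. }
  set (k := INR (S i)) in *; set (j := INR (S (l - S i))) in *.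
  assert (HjK : 0 < j / K) by (apply Rdiv_lt_0_compat; lra).
  apply Rle_trans with (Rpower k (- be) * (K / j)).
  + apply Rmult_le_compat_l; [left; apply Rpower_pos|].
    replace (K / j) with (/ (j / K)) by (field; lra). apply Rinv_le_contravar; lra.
  + replace (Rpower k (- be) * (K / j)) with (Rpower k (- be) + (k * Rpower k (- be)) * / j)
     by (replace K with (j + k) by lra; field; lra).
    apply Rplus_le_compat_l. rewrite <- Rpower_succ by lra.
    assert (H1 : Rpower k (- be + 1) <= Rpower K (1 - be)).
    { replace (- be + 1) with (1 - be) by ring. apply Rpower_le_base; lra. }
    assert (H2 : / j <= Rpower K d * Rpower j (- 1 - d)).
    { replace (-1 - d) with (- d + - (1)) by ring.
      rewrite Rpower_plus, (Rpower_Ropp _ 1), Rpower_1 by lra.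
      assert (1 <= Rpower K d * Rpower j (- d)).
      { rewrite Rpower_Ropp. pose proof (Rpower_pos j d).
        apply (Rle_div_r 1 (Rpower K d)); auto. rewrite Rmult_1_l.
        apply Rpower_le_base; lra. }
      assert (0 < / j) by (apply Rinv_0_lt_compat; lra). nra. }
    assert (0 < / j) by (apply Rinv_0_lt_compat; lra).
    pose proof (Rpower_pos k (- be + 1)).
    apply Rmult_le_compat; lra.
- rewrite rsum_plus, rsum_mult, rsum_mult.
  pose proof (rsum_Rpower_le be l ltac:(lra)) as H1; fold K in H1.
  rewrite (rsum_rev (fun j => Rpower (INR (S j)) (- 1 - d)) l).
  assert (H2 : rsum (fun j => Rpower (INR (S j)) (- 1 - d)) l <= ptail 1 d 0).
  { apply Rle_trans with (rsum (fun j => ptail 1 d j - ptail 1 d (S j)) l).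
    - apply rsum_le; intros j Hj.
      pose proof (ptail_diff 1 d j ltac:(lra) Hd). lra.
    - rewrite rsum_telescope. pose proof (ptail_pos 1 d l ltac:(lra) Hd). lra. }
  assert (E2 : Rpower K (1 - be) * Rpower K d = Rpower K (1 / 2)).
  { rewrite <- Rpower_plus; f_equal; unfold d; field. }
  assert (H3 : Rpower K (1 - be) <= Rpower K (1 / 2)) by (apply Rpower_le_exp; lra).
  assert (0 < 2 / (1 - be)) by (apply Rdiv_lt_0_compat; lra).
  rewrite <- Rmult_assoc, E2, Rmult_plus_distr_r.
  pose proof (Rpower_pos K (1 / 2)).
  apply Rplus_le_compat; [nra|]. rewrite Rmult_comm. apply Rmult_le_compat_r; lra.
Qed.

Lemma offdiag_bound (b : nat -> C) (C0 be : R) : 1 / 2 < be < 1 -> 0 <= C0 ->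
  (forall i, Cmod (b i) <= C0 * Rpower (INR (S i)) (- be)) ->
  exists Q, 0 <= Q /\ forall n,
  rsum (fun l => rsum (fun i => 4 * (Cmod (b i) * Cmod (b l)) /
    (ln (INR (S l)) - ln (INR (S i)))) l) n <= Q * Rpower (INR (S n)) (3 / 2 - be).
Proof.
intros Hbe HC Hb.
set (A := 2 / (1 - be) + ptail 1 (be - 1 / 2) 0).
assert (HA : 0 <= A).
{ unfold A; pose proof (ptail_pos 1 (be - 1 / 2) 0 ltac:(lra) ltac:(lra)).
  assert (0 < 2 / (1 - be)) by (apply Rdiv_lt_0_compat; lra). lra. }
set (d := be - 1 / 2).
exists (4 * C0 * C0 * A * (2 / (1 - d))); split.
{ assert (0 < 2 / (1 - d)) by (apply Rdiv_lt_0_compat; unfold d; lra).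
  repeat (apply Rmult_le_pos; [|lra]); lra. }
intros n.
apply Rle_trans with (rsum (fun l => 4 * C0 * C0 * A * Rpower (INR (S l)) (- d)) n).
- apply rsum_le; intros l Hl.
  apply Rle_trans with (rsum (fun i => 4 * C0 * C0 * Rpower (INR (S l)) (- be) *
   (Rpower (INR (S i)) (- be) / (ln (INR (S l)) - ln (INR (S i))))) l).
  + apply rsum_le; intros i Hi.
    pose proof (ln_diff_lower i l Hi) as HL.
    assert (0 < INR (S (l - S i)) / INR (S l)) by (apply Rdiv_lt_0_compat; apply INR_S_pos).
    set (D := ln (INR (S l)) - ln (INR (S i))) in *.
    assert (HD : 0 < / D) by (apply Rinv_0_lt_compat; lra).
    pose proof (Hb i) as B1; pose proof (Hb l) as B2.
    pose proof (Cmod_ge_0 (b i)); pose proof (Cmod_ge_0 (b l)).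
    unfold Rdiv.
    replace (4 * C0 * C0 * Rpower (INR (S l)) (- be) * (Rpower (INR (S i)) (- be) * / D)) with
     (4 * ((C0 * Rpower (INR (S i)) (- be)) * (C0 * Rpower (INR (S l)) (- be))) * / D) by ring.
    apply Rmult_le_compat_r; [lra|]. apply Rmult_le_compat_l; [lra|].
    apply Rmult_le_compat; auto.
  + rewrite rsum_mult.
    pose proof (offdiag_inner be l Hbe) as H; fold A in H.
    pose proof (Rpower_pos (INR (S l)) (- be)) as HP.
    apply Rle_trans with (4 * C0 * C0 * Rpower (INR (S l)) (- be) * (A * Rpower (INR (S l)) (1 / 2))).
    * apply Rmult_le_compat_l; auto. repeat apply Rmult_le_pos; lra.
    * replace (- d) with (- be + 1 / 2) by (unfold d; ring).
      rewrite Rpower_plus; right; ring.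
- rewrite rsum_mult, (Rmult_assoc (4 * C0 * C0 * A)). apply Rmult_le_compat_l.
  + repeat apply Rmult_le_pos; lra.
  + pose proof (rsum_Rpower_le d n ltac:(unfold d; lra)) as H.
    replace (3 / 2 - be) with (1 - d) by (unfold d; field). exact H.
Qed.

(** * Continuation of the double zeta function *)

Definition conv_remainder (p q B : C) (n : nat) : C :=
  (inner_conv p q (S n) - (B * dterm (p + q - 1) n + zeta_cont p * dterm q n + zeta_cont q * dterm p n))%C.

(** [B] is kept as a parameter: it is determined by the bound on [conv_remainder] that the following
    lemmas assume. *)
Definition MTcont (p q B : C) (s : C) : C :=
  (B * zeta_cont (p + q - 1 + s) + zeta_cont p * zeta_cont (q + s) + zeta_cont q * zeta_cont (p + s)
   + Clim (csum (fun n => conv_remainder p q B n * dterm s n)))%C.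

Lemma dterm_mult (s w : C) (n : nat) : (dterm s n * dterm w n)%C = dterm (s + w) n.
Proof. unfold dterm; rewrite <- xpow_plus; f_equal; ring. Qed.

Lemma conv_partial (p q B s : C) (n : nat) :
  csum (fun n => inner_conv p q (S n) * dterm s n)%C n =
  (B * csum (dterm (p + q - 1 + s)) n + zeta_cont p * csum (dterm (q + s)) n
   + zeta_cont q * csum (dterm (p + s)) n + csum (fun n => conv_remainder p q B n * dterm s n) n)%C.
Proof.
rewrite <- !csum_mult, <- !csum_plus; apply csum_ext; intros i _.
unfold conv_remainder; rewrite <- !dterm_mult; ring.
Qed.

Lemma conv_remainder_cauchy (p q B s : C) (E : R) : 0 <= E ->
  (forall n, Cmod (conv_remainder p q B n) <= E * Rpower (INR (S n)) (- (Re p + Re q))) ->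
  1 < Re p + Re q + Re s ->
  clim (csum (fun n => conv_remainder p q B n * dterm s n)%C) (Clim (csum (fun n => conv_remainder p q B n * dterm s n)%C)) /\
  forall n, Cmod (Clim (csum (fun n => conv_remainder p q B n * dterm s n)%C) - csum (fun n => conv_remainder p q B n * dterm s n)%C n)
   <= ptail E (Re p + Re q + Re s - 1) n.
Proof.
intros HE Hr Hs; set (e := Re p + Re q + Re s - 1).
assert (He : 0 < e) by (unfold e; lra).
apply clim_complete; [apply ptail_tendsto0; auto|].
intros N M HNM; eapply Rle_trans.
- apply (csum_tail_le _ (ptail E e)); auto; intros k _.
  eapply Rle_trans; [|apply ptail_diff; auto].
  replace (-1 - e) with (- (Re p + Re q) + - Re s) by (unfold e; ring).
  rewrite Rpower_plus, <- Rmult_assoc.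
  apply Cmod_mult_le; [apply Hr|rewrite Cmod_dterm; apply Rle_refl].
- pose proof (ptail_pos E e M HE He); lra.
Qed.

Lemma cdiff_remainder_series (p q B s : C) (E : R) : 0 <= E ->
  (forall n, Cmod (conv_remainder p q B n) <= E * Rpower (INR (S n)) (- (Re p + Re q))) ->
  1 < Re p + Re q -> 0 < Re s ->
  cdiff (fun s => Clim (csum (fun n => conv_remainder p q B n * dterm s n)%C)) s.
Proof.
intros HE Hr Hpq Hs.
(* Half of the excess of Re p + Re q over 1: one half pays for the logarithm from differentiation,
   the other for convergence. *)
set (d := (Re p + Re q - 1) / 2); assert (Hd : 0 < d) by (unfold d; lra).
assert (HEd : 0 <= E / d) by (apply Rdiv_le_0_compat; auto).
assert (Hball : forall z, Cmod (z - s) < Re s -> 0 < Re z).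
{ intros z Hz; pose proof (re_le_Cmod (z - s)) as H; unfold Re in H; simpl in H.
  destruct (Rabs_def2 (fst z + - fst s) (Re s) ltac:(lra)). unfold Re in *; lra. }
apply (series_cdiff (fun n z => conv_remainder p q B n * dterm z n)%C
  (fun n z => conv_remainder p q B n * - (RtoC (ln (INR (S n))) * dterm z n))%C (ptail (E / d) d) _ s (Re s)); auto.
- apply ptail_tendsto0; auto.
- intros; apply ptail_pos; auto.
- intros i z Hz; apply derw_scal, cder_xpow_neg.
- intros i z Hz; specialize (Hball z Hz).
  eapply Rle_trans; [|apply ptail_diff; auto].
  pose proof (INR_S_ge_1 i) as Hi; set (k := INR (S i)) in *.
  pose proof (Rpower_pos k (- (Re p + Re q))).
  apply Rle_trans with (E * Rpower k (- (Re p + Re q)) * (Rpower k d / d * 1)).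
  + apply Cmod_mult_le; [apply Hr|]. rewrite Cmod_opp.
    apply Cmod_mult_le.
    * rewrite Cmod_R, Rabs_pos_eq; [apply ln_le_Rpower; auto|apply ln_nonneg; auto].
    * rewrite Cmod_dterm; apply Rpower_le_1; auto; lra.
  + replace (-1 - d) with (- (Re p + Re q) + d) by (unfold d; field).
    rewrite Rpower_plus; right; field; lra.
- intros z Hz; specialize (Hball z Hz); apply (conv_remainder_cauchy p q B z E); auto; lra.
Qed.

Lemma cdiff_zeta_cont_shift (a s : C) : 0 < Re (a + s)%C -> 0 < Im (a + s)%C ->
  cdiff (fun s => zeta_cont (a + s)) s.
Proof.
intros H1 H2; apply (cdiff_comp zeta_cont (fun s => a + s)%C).
- apply cdiff_plus; [apply cdiff_const|apply cdiff_id].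
- apply cdiff_zeta_cont; auto; intros E; rewrite E in H2; simpl in H2; lra.
Qed.

Lemma Re_plus_C (a b : C) : Re (a + b)%C = Re a + Re b. Proof. reflexivity. Qed.
Lemma Im_plus_C (a b : C) : Im (a + b)%C = Im a + Im b. Proof. reflexivity. Qed.
Lemma Re_pq1 (p q : C) : Re (p + q - 1)%C = Re p + Re q - 1. Proof. reflexivity. Qed.
Lemma Im_pq1 (p q : C) : Im (p + q - 1)%C = Im p + Im q. Proof. unfold Im; simpl; ring. Qed.

Lemma not_MT_singular (p q s : C) : 0 <= Im p -> 0 <= Im q -> 0 < Im s -> ~ MT_singular p q s.
Proof.
intros Hp Hq Hs [[l H]|[[l H]|H]]; apply (f_equal Im) in H; unfold Im in *; simpl in H; lra.
Qed.

(* Both sides are holomorphic in the quadrant [Re s > 0], [Im s > 0], which avoids all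
   singularities, and agree for large [Re s]. *)
Lemma zetaMT2_eq_MTcont (p q B : C) (Z : C -> C) (E : R) : 0 <= E ->
  (forall n, Cmod (conv_remainder p q B n) <= E * Rpower (INR (S n)) (- (Re p + Re q))) ->
  is_zetaMT2_in_s3 p q Z ->
  0 <= Re p -> 0 <= Re q -> 0 <= Im p -> 0 <= Im q -> 1 < Re p + Re q ->
  forall s, 0 < Re s -> 0 < Im s -> Z s = MTcont p q B s.
Proof.
intros HE Hr [HZ1 HZ2] Hp Hq Ip Iq Hpq s Hs1 Hs2.
assert (H0 : (Z s - MTcont p q B s)%C = 0).
{ apply (identity_quadrant (fun s => Z s - MTcont p q B s)%C 4); auto; clear s Hs1 Hs2.
  - intros s Hs1 Hs2; apply cdiff_minus.
    + apply cdiff_of_ex_derive, HZ1, not_MT_singular; auto.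
    + unfold MTcont.
      apply cdiff_plus; [apply cdiff_plus; [apply cdiff_plus|]|].
      * apply cdiff_mult; [apply cdiff_const|apply cdiff_zeta_cont_shift];
         rewrite ?Re_plus_C, ?Im_plus_C, ?Re_pq1, ?Im_pq1; lra.
      * apply cdiff_mult; [apply cdiff_const|apply cdiff_zeta_cont_shift];
         rewrite ?Re_plus_C, ?Im_plus_C; lra.
      * apply cdiff_mult; [apply cdiff_const|apply cdiff_zeta_cont_shift];
         rewrite ?Re_plus_C, ?Im_plus_C; lra.
      * apply (cdiff_remainder_series p q B s E); auto.
  - intros s Hs2 Hs1.
    assert (EZ : Z s = MTcont p q B s).
    { apply (clim_unique (csum (fun n => inner_conv p q (S n) * dterm s n)%C)).
      - apply MT_series_partial; auto; [lra|]. apply HZ2; unfold MT_abs_region; lra.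
      - intros eps He.
        assert (HL : clim (fun n => B * csum (dterm (p + q - 1 + s)) n + zeta_cont p * csum (dterm (q + s)) n
          + zeta_cont q * csum (dterm (p + s)) n + csum (fun n => conv_remainder p q B n * dterm s n) n)%C (MTcont p q B s)).
        { unfold MTcont; repeat apply clim_plus; try apply clim_mult_const;
           try (apply zeta_cont_series; rewrite ?Re_plus_C, ?Re_pq1; lra).
          apply (conv_remainder_cauchy p q B s E); auto; lra. }
        destruct (HL eps He) as [N HN]; exists N; intros n Hn.
        rewrite (conv_partial p q B); apply HN; auto. }
    rewrite EZ; ring. }
replace (Z s) with ((Z s - MTcont p q B s) + MTcont p q B s)%C by ring.
rewrite H0; ring.
Qed.

(** Brings both errors of [zeta_cont_approx] to the form N^a / t, the first by |w - 1| >= t and the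
    second by N >= t. The free exponent [a] lets the three zeta factors share one bound. *)
Lemma zeta_cont_error (w : C) (n : nat) (t a : R) : 0 < Re w <= 1 -> 1 - Re w <= a -> 2 <= t -> t <= Im w ->
  t <= INR (S n) -> 2 * Cmod w + 2 <= INR (S n) ->
  Cmod (zeta_cont w - csum (dterm w) n) <= 51 * (Rpower (INR (S n)) a / t).
Proof.
intros Hw Ha Ht Htw HtN HN.
eapply Rle_trans; [apply zeta_cont_approx; auto; lra|].
set (N := INR (S n)) in *.
assert (HN1 : 1 <= N) by apply INR_S_ge_1.
assert (Hw1 : t <= Cmod (w - 1)).
{ eapply Rle_trans; [|apply im_le_Cmod]. eapply Rle_trans; [|apply Rle_abs].
  unfold Im in *; simpl; lra. }
assert (E : Rpower N (1 - Re w) = N * Rpower N (- Re w)).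
{ rewrite <- Rpower_succ by lra; f_equal; ring. }
assert (H1 : Rpower N (1 - Re w) <= Rpower N a) by (apply Rpower_le_exp; auto).
assert (H2 : Rpower N (1 - Re w) / Cmod (w - 1) <= Rpower N a / t).
{ unfold Rdiv; apply Rmult_le_compat; auto.
  - left; apply Rpower_pos.
  - left; apply Rinv_0_lt_compat; lra.
  - apply Rinv_le_contravar; lra. }
assert (H3 : Rpower N (- Re w) <= Rpower N a / t).
{ apply Rle_div_r; [lra|]. pose proof (Rpower_pos N (- Re w)). nra. }
lra.
Qed.

(** The term with [B] dictates the exponent 2 - alpha; the other two zeta factors have exponents no
    larger because Re p, Re q <= 1, and the remainder, of size N^(1-alpha), is absorbed by t <= N.
    [M] exceeds |w| - t for each of the three arguments w of zeta. *)
Lemma MTcont_error (p q B : C) (c E : R) : 0 <= E ->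
  (forall n, Cmod (conv_remainder p q B n) <= E * Rpower (INR (S n)) (- (Re p + Re q))) ->
  0 < c -> 0 <= Im p -> 0 <= Im q -> Re p <= 1 -> Re q <= 1 ->
  Re p + c <= 1 -> Re q + c <= 1 -> 3 / 2 < Re p + Re q + c ->
  exists K M, 0 <= K /\ forall (t : R) (n : nat), 2 <= t -> 2 * (M + t) + 2 <= INR (S n) ->
   Cmod (MTcont p q B (c, t) - csum (fun n => inner_conv p q (S n) * dterm (c, t) n)%C n)
   <= K * (Rpower (INR (S n)) (2 - (Re p + Re q + c)) / t).
Proof.
intros HE Hr Hc Ip Iq Hp Hq Hpc Hqc Hal.
set (al := Re p + Re q + c) in *.
set (Kr := E * (Rpower 2 (1 + (al - 1)) / (al - 1))).
assert (HKr : 0 <= Kr).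
{ unfold Kr; apply Rmult_le_pos; auto; left; apply ptail_const_pos; lra. }
pose proof (Cmod_ge_0 B) as HB0; pose proof (Cmod_ge_0 (zeta_cont p)) as Hz0; pose proof (Cmod_ge_0 (zeta_cont q)) as Hz0'.
exists (51 * (Cmod B + Cmod (zeta_cont p) + Cmod (zeta_cont q)) + Kr), (Cmod p + Cmod q + 1 + c); split; [nra|].
intros t n Ht HN.
pose proof (Cmod_ge_0 p) as Hp0; pose proof (Cmod_ge_0 q) as Hq0.
assert (Hs : Cmod (c, t) <= c + t).
{ eapply Rle_trans; [apply Cmod_le_abs|]; rewrite !Rabs_pos_eq; lra. }
assert (HtN : t <= INR (S n)) by lra.
rewrite (conv_partial p q B); unfold MTcont.
set (s := (c, t) : C) in *.
assert (Res : Re s = c) by reflexivity; assert (Ims : Im s = t) by reflexivity.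
set (X := Rpower (INR (S n)) (2 - al) / t).
assert (A1 : Cmod (zeta_cont (p + q - 1 + s) - csum (dterm (p + q - 1 + s)) n) <= 51 * X).
{ apply zeta_cont_error; rewrite ?Re_plus_C, ?Im_plus_C, ?Re_pq1, ?Im_pq1, ?Res, ?Ims; auto;
   try (unfold al in *; lra).
  assert (Cmod (p + q - 1 + s)%C <= Cmod p + Cmod q + 1 + (c + t)).
  { apply Cmod_triangle_le; auto. apply Cmod_minus_le; [|rewrite Cmod_1; lra].
    apply Cmod_triangle_le; lra. }
  lra. }
assert (A2 : Cmod (zeta_cont (q + s) - csum (dterm (q + s)) n) <= 51 * X).
{ apply zeta_cont_error; rewrite ?Re_plus_C, ?Im_plus_C, ?Res, ?Ims; auto;
   try (unfold al in *; lra).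
  assert (Cmod (q + s)%C <= Cmod q + (c + t)) by (apply Cmod_triangle_le; lra).
  lra. }
assert (A3 : Cmod (zeta_cont (p + s) - csum (dterm (p + s)) n) <= 51 * X).
{ apply zeta_cont_error; rewrite ?Re_plus_C, ?Im_plus_C, ?Res, ?Ims; auto;
   try (unfold al in *; lra).
  assert (Cmod (p + s)%C <= Cmod p + (c + t)) by (apply Cmod_triangle_le; lra).
  lra. }
destruct (conv_remainder_cauchy p q B s E HE Hr) as [_ A4]; [rewrite Res; unfold al in *; lra|].
specialize (A4 n); rewrite Res in A4; fold al in A4.
assert (A5 : ptail E (al - 1) n <= Kr * X).
{ unfold ptail; fold Kr; apply Rmult_le_compat_l; auto.
  unfold X; apply Rle_div_r; [lra|].
  replace (2 - al) with (- (al - 1) + 1) by ring.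
  pose proof (INR_S_ge_1 n). rewrite Rpower_succ by lra.
  pose proof (Rpower_pos (INR (S n)) (- (al - 1))). nra. }
match goal with |- Cmod ?A <= _ => replace A with
 (B * (zeta_cont (p + q - 1 + s) - csum (dterm (p + q - 1 + s)) n)
  + zeta_cont p * (zeta_cont (q + s) - csum (dterm (q + s)) n)
  + zeta_cont q * (zeta_cont (p + s) - csum (dterm (p + s)) n)
  + (Clim (csum (fun n => conv_remainder p q B n * dterm s n)) - csum (fun n => conv_remainder p q B n * dterm s n) n))%C
  by ring end.
replace ((51 * (Cmod B + Cmod (zeta_cont p) + Cmod (zeta_cont q)) + Kr) * X) with
 (Cmod B * (51 * X) + Cmod (zeta_cont p) * (51 * X) + Cmod (zeta_cont q) * (51 * X) + Kr * X) by ring.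
repeat apply Cmod_triangle_le; try (apply Cmod_mult_le; [apply Rle_refl|assumption]).
eapply Rle_trans; [exact A4|exact A5].
Qed.

(** * The mean square *)

Definition coef (p q : C) (c : R) (i : nat) : C := (inner_conv p q (S i) * dterm (RtoC c) i)%C.

Lemma csum_dirichlet_poly (p q : C) (c t : R) (n : nat) :
  csum (fun n => inner_conv p q (S n) * dterm (c, t) n)%C n =
  dirichlet_poly (coef p q c) (fun i => ln (INR (S i))) n t.
Proof.
unfold dirichlet_poly; apply csum_ext; intros i _; unfold oscillation, coef.
rewrite <- Cmult_assoc; f_equal; unfold dterm, xpow; rewrite <- cexp_plus; f_equal.
apply injective_projections; simpl; ring.
Qed.

Lemma coef_bound (p q B : C) (c E : R) : 0 <= E ->
  (forall n, Cmod (conv_remainder p q B n) <= E * Rpower (INR (S n)) (- (Re p + Re q))) ->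
  Re p <= 1 -> Re q <= 1 ->
  exists C0, 0 <= C0 /\ forall i,
   Cmod (coef p q c i) <= C0 * Rpower (INR (S i)) (- (Re p + Re q + c - 1)).
Proof.
intros HE Hr Hp Hq.
pose proof (Cmod_ge_0 B); pose proof (Cmod_ge_0 (zeta_cont p)); pose proof (Cmod_ge_0 (zeta_cont q)).
exists (Cmod B + Cmod (zeta_cont p) + Cmod (zeta_cont q) + E); split; [lra|]; intros i.
pose proof (INR_S_ge_1 i) as Hi; set (k := INR (S i)) in *.
set (P := Rpower k (- (Re p + Re q - 1))).
unfold coef.
replace (- (Re p + Re q + c - 1)) with (- (Re p + Re q - 1) + - c) by ring.
rewrite Rpower_plus, <- Rmult_assoc; fold P.
apply Cmod_mult_le; [|rewrite Cmod_dterm; apply Rle_refl].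
replace (inner_conv p q (S i)) with
 (B * dterm (p + q - 1) i + zeta_cont p * dterm q i + zeta_cont q * dterm p i + conv_remainder p q B i)%C by (unfold conv_remainder; ring).
replace ((Cmod B + Cmod (zeta_cont p) + Cmod (zeta_cont q) + E) * P) with
 (Cmod B * P + Cmod (zeta_cont p) * P + Cmod (zeta_cont q) * P + E * P) by ring.
repeat apply Cmod_triangle_le.
- apply Cmod_mult_le; [lra|rewrite Cmod_dterm; apply Rle_refl].
- apply Cmod_mult_le; [lra|rewrite Cmod_dterm; apply Rpower_le_exp; auto; lra].
- apply Cmod_mult_le; [lra|rewrite Cmod_dterm; apply Rpower_le_exp; auto; lra].
- eapply Rle_trans; [apply Hr|]. apply Rmult_le_compat_l; auto.
  apply Rpower_le_exp; auto; lra.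
Qed.

Lemma csum_RtoC (f : nat -> R) n : csum (fun i => RtoC (f i)) n = RtoC (rsum f n).
Proof. induction n; cbn [csum rsum]; [reflexivity|rewrite IHn, RtoC_plus; reflexivity]. Qed.

(** [zetaMT2_sq] starts at k = 2, whereas the Dirichlet polynomial starts at k = 1, where the
    convolution is empty; [f O = 0] reconciles the two. *)
Lemma Series_tail (f V : nat -> R) : tendsto0 V -> (forall n, 0 <= V n) ->
  f O = 0 -> (forall i, 0 <= f i <= V i - V (S i)) ->
  forall n, Rabs (Series (fun j => f (S j)) - rsum f n) <= V n.
Proof.
intros HV HV0 Hf0 Hf.
destruct (clim_complete (fun n => csum (fun i => RtoC (f i)) n) V HV) as [HL HT].
{ intros N M HNM; eapply Rle_trans; [apply (csum_tail_le _ V); auto|].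
  - intros k _; rewrite Cmod_R, Rabs_pos_eq; apply Hf.
  - specialize (HV0 M); lra. }
set (L := Clim (fun n => csum (fun i => RtoC (f i)) n)) in *.
assert (HTR : forall n, Rabs (Re L - rsum f n) <= V n).
{ intros n; eapply Rle_trans; [|apply (HT n)]. rewrite csum_RtoC.
  apply (re_le_Cmod (L - RtoC (rsum f n))). }
assert (HS : is_series (fun j => f (S j)) (Re L)).
{ cut (is_lim_seq (sum_n (fun j => f (S j))) (Re L)); [exact (fun H => H)|].
  apply is_lim_seq_spec; intros eps.
  destruct (HV eps (cond_pos eps)) as [N HN]; exists N; intros n Hn.
  replace (sum_n (fun j => f (S j)) n) with (rsum f (S (S n))).
  - rewrite Rabs_minus_sym; eapply Rle_lt_trans; [apply HTR|apply HN; lia].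
  - rewrite rsum_shift, Hf0, Rplus_0_l. clear.
    induction n; [rewrite sum_O; cbn [rsum]; apply Rplus_0_l|].
    rewrite sum_Sn, <- IHn; reflexivity. }
intros n; rewrite (is_series_unique _ _ HS); apply HTR.
Qed.

Lemma zetaMT2_sq_coef (p q : C) (c : R) :
  zetaMT2_sq p q (2 * c) = Series (fun j => Cmod (coef p q c (S j)) ^ 2).
Proof.
unfold zetaMT2_sq; apply Series_ext; intros j.
replace (j + 2)%nat with (S (S j)) by lia.
unfold coef; rewrite Cmod_mult, Rpow_mult_distr, Cmod_dterm; f_equal.
unfold rpow_neg, Rpower; simpl Re.
replace (exp (- c * ln (INR (S (S j)))) ^ 2) with
 (exp (- c * ln (INR (S (S j)))) * exp (- c * ln (INR (S (S j))))) by ring.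
rewrite <- exp_plus; f_equal; ring.
Qed.

(** A pointwise substitute for Cauchy-Schwarz: 2 |b| e <= lam |b|^2 + e^2 / lam, with e^2 itself
    absorbed because lam <= 1. The weight can then be chosen once for the whole interval of
    integration. *)
Lemma Cmod2_perturb (a b : C) (e lam : R) : 0 < lam <= 1 -> Cmod (a - b) <= e ->
  Cmod b ^ 2 - (lam * Cmod b ^ 2 + 2 / lam * e ^ 2) <= Cmod a ^ 2 <=
  Cmod b ^ 2 + (lam * Cmod b ^ 2 + 2 / lam * e ^ 2).
Proof.
intros Hl He.
pose proof (Cmod_ge_0 a) as Ha; pose proof (Cmod_ge_0 b) as Hb.
pose proof (Cmod_ge_0 (a - b)) as Hab.
assert (H1 : Cmod a <= Cmod b + e).
{ replace a with (b + (a - b))%C by ring; apply Cmod_triangle_le; lra. }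
assert (H2 : Cmod b <= Cmod a + e).
{ replace b with (a - (a - b))%C by ring; apply Cmod_minus_le; lra. }
set (x := Cmod a) in *; set (y := Cmod b) in *.
assert (HA : 2 * y * e <= lam * y ^ 2 + e ^ 2 / lam).
{ assert (E : lam * y ^ 2 + e ^ 2 / lam - 2 * y * e = (lam * y - e) ^ 2 / lam) by (field; lra).
  assert (0 <= (lam * y - e) ^ 2 / lam) by (apply Rdiv_le_0_compat; [apply pow2_ge_0|lra]).
  lra. }
assert (HB : e ^ 2 <= e ^ 2 / lam).
{ apply (Rle_div_r (e ^ 2) (e ^ 2) lam); [lra|]. pose proof (pow2_ge_0 e). set (X := e ^ 2) in *; clearbody X; nra. }
replace (2 / lam * e ^ 2) with (e ^ 2 / lam + e ^ 2 / lam) by (field; lra).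
split; nra.
Qed.

Lemma is_RInt_inv_sq (k u w : R) : 0 < u <= w ->
  is_RInt (fun t => k / t ^ 2) u w (k / u - k / w).
Proof.
intros Hu.
replace (k / u - k / w) with (minus ((fun t => - k / t) w) ((fun t => - k / t) u)).
- apply (is_RInt_derive (V := R_CompleteNormedModule) (fun t => - k / t)).
  + intros x Hx; rewrite Rmin_left, Rmax_right in Hx by lra.
    auto_derive; [lra|eq_as_R; field; lra].
  + intros x Hx; rewrite Rmin_left, Rmax_right in Hx by lra.
    apply (ex_derive_continuous (fun t => k / t ^ 2)); auto_derive.
    assert (0 < x * x) by nra. simpl; lra.
- change (- k / w - - k / u = k / u - k / w). field; lra.
Qed.

Lemma ex_RInt_Cmod2 (f : C -> C) (c u w : R) : u <= w ->
  (forall t, u <= t <= w -> cdiff f (c, t)) ->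
  ex_RInt (fun t => Cmod (f (c, t)) ^ 2) u w.
Proof.
intros Huw H; apply (ex_RInt_continuous (V := R_CompleteNormedModule)).
intros t Ht; rewrite Rmin_left, Rmax_right in Ht by lra.
assert (Hc : continuous (fun t => Cmod (f (c, t))) t).
{ apply (rcont_Cmod (fun t => f (c, t))), rcont_ver, cdiff_ccont, H, Ht. }
apply (continuous_ext (fun t => mult (Cmod (f (c, t))) (Cmod (f (c, t))))).
- intros x; unfold mult; simpl; eq_as_R; ring.
- apply (continuous_mult (K := R_AbsRing)); exact Hc.
Qed.

(** The 4 secures 2 (M + t) + 2 <= N for all t <= T as soon as T >= M + 1; the 5 leaves room for an
    integer. *)
Lemma exists_cutoff (T : R) : 1 <= T -> exists n : nat, 4 * T <= INR (S n) <= 5 * T.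
Proof.
intros HT; destruct (nfloor_ex (4 * T)) as [n Hn]; [lra|].
exists n; rewrite S_INR; lra.
Qed.

(* The weight [lam = T ^ (3/2 - al)] balances the two error terms of [Cmod2_perturb]. *)
Lemma mean_square_MTcont (p q B : C) (c E : R) (f : C -> C) : 0 <= E ->
  (forall n, Cmod (conv_remainder p q B n) <= E * Rpower (INR (S n)) (- (Re p + Re q))) ->
  0 < c -> 0 <= Im p -> 0 <= Im q -> Re p <= 1 -> Re q <= 1 ->
  Re p + c <= 1 -> Re q + c <= 1 -> 3 / 2 < Re p + Re q + c ->
  (forall t, 2 <= t -> cdiff f (c, t)) ->
  (forall t, 2 <= t -> f (c, t) = MTcont p q B (c, t)) ->
  exists K T0 : R, forall T : R, T0 <= T ->
     Rabs (RInt (fun t => (Cmod (f (c, t))) ^ 2) 2 T - zetaMT2_sq p q (2 * c) * T)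
     <= K * Rpower T (5 / 2 - (Re p + Re q + c)).
Proof.
intros HE Hr Hc Ip Iq Hp Hq Hpc Hqc Hal Hfd Hf.
destruct (MTcont_error p q B c E HE Hr Hc Ip Iq Hp Hq Hpc Hqc Hal) as [K1 [M [HK1 Herr]]].
destruct (coef_bound p q B c E HE Hr Hp Hq) as [C0 [HC0 Hcoef]].
set (al := Re p + Re q + c) in *.
assert (Hal2 : al < 2) by (unfold al; lra).
set (be := al - 1) in *.
assert (Hbe : 1 / 2 < be < 1) by (unfold be; lra).
destruct (offdiag_bound (coef p q c) C0 be Hbe HC0 Hcoef) as [Q [HQ HoffQ]].
set (ff := fun i => Cmod (coef p q c i) ^ 2).
(* The squared coefficients are O(k^(-2 be)) = O(k^(-1-e)), summable because be > 1/2. *)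
set (e := 2 * be - 1). assert (He : 0 < e) by (unfold e; lra).
assert (HC2 : 0 <= C0 * C0) by nra.
assert (Hff : forall i, 0 <= ff i <= ptail (C0 * C0) e i - ptail (C0 * C0) e (S i)).
{ intros i; unfold ff; split; [apply pow2_ge_0|].
  eapply Rle_trans; [|apply ptail_diff; auto].
  replace (-1 - e) with (- be + - be) by (unfold e; ring).
  rewrite Rpower_plus.
  replace (C0 * C0 * (Rpower (INR (S i)) (- be) * Rpower (INR (S i)) (- be))) with
   ((C0 * Rpower (INR (S i)) (- be)) ^ 2) by ring.
  apply pow_incr; split; [apply Cmod_ge_0|apply Hcoef]. }
pose proof (Series_tail ff (ptail (C0 * C0) e) (ptail_tendsto0 _ e HC2 He)
  (fun n => ptail_pos _ e n HC2 He)) as HS.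
assert (Hff0 : ff O = 0).
{ unfold ff, coef. replace (inner_conv p q 1) with (RtoC 0) by reflexivity.
  rewrite Cmult_0_l, Cmod_0; ring. }
specialize (HS Hff0 Hff).
rewrite (zetaMT2_sq_coef p q c).
change (Series (fun j => Cmod (coef p q c (S j)) ^ 2)) with (Series (fun j => ff (S j))).
set (A := Series (fun j => ff (S j))) in *.
assert (HA : 0 <= A).
{ pose proof (HS O) as H0. apply Rnot_lt_le; intros Hneg.
  destruct (ptail_tendsto0 (C0 * C0) e HC2 He (- A) ltac:(lra)) as [N HN].
  specialize (HN N (le_n N)); specialize (HS N).
  assert (0 <= rsum ff N).
  { rewrite <- (Rmult_0_r (INR N)), <- (rsum_const 0); apply rsum_le; intros; apply Hff. }
  rewrite Rabs_minus_sym in HS. pose proof (Rle_abs (rsum ff N - A)). lra. }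
set (V0 := C0 * C0 * (Rpower 2 (1 + e) / e)).
assert (HV0 : 0 <= V0) by (unfold V0; apply Rmult_le_pos; auto; left; apply ptail_const_pos; auto).
(* The powers of 5 here and in [K5] come from N <= 5 T. *)
set (Q5 := Q * Rpower 5 (5 / 2 - al)).
assert (HQ5 : 0 <= Q5) by (unfold Q5; apply Rmult_le_pos; auto; left; apply Rpower_pos).
set (K5 := K1 * K1 * Rpower 5 (4 - 2 * al)).
assert (HK5 : 0 <= K5) by (unfold K5; apply Rmult_le_pos; [nra|left; apply Rpower_pos]).
exists ((A + V0 + Q5 + K5) + Q5 + (2 * (A + V0) + V0)), (Rmax 2 (M + 1)).
intros T HT.
assert (HT2 : 2 <= T) by (eapply Rle_trans; [apply Rmax_l|exact HT]).
assert (HTM : M + 1 <= T) by (eapply Rle_trans; [apply Rmax_r|exact HT]).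
set (Y := Rpower T (5 / 2 - al)).
assert (HY1 : 1 <= Y) by (apply Rpower_ge_1; lra).
destruct (exists_cutoff T ltac:(lra)) as [n [Hn1 Hn2]].
set (N := INR (S n)) in *.
destruct (dirichlet_mean_square (coef p q c) (fun i => ln (INR (S i))) 2 T n HT2) as [v [Hv Bv]].
{ intros i j Hij; apply ln_increasing; [apply INR_S_pos|apply lt_INR; lia]. }
fold ff in Bv.
assert (HNY : Rpower N (3 / 2 - be) <= Rpower 5 (5 / 2 - al) * Y).
{ replace (3 / 2 - be) with (5 / 2 - al) by (unfold be; field).
  unfold Y; rewrite Rpower_mult_distr by lra. apply Rpower_le_base; lra. }
assert (Bv' : Rabs (v - (T - 2) * rsum ff n) <= Q5 * Y).
{ eapply Rle_trans; [exact Bv|]. eapply Rle_trans; [apply HoffQ|]. fold N.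
  unfold Q5; rewrite Rmult_assoc; apply Rmult_le_compat_l; auto. }
assert (Htail : Rabs (A - rsum ff n) <= V0 * Rpower N (- e)) by exact (HS n).
assert (HNe1 : Rpower N (- e) <= 1) by (apply Rpower_le_1; lra).
(* Truncating the diagonal costs T N^(-e), of exponent 1 - e = 4 - 2 alpha, which is below 5/2 -
   alpha since alpha > 3/2. *)
assert (HNe : T * Rpower N (- e) <= Y).
{ apply Rle_trans with (T * Rpower T (- e)).
  - apply Rmult_le_compat_l; [lra|]. apply Rpower_le_base_neg; lra.
  - rewrite <- Rpower_succ by lra. apply Rpower_le_exp; [lra|]. unfold e, be; lra. }
assert (HSig : 0 <= rsum ff n <= A + V0).
{ split.
  - rewrite <- (Rmult_0_r (INR n)), <- (rsum_const 0); apply rsum_le; intros; apply Hff.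
  - rewrite Rabs_minus_sym in Htail. pose proof (Rle_abs (rsum ff n - A)).
    pose proof (Rpower_pos N (- e)). nra. }
set (lam := Rpower T (3 / 2 - al)).
assert (Hlam : 0 < lam <= 1) by (split; [apply Rpower_pos|apply Rpower_le_1; lra]).
assert (HlT : lam * T = Y).
{ unfold lam, Y; rewrite Rmult_comm, <- Rpower_succ by lra; f_equal; field. }
set (G := K1 * Rpower N (2 - al)).
assert (HG0 : 0 <= G) by (apply Rmult_le_pos; auto; left; apply Rpower_pos).
assert (HG : / lam * (G * G) <= K5 * Y).
{ replace (G * G) with (K1 * K1 * Rpower N (4 - 2 * al)).
  2: { unfold G; replace (4 - 2 * al) with ((2 - al) + (2 - al)) by ring.
       rewrite Rpower_plus; ring. }
  assert (HN5 : Rpower N (4 - 2 * al) <= Rpower 5 (4 - 2 * al) * Rpower T (4 - 2 * al)).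
  { rewrite Rpower_mult_distr by lra. apply Rpower_le_base; lra. }
  assert (HE2 : / lam * Rpower T (4 - 2 * al) = Y).
  { unfold lam, Y; rewrite <- Rpower_Ropp, <- Rpower_plus; f_equal; field. }
  rewrite <- HE2; unfold K5.
  assert (0 < / lam) by (apply Rinv_0_lt_compat; lra).
  replace (K1 * K1 * Rpower 5 (4 - 2 * al) * (/ lam * Rpower T (4 - 2 * al))) with
   (/ lam * (K1 * K1 * (Rpower 5 (4 - 2 * al) * Rpower T (4 - 2 * al)))) by ring.
  apply Rmult_le_compat_l; [lra|]. apply Rmult_le_compat_l; nra. }
destruct (ex_RInt_Cmod2 f c 2 T HT2) as [I HI]; [intros t Ht; apply Hfd; lra|].
change R in I.
rewrite (is_RInt_unique _ _ _ _ HI).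
set (P := fun t => Cmod (dirichlet_poly (coef p q c) (fun i => ln (INR (S i))) n t) ^ 2) in *.
set (g := fun t => 2 / lam * (G * G) / t ^ 2).
assert (Hg : is_RInt g 2 T (2 / lam * (G * G) / 2 - 2 / lam * (G * G) / T))
 by (apply is_RInt_inv_sq; lra).
assert (Hpt : forall t, 2 < t < T ->
  P t - (lam * P t + g t) <= Cmod (f (c, t)) ^ 2 <= P t + (lam * P t + g t)).
{ intros t Ht; rewrite Hf by lra; unfold P, g.
  replace (2 / lam * (G * G) / t ^ 2) with (2 / lam * (G / t) ^ 2) by (field; lra).
  apply Cmod2_perturb; auto.
  rewrite <- csum_dirichlet_poly.
  replace (G / t) with (K1 * (Rpower N (2 - al) / t)) by (unfold G; field; lra).
  apply Herr; [lra|]. fold N; lra. }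
assert (Hlp : is_RInt (fun t => lam * P t) 2 T (lam * v)) by exact (is_RInt_scal _ _ _ lam _ Hv).
set (D := 2 / lam * (G * G) / 2 - 2 / lam * (G * G) / T) in *.
assert (Hlg : is_RInt (fun t => lam * P t + g t) 2 T (lam * v + D))
 by exact (is_RInt_plus _ _ _ _ _ _ Hlp Hg).
assert (Hup : I <= v + (lam * v + D)).
{ apply (is_RInt_le (fun t => Cmod (f (c, t)) ^ 2) (fun t => P t + (lam * P t + g t)) 2 T); auto.
  - exact (is_RInt_plus _ _ _ _ _ _ Hv Hlg).
  - intros t Ht; apply Hpt; auto. }
assert (Hlo : v - (lam * v + D) <= I).
{ apply (is_RInt_le (fun t => P t - (lam * P t + g t)) (fun t => Cmod (f (c, t)) ^ 2) 2 T); auto.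
  - exact (is_RInt_minus _ _ _ _ _ _ Hv Hlg).
  - intros t Ht; apply Hpt; auto. }
assert (HD : D <= K5 * Y).
{ assert (0 < / lam) by (apply Rinv_0_lt_compat; lra).
  assert (0 <= 2 / lam * (G * G) / T) by (apply Rdiv_le_0_compat; [|lra]; apply Rmult_le_pos; [unfold Rdiv|]; nra).
  unfold D. replace (2 / lam * (G * G) / 2) with (/ lam * (G * G)) by (field; lra). lra. }
assert (Hv2 : lam * v <= (A + V0 + Q5) * Y).
{ assert (v <= T * (A + V0) + Q5 * Y).
  { pose proof (Rle_abs (v - (T - 2) * rsum ff n)). nra. }
  apply Rle_trans with (lam * (T * (A + V0) + Q5 * Y)); [apply Rmult_le_compat_l; lra|].
  rewrite Rmult_plus_distr_l, <- Rmult_assoc, HlT.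
  assert (0 <= Q5 * Y) by nra. nra. }
assert (HIv : Rabs (I - v) <= (A + V0 + Q5 + K5) * Y) by (apply Rabs_le; lra).
assert (H3 : Rabs ((T - 2) * rsum ff n - A * T) <= (2 * (A + V0) + V0) * Y).
{ replace ((T - 2) * rsum ff n - A * T) with (- (2 * rsum ff n) + - (T * (A - rsum ff n))) by ring.
  eapply Rle_trans; [apply Rabs_triang|].
  rewrite !Rabs_Ropp, (Rabs_mult T), (Rabs_pos_eq T), (Rabs_pos_eq (2 * rsum ff n)) by lra.
  assert (T * Rabs (A - rsum ff n) <= V0 * Y).
  { apply Rle_trans with (T * (V0 * Rpower N (- e))); [apply Rmult_le_compat_l; lra|].
    replace (T * (V0 * Rpower N (- e))) with (V0 * (T * Rpower N (- e))) by ring.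
    apply Rmult_le_compat_l; auto. }
  nra. }
replace (I - A * T) with ((I - v) + (v - (T - 2) * rsum ff n) + ((T - 2) * rsum ff n - A * T)) by ring.
eapply Rle_trans; [eapply Rle_trans; [apply Rabs_triang|apply Rplus_le_compat_r, Rabs_triang]|].
lra.
Qed.

Theorem theorem1p4 (s1 s2 : C) (sigma3 : R) (Z : C -> C) :
  is_zetaMT2_in_s3 s1 s2 Z ->
  0 <= Re s1 -> 0 <= Re s2 -> 0 < sigma3 ->
  0 <= Im s1 -> 0 <= Im s2 ->
  Re s1 + sigma3 <= 1 -> Re s2 + sigma3 <= 1 ->
  Re s1 + Re s2 + sigma3 > 3 / 2 ->
  (forall t3 : R, 2 <= t3 ->
     (s1 + (sigma3, t3))%C <> RtoC 1 /\
     (s2 + (sigma3, t3))%C <> RtoC 1 /\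
     (s1 + s2 + (sigma3, t3))%C <> RtoC 2) ->
  (Re s1 + Re s2 + sigma3 < 2 ->
   exists K T0 : R, forall T : R, T0 <= T ->
     Rabs (RInt (fun t3 => (Cmod (Z (sigma3, t3))) ^ 2) 2 T
           - zetaMT2_sq s1 s2 (2 * sigma3) * T)
     <= K * Rpower T (5 / 2 - (Re s1 + Re s2 + sigma3))) /\
  (Re s1 + Re s2 + sigma3 = 2 ->
   exists K T0 : R, forall T : R, T0 <= T ->
     Rabs (RInt (fun t3 => (Cmod (Z (sigma3, t3))) ^ 2) 2 T
           - zetaMT2_sq s1 s2 (2 * sigma3) * T)
     <= K * sqrt (T * ln T)).
Proof.
intros HZ H1 H2 H3 I1 I2 H13 H23 Hal _.
(* From sigma2 <= 1 - sigma3 < 1 and sigma1 + sigma3 <= 1 follows alpha < 2, which contradicts the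
   second case. *)
split; [intros _|intros H; exfalso; lra].
destruct (inner_conv_asymp s1 s2 ltac:(lra) ltac:(lra)) as [B [E [HE Hr]]].
apply (mean_square_MTcont s1 s2 B sigma3 E Z); auto; try lra.
- intros t Ht; apply cdiff_of_ex_derive, (proj1 HZ), not_MT_singular; auto; simpl; lra.
- intros t Ht; apply (zetaMT2_eq_MTcont s1 s2 B Z E); auto; simpl; lra.
Qed.
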